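(* Let $n\ge2$, $0<\alpha<1$, $1\le p\le\infty$, $1\le q\le\infty$, and $1/p+1/p'=1$. (i) If $p=1$, then $R_+^\alpha$ is an operator of weak $(1,q)$-type with $1/q=1-\alpha$; that is, there is a constant $c$ such that for all $f\in L^1(\mathbb{R}^n)$ and all $\lambda>0$, $$m\{(\theta,t)\in Z_n:\ |(R_+^\alpha f)(\theta,t)|>\lambda\}\le c\left(\frac{\|f\|_1}{\lambda}\right)^{1/(1-\alpha)} .$$ (ii) The inequality $$\|R_+^\alpha f\|_{L^q(Z_n)}\le c\,\|f\|_p\quad\text{for all } f\in L^p(\mathbb{R}^n),\qquad c=\mathrm{const},$$ holds if and only if $$1<p\le p_\alpha,\qquad p_\alpha=\frac{n+1}{n+\alpha},\qquad \frac1q=1-\alpha-\frac{n}{p'} .$$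
   Context: $Z_n=S^{n-1}\times\mathbb{R}$ is equipped with the product measure $d\theta\,dt$, where $d\theta$ is the surface area measure on the unit sphere $S^{n-1}\subset\mathbb{R}^n$; $m\{\cdot\}$ denotes this measure of a set. $\|\cdot\|_p$ is the norm of $L^p(\mathbb{R}^n)$. For real $X$ and complex $\lambda$, $(X)_+^\lambda=|X|^\lambda$ if $X>0$ and $0$ otherwise. The operator $R_+^\alpha$ is given by $$(R_+^\alpha f)(\theta,t)=\frac1{\Gamma(\alpha)}\int_{\mathbb{R}^n}(t-x\cdot\theta)_+^{\alpha-1}f(x)\,dx,\qquad(\theta,t)\in Z_n .$$ *)

(* Defs.v *)
From HB Require Import structures.
From mathcomp Require Import all_boot all_order all_algebra.
From mathcomp Require Import all_classical all_reals all_analysis.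
From mathcomp Require Import measurable_realfun.
From mathcomp.real_closed Require Import complex.

Set Implicit Arguments.
Unset Strict Implicit.
Unset Printing Implicit Defensive.

Import Order.TTheory GRing.Theory Num.Theory.
Import numFieldNormedType.Exports.

Local Open Scope classical_set_scope.
Local Open Scope complex_scope.
Local Open Scope ring_scope.

(* Points of R^n are n-tuples, which carry the product (Borel) sigma-algebra. *)
Definition dotp (R : realType) (n : nat) (x y : n.-tuple R) : R :=
  \sum_(i < n) tnth x i * tnth y i.

Definition enorm (R : realType) (n : nat) (x : n.-tuple R) : R :=
  Num.sqrt (dotp x x).

Definition normalize (R : realType) (n : nat) (x : n.-tuple R) : n.-tuple R :=
  [tuple tnth x i / enorm x | i < n].

Definition usphere (R : realType) (n : nat) : set (n.-tuple R) :=
  [set x | enorm x = 1].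
Arguments usphere : clear implicits.

Definition punctured_ball (R : realType) (n : nat) : set (n.-tuple R) :=
  [set x | 0 < enorm x <= 1].
Arguments punctured_ball : clear implicits.

Section measurability.
Context (R : realType) (n : nat).

Lemma measurable_enorm : measurable_fun [set: n.-tuple R] (@enorm R n).
Proof.
apply: (@measurableT_comp _ _ _ _ _ _ (@Num.sqrt R)).
  exact: continuous_measurable_fun (@sqrt_continuous R).
apply: measurable_sum => i.
by apply: measurable_funM; exact: measurable_tnth.
Qed.

Lemma measurable_normalize : measurable_fun [set: n.-tuple R] (@normalize R n).
Proof.
apply/measurable_fun_tnthP => i.
rewrite (_ : _ \o _ = (fun x => tnth x i * (enorm x) `^ (-1))); last first.
  by apply/funext => x /=; rewrite tnth_mktuple powR_inv1// sqrtr_ge0.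
apply: measurable_funM; first exact: measurable_tnth.
apply: (@measurableT_comp _ _ _ _ _ _ (fun y : R => y `^ (-1))) => //.
exact: measurable_enorm.
Qed.

Lemma measurable_punctured_ball : measurable (punctured_ball R n).
Proof.
rewrite (_ : punctured_ball R n = setT `&` @enorm R n @^-1` `]0, 1]).
  exact: measurable_enorm.
by apply/seteqP; split => x /=; rewrite in_itv//= => -[].
Qed.

Lemma measurable_cons_pair :
  measurable_fun [set: n.-tuple R * measurableTypeR R]
    (fun z => [tuple of z.2 :: z.1] : n.+1.-tuple R).
Proof. exact: measurable_cons. Qed.

End measurability.


Section lebesgue_tuple.
Context (R : realType).
Local Open Scope ereal_scope.

(* The product of lebesgue_measure with itself on R^n; the first coordinate is
   split off, as in R^(n+1) = R^n * R with (x, t) standing for t :: x. *)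
Fixpoint lebesgue_tuple (n : nat) : set (n.-tuple R) -> \bar R :=
  match n with
  | 0 => dirac [tuple]
  | m.+1 => pushforward (@lebesgue_tuple m \x lebesgue_measure)
              (fun z : m.-tuple R * measurableTypeR R => [tuple of z.2 :: z.1])
  end.
Arguments lebesgue_tuple : clear implicits.

Lemma lebesgue_tuple_measure (n : nat) :
  exists mu : {measure set (n.-tuple R) -> \bar R},
    lebesgue_tuple n = mu :> (set _ -> \bar R).
Proof.
elim: n => [|n [mu muE]]; first by exists (dirac [tuple]).
rewrite /= muE.
by exists (measure_function_pushforward__canonical__measure_function_Measure
  (mu \x lebesgue_measure) (@measurable_cons_pair R n)).
Qed.

Section instance.
Variable n : nat.

Let lebesgue_tuple0 : lebesgue_tuple n set0 = 0.
Proof. by have [mu ->] := lebesgue_tuple_measure n; exact: measure0. Qed.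

Let lebesgue_tuple_ge0 A : 0 <= lebesgue_tuple n A.
Proof. by have [mu ->] := lebesgue_tuple_measure n; exact: measure_ge0. Qed.

Let lebesgue_tuple_sigma_additive : semi_sigma_additive (lebesgue_tuple n).
Proof.
have [mu ->] := lebesgue_tuple_measure n; exact: measure_semi_sigma_additive.
Qed.

HB.instance Definition _ := isMeasure.Build _ _ _ (lebesgue_tuple n)
  lebesgue_tuple0 lebesgue_tuple_ge0 lebesgue_tuple_sigma_additive.
End instance.

End lebesgue_tuple.
Arguments lebesgue_tuple : clear implicits.

Section surface_measure.
Context (R : realType) (n : nat).
Local Open Scope ereal_scope.

(* Surface area on the unit sphere, as a measure on R^n that is concentrated on
   the sphere: the area of A is n times the volume of the cone over A, that is,
   of the points r *: theta with theta in A and 0 < r <= 1. *)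
Definition surface_measure (A : set (n.-tuple R)) : \bar R :=
  n%:R%:E * lebesgue_tuple R n (@normalize R n @^-1` A `&` punctured_ball R n).

Let restr : {measure set (n.-tuple R) -> \bar R} :=
  mrestr (lebesgue_tuple R n) (@measurable_punctured_ball R n).

Let cone : {measure set (n.-tuple R) -> \bar R} :=
  measure_function_pushforward__canonical__measure_function_Measure
    restr (@measurable_normalize R n).

Let surface_measureE : surface_measure = mscale (n%:R%:nng)%R cone.
Proof. by []. Qed.

Let surface_measure0 : surface_measure set0 = 0.
Proof. by rewrite surface_measureE; exact: measure0. Qed.

Let surface_measure_ge0 A : 0 <= surface_measure A.
Proof. by rewrite surface_measureE; exact: measure_ge0. Qed.

Let surface_measure_sigma_additive : semi_sigma_additive surface_measure.
Proof. by rewrite surface_measureE; exact: measure_semi_sigma_additive. Qed.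

HB.instance Definition _ := isMeasure.Build _ _ _ surface_measure
  surface_measure0 surface_measure_ge0 surface_measure_sigma_additive.

End surface_measure.
Arguments surface_measure : clear implicits.

Lemma enorm_normalize (R : realType) (n : nat) (x : n.-tuple R) :
  0 < enorm x -> enorm (normalize x) = 1.
Proof.
move=> x0; rewrite {1}/enorm (_ : dotp _ _ = 1) ?sqrtr1//.
rewrite /dotp (eq_bigr (fun i => tnth x i * tnth x i / enorm x ^+ 2)); last first.
  by move=> i _; rewrite tnth_mktuple mulf_div -expr2.
rewrite -mulr_suml -/(dotp x x) /enorm sqr_sqrtr; last first.
  by apply: sumr_ge0 => i _; rewrite -expr2 sqr_ge0.
by rewrite divff// lt0r_neq0// -sqrtr_gt0.
Qed.

Lemma surface_measure_usphereC (R : realType) (n : nat) :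
  surface_measure R n (~` usphere R n) = 0%E.
Proof.
rewrite /surface_measure (_ : _ `&` _ = set0) ?measure0 ?mule0//.
apply/seteqP; split => // x [] /= xS /andP[x0 _].
by apply: xS; exact: enorm_normalize.
Qed.

Definition Zn (R : realType) (n : nat) : set (n.-tuple R * R) :=
  usphere R n `*` setT.
Arguments Zn : clear implicits.

(* d(theta) dt; it vanishes outside Zn by surface_measure_usphereC, so that its
   L^q norms are those of L^q(Zn). *)
Definition Zn_measure (R : realType) (n : nat) :
    {measure set (n.-tuple R * measurableTypeR R) -> \bar R} :=
  (surface_measure R n \x lebesgue_measure)%E.
Arguments Zn_measure : clear implicits.

Definition Gamma (R : realType) (a : R) : R :=
  \int[lebesgue_measure]_(x in `]0, +oo[) (x `^ (a - 1) * expR (- x)).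

Definition plus_power (R : realType) (X l : R) : R :=
  if 0 < X then `|X| `^ l else 0.

Section complex_valued.
Context d (T : measurableType d) (R : realType).
Implicit Types (mu : {measure set T -> \bar R}) (f : T -> R[i]).

Definition cmeasurable f :=
  measurable_fun [set: T] (fun x => complex.Re (f x)) /\
  measurable_fun [set: T] (fun x => complex.Im (f x)).

Definition cintegrable mu f :=
  mu.-integrable [set: T] (fun x => (complex.Re (f x))%:E) /\
  mu.-integrable [set: T] (fun x => (complex.Im (f x))%:E).

Definition cintegral mu f : R[i] :=
  (\int[mu]_x complex.Re (f x)) +i* (\int[mu]_x complex.Im (f x)).

Definition cLnorm mu (p : \bar R) f : \bar R :=
  Lnorm mu p (fun x => (ComplexField.Normc.normc (f x))%:E).

(* Measurability is Borel: every class in L^p has a Borel representative. *)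
Definition cLp mu (p : \bar R) : set (T -> R[i]) :=
  [set f | cmeasurable f /\ (cLnorm mu p f < +oo)%E].

End complex_valued.

Section Rplus.
Context (R : realType) (n : nat).
Implicit Types (a : R) (f : n.-tuple R -> R[i]) (z : n.-tuple R * R).

Definition Rplus_integrand a f z (x : n.-tuple R) : R[i] :=
  (plus_power (z.2 - dotp x z.1) (a - 1))%:C * f x.

Definition Rplus a f z : R[i] :=
  ((Gamma a)^-1)%:C * cintegral (lebesgue_tuple R n) (Rplus_integrand a f z).

(* The integral defining R_+^a f converges absolutely almost everywhere on
   Z_n; where it does not, the value of Rplus is meaningless. *)
Definition Rplus_exists a f : Prop :=
  {ae Zn_measure R n, forall z,
    cintegrable (lebesgue_tuple R n) (Rplus_integrand a f z)}.

End Rplus.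

(* Main.v *)
(* Sufficiency.  The modulus of R_+^a f is bounded by the transform of |f|
   with kernel |t - x.theta|^(a-1).  For the weak type bound, integrate that
   kernel over a set E of finite measure and split at |t - x.theta| = m(E).
   For the strong bound put e = 1/p' and use the chart theta = (1, u)/|(1, u)|
   of the sphere: with the first coordinate of R^n split off, the integral over
   a hyperplane becomes f |-> int f(v - u.x, x) dx.  Its mixed norm estimates
   are obtained one variable at a time: the estimate in the plane follows by
   duality, Young's inequality and the trilinear Hardy-Littlewood-Sobolev
   inequality from the fact that two lines of distinct slopes are transversal,
   and the step to more variables is Minkowski's inequality.  A fractional
   integration in t, again by Hardy-Littlewood-Sobolev, then gives the bound
   for R_+^a.

   Necessity.  Take f to be the indicator of
   {|x_1| <= l d, |x_i| <= l for i >= 2}, with theta within d of the first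
   axis and t of size l d.  Varying l gives 1/q = 1 - a - n/p', and d -> 0
   gives p <= p_a.  For p = 1, |R_+^a f|^q is of size 1/t at infinity. *)

Require Import Defs.
From HB Require Import structures.
From mathcomp Require Import all_boot all_order all_algebra.
From mathcomp Require Import all_classical all_reals all_analysis.
From mathcomp Require Import measurable_realfun.
From mathcomp.real_closed Require Import complex.
From mathcomp Require Import ring lra.

Import Order.TTheory GRing.Theory Num.Theory.
Import numFieldNormedType.Exports.

Local Open Scope classical_set_scope.
Local Open Scope ring_scope.

Set Implicit Arguments.
Unset Strict Implicit.

Local Open Scope ereal_scope.

(** Exponents are carried as reciprocals: e = 1/p', i for the inner norm, j = 1/q. Fractional
    integration lowers the inner reciprocal from 1 - e to i = 1 - e - a, and each of the n - 1 chart
    variables costs one more e; hence 1/q = 1 - a - n/p'. The planar estimate requires 2e <= i, so n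
    - 1 successive steps require n e <= i, that is (n + 1) e <= 1 - a. This says at once p <= p_a
    and q <= p'. The chart estimate has outer exponent 1/e = p' in u. At this exponent the
    homogeneity of the kernel in (theta, t) cancels the Jacobian of the chart exactly, and the
    finite area of the sphere then brings p' down to q. All interpolation is pointwise, between
    products of powers of nonnegative functions normalised to integral at most 1; mixed-norm duality
    turns bounds for such forms into bounds for operators. *)

Local Notation normc := (@ComplexField.Normc.normc _).

(** * Integrals of nonnegative functions *)

Notation meas2 f := (measurable_fun setT (fun z => f z.1 z.2)).
Notation nneg1 f := (forall x, 0 <= f x).
Notation nneg2 f := (forall x y, 0 <= f x y).

Section integral_basics.
Context d (T : measurableType d) (R : realType).
Variable mu : {measure set T -> \bar R}.

(** Read off the definition: the integral is the supremum over the simple functions below the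
    integrand. *)
Lemma le_int (f g : T -> \bar R) : nneg1 f -> (forall x, f x <= g x) ->
  \int[mu]_x f x <= \int[mu]_x g x.
Proof.
move=> f0 fg; rewrite !ge0_integralTE//; last first.
  by move=> x; exact: le_trans (f0 x) (fg x).
apply: le_ereal_sup => _ [h hf <-]; exists h => // x.
exact: le_trans (hf x) (fg x).
Qed.

Lemma int_ge0 (f : T -> \bar R) : nneg1 f -> 0 <= \int[mu]_x f x.
Proof. by move=> f0; apply: integral_ge0. Qed.

Lemma intZl (k : \bar R) (f : T -> \bar R) : nneg1 f ->
  measurable_fun setT f -> 0 <= k -> \int[mu]_x (k * f x) = k * \int[mu]_x f x.
Proof. by move=> f0 mf k0; rewrite ge0_integralZl. Qed.

Lemma intZr (k : \bar R) (f : T -> \bar R) : nneg1 f ->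
  measurable_fun setT f -> 0 <= k -> \int[mu]_x (f x * k) = \int[mu]_x f x * k.
Proof. by move=> f0 mf k0; rewrite ge0_integralZr. Qed.

Lemma intD (f g : T -> \bar R) : nneg1 f -> measurable_fun setT f ->
  nneg1 g -> measurable_fun setT g ->
  \int[mu]_x (f x + g x) = \int[mu]_x f x + \int[mu]_x g x.
Proof. by move=> f0 mf g0 mg; rewrite ge0_integralD. Qed.

Lemma measurable_EFinT (f : T -> R) :
  measurable_fun setT f -> measurable_fun setT (fun x => (f x)%:E).
Proof. by move=> h; apply/measurable_EFinP. Qed.

Lemma measurable_poweRT (f : T -> \bar R) r :
  measurable_fun setT f -> measurable_fun setT (fun x => f x `^ r).
Proof. by move=> h; exact: (measurableT_comp (measurable_poweR r) h). Qed.

Lemma measurable_powRT (f : T -> R) (r : R) :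
  measurable_fun setT f -> measurable_fun setT (fun x => f x `^ r)%R.
Proof. by move=> h; exact: (measurableT_comp (measurable_powR r) h). Qed.

Lemma measurable_normT (f : T -> R) :
  measurable_fun setT f -> measurable_fun setT (fun x => `|f x|%R).
Proof. by move=> h; exact: (measurableT_comp _ h). Qed.

Lemma measurable_mineT (f g : T -> \bar R) : measurable_fun setT f ->
  measurable_fun setT g -> measurable_fun setT (fun x => mine (f x) (g x)).
Proof. by move=> mf mg; apply: measurable_mine. Qed.

End integral_basics.

Section comp.
Context d d1 d2 d3 (T : measurableType d) (X : measurableType d1)
  (Y : measurableType d2) (Z : measurableType d3).

Lemma measurable_comp2 (f : X -> Y -> Z) (a : T -> X) (b : T -> Y) :
  meas2 f -> measurable_fun setT a -> measurable_fun setT b ->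
  measurable_fun setT (fun t => f (a t) (b t)).
Proof.
by move=> mf ma mb; exact: (measurableT_comp mf (measurable_fun_pair ma mb)).
Qed.
End comp.

Section tonelli.
Context d1 d2 (T1 : measurableType d1) (T2 : measurableType d2) (R : realType).
Variables (m1 : {sigma_finite_measure set T1 -> \bar R})
  (m2 : {sigma_finite_measure set T2 -> \bar R}).

Lemma measurable_int (f : T1 -> T2 -> \bar R) : nneg2 f -> meas2 f ->
  measurable_fun setT (fun x => \int[m2]_y f x y).
Proof.
move=> f0 mf.
exact: (measurable_fun_fubini_tonelli_F (m2 := m2) (fun z => f z.1 z.2)).
Qed.

Lemma tonelli (f : T1 -> T2 -> \bar R) : nneg2 f -> meas2 f ->
  \int[m1]_x \int[m2]_y f x y = \int[m2]_y \int[m1]_x f x y.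
Proof. by move=> f0 mf; exact: (fubini_tonelli (fun z => f z.1 z.2)). Qed.

End tonelli.

Definition scale_tuple (R : realType) n (c : R) (x : n.-tuple R) : n.-tuple R :=
  [tuple (c * tnth x i)%R | i < n].

Lemma measurable_scale_tuple (R : realType) d (T : measurableType d) n (c : T -> R)
    (x : T -> n.-tuple R) : measurable_fun setT c -> measurable_fun setT x ->
  measurable_fun setT (fun t => scale_tuple (c t) (x t)).
Proof.
move=> mc mx; apply/measurable_fun_tnthP => i.
rewrite (_ : _ \o _ = (fun t => c t * tnth (x t) i)%R); last first.
  by apply/funext => t /=; rewrite tnth_mktuple.
apply: measurable_funM => //.
exact: (measurableT_comp (measurable_tnth i) mx).
Qed.

Lemma measurable_enormT d (T : measurableType d) (R : realType) n
    (f : T -> n.-tuple R) : measurable_fun setT f ->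
  measurable_fun setT (fun x => enorm (f x)).
Proof. by move=> mF; exact: (measurableT_comp (@measurable_enorm R n) mF). Qed.

Lemma measurable_normalizeT d (T : measurableType d) (R : realType) n
    (f : T -> n.-tuple R) : measurable_fun setT f ->
  measurable_fun setT (fun x => normalize (f x)).
Proof. by move=> mF; exact: (measurableT_comp (@measurable_normalize R n) mF). Qed.

Lemma measurable_idR (R : realType) :
  measurable_fun [set: measurableTypeR R] ((fun x => x) : measurableTypeR R -> R).
Proof. exact: (@measurable_id _ (measurableTypeR R) setT). Qed.

Ltac mid := first [exact: measurable_id | exact: measurable_idR].
Lemma measurable_cons_tuple d (T : measurableType d) (R : realType) n (f : T -> R)
    (g : T -> n.-tuple R) : measurable_fun setT f -> measurable_fun setT g ->
  measurable_fun setT (fun x => cons_tuple (f x) (g x)).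
Proof. by move=> mF mg; exact: (measurable_cons mF mg). Qed.

Lemma measurable_dotp (R : realType) n :
  measurable_fun setT (fun z : n.-tuple R * n.-tuple R => dotp z.1 z.2).
Proof.
apply: measurable_sum => i; apply: measurable_funM.
  exact: (measurableT_comp (measurable_tnth i) measurable_fst).
exact: (measurableT_comp (measurable_tnth i) measurable_snd).
Qed.

Lemma measurable_dotpT d (T : measurableType d) (R : realType) n
    (f g : T -> n.-tuple R) : measurable_fun setT f -> measurable_fun setT g ->
  measurable_fun setT (fun x => dotp (f x) (g x)).
Proof. by move=> mF mg; exact: (measurable_comp2 (@measurable_dotp R n) mF mg). Qed.

Ltac mproj := lazymatch goal with
  | |- measurable_fun _ fst => exact: measurable_fst
  | |- measurable_fun _ snd => exact: measurable_snd
  | |- measurable_fun _ (fun t => fst t) => exact: measurable_fst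
  | |- measurable_fun _ (fun t => snd t) => exact: measurable_snd
  | |- measurable_fun _ (fun t => fst _) => apply: (measurableT_comp measurable_fst); mproj
  | |- measurable_fun _ (fun t => snd _) => apply: (measurableT_comp measurable_snd); mproj
  | |- measurable_fun _ (fun t => t) => mid
  | |- _ => exact: measurable_cst
  end.

(* [nn] proves nonnegativity and [mf] measurability, following the syntax of the
   expression and using hypotheses of the shapes [nneg1], [nneg2], [meas2]. *)
Ltac nn := first [assumption | apply: ltW; assumption | lazymatch goal with
  | |- forall x, _ => move=> ?; nn
  | |- is_true (Order.le _ (poweR _ _)) => exact: poweR_ge0
  | |- is_true (Order.le _ (mule _ _)) => apply: mule_ge0; nn
  | |- is_true (Order.le _ (adde _ _)) => apply: adde_ge0; nn
  | |- is_true (Order.le _ (_ + _)%R) => first [apply: adde_ge0 | apply: addr_ge0]; nn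
  | |- is_true (Order.le _ (_ * _)%R) => first [apply: mule_ge0 | apply: mulr_ge0]; nn
  | |- is_true (Order.le _ (integral _ _ _)) => apply: int_ge0 => ?; nn
  | |- is_true (Order.le _ (if _ then _ else _)) => case: ifP => _; nn
  | |- is_true (Order.le _ (EFin _)) => rewrite lee_fin; nn
  | |- _ => first [assumption | exact: powR_ge0 | exact: normr_ge0 | exact: sqr_ge0 |
    match goal with
    | H : (forall x, is_true _) |- _ => exact: H
    | H : (forall x y, is_true _) |- _ => exact: H
    | H : (forall x y z, is_true _) |- _ => exact: H
    end | by [] | exact: ltW ]
  end ].

Ltac mf := lazymatch goal with
  | |- measurable_fun _ fst => exact: measurable_fst
  | |- measurable_fun _ snd => exact: measurable_snd
  | |- measurable_fun _ (fun t => t) => mid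
  | |- measurable_fun _ ( *%R ?c) => apply: (measurable_funM (f := fun=> c) (g := fun t => t)); [exact: measurable_cst|mid]
  | |- measurable_fun _ (+%R ?c) => apply: (measurable_funD (f := fun=> c) (g := fun t => t)); [exact: measurable_cst|mid]
  | |- measurable_fun _ (@Num.norm _ _) => apply: (measurable_normT (f := fun t => t)); mid
  | |- measurable_fun _ (fun t => fst _) => mproj
  | |- measurable_fun _ (fun t => snd _) => mproj
  | |- measurable_fun _ (fun t => pair _ _) => apply: measurable_fun_pair; mf
  | |- measurable_fun _ (fun t => cons_tuple _ _) => apply: measurable_cons_tuple; mf
  | |- measurable_fun _ (fun t => dotp _ _) => apply: measurable_dotpT; mf
  | |- measurable_fun _ (fun t => scale_tuple _ _) => apply: measurable_scale_tuple; mf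
  | |- measurable_fun _ (scale_tuple ?c) => apply: (measurable_scale_tuple (c := fun=> c) (x := fun t => t)); [exact: measurable_cst|mid]
  | |- measurable_fun _ (fun t => enorm _) => apply: measurable_enormT; mf
  | |- measurable_fun _ (@enorm _ _) => exact: measurable_enorm
  | |- measurable_fun _ (fun t => normalize _) => apply: measurable_normalizeT; mf
  | |- measurable_fun _ (@normalize _ _) => exact: measurable_normalize
  | |- measurable_fun _ (cons_tuple ?c) => apply: (measurable_cons_tuple (f := fun=> c) (g := fun t => t)); [exact: measurable_cst|mid]
  | |- measurable_fun _ (dotp ?c) => apply: (measurable_dotpT (f := fun=> c) (g := fun t => t)); [exact: measurable_cst|mid]
  | |- measurable_fun _ (fun t => integral _ _ _) => apply: measurable_int; [nn|mf]
  | |- measurable_fun _ (fun t => mule _ _) => apply: emeasurable_funM; mf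
  | |- measurable_fun _ (fun t => adde _ _) => apply: emeasurable_funD; mf
  | |- measurable_fun _ (fun t => poweR _ _) => apply: measurable_poweRT; mf
  | |- measurable_fun _ (fun t => if _ then _ else _) => apply: measurable_fun_ifT; mf
  | |- measurable_fun _ (fun t => andb _ _) => apply: measurable_and; mf
  | |- measurable_fun _ (fun t => @Order.le _ (reals_Real__to__Order_POrder _) _ _) => apply: measurable_fun_ler; mf
  | |- measurable_fun _ (fun t => @Order.lt _ (reals_Real__to__Order_POrder _) _ _) => apply: measurable_fun_ltr; mf
  | |- measurable_fun _ (fun t => (_ <= _)%R) => apply: measurable_fun_ler; mf
  | |- measurable_fun _ (fun t => (_ < _)%R) => apply: measurable_fun_ltr; mf
  | |- measurable_fun _ (fun t => Order.le _ _) => apply: measurable_fun_lee; mf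
  | |- measurable_fun _ (fun t => Order.lt _ _) => apply: measurable_fun_lte; mf
  | |- measurable_fun _ (fun t => mine _ _) => apply: measurable_mineT; mf
  | |- measurable_fun _ (fun t => EFin _) => apply: measurable_EFinT; mf
  | |- measurable_fun _ (fun t => powR _ _) => apply: measurable_powRT; mf
  | |- measurable_fun _ (fun t => Num.norm _) => apply: measurable_normT; mf
  | |- measurable_fun _ (fun t => (_ - _)%R) => apply: measurable_funB; mf
  | |- measurable_fun _ (fun t => (_ + _)%R) => first [apply: measurable_funD | apply: emeasurable_funD]; mf
  | |- measurable_fun _ (fun t => (_ * _)%R) => first [apply: measurable_funM | apply: emeasurable_funM]; mf
  | |- measurable_fun _ (fun t => (- _)%R) => apply: measurable_funN; mf
  | |- _ => first [assumption |
    match goal with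
    | |- measurable_fun _ (fun t => ?f _) =>
      match goal with H : measurable_fun _ ?g |- _ =>
        constr_eq f g; apply: (measurableT_comp H); mf end
    | |- measurable_fun _ (fun t => ?f _ _) =>
      match goal with H : measurable_fun _ (fun z => ?g z.1 z.2) |- _ =>
        constr_eq f g; apply: (measurable_comp2 H); mf end
    | |- measurable_fun _ (?f ?x) =>
      match goal with H : measurable_fun _ (fun z => ?g z.1 z.2) |- _ =>
        constr_eq f g; exact: (measurable_fun_pair2 x H) end
    end | exact: measurable_cst ]
  end.

(** * Powers of extended reals *)

Section poweR_lemmas.
Context (R : realType).
Implicit Types (x y : \bar R) (r s t : R).

Lemma le_poweR x y r : (0 <= r)%R -> 0 <= x -> x <= y -> x `^ r <= y `^ r.
Proof.
move=> r0 x0 xy; apply: gt0_ler_poweR => //; rewrite in_itv/= leey andbT//.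
exact: le_trans xy.
Qed.

(** By convention 0 to a nonzero power is 0 and +oo to a nonzero power is +oo, negative powers
    included. The law therefore holds at 0 and +oo as soon as the total exponent is nonzero. *)
Lemma poweRDe x r s : (r + s != 0)%R -> x `^ (r + s) = x `^ r * x `^ s.
Proof. by move=> rs; rewrite poweRD// add_neq0_poweRD_def. Qed.

Lemma poweRK x r : (r != 0)%R -> 0 <= x -> (x `^ r) `^ r^-1 = x.
Proof. by move=> r0 x0; rewrite -poweRrM divff// poweRe1. Qed.

Lemma poweRVK x r : (r != 0)%R -> 0 <= x -> (x `^ r^-1) `^ r = x.
Proof. by move=> r0 x0; rewrite -poweRrM mulVf// poweRe1. Qed.

(** Both factors are bounded by powers of the maximum, which covers t = 0 and t = 1 as well; the
    price is the loss of the weights of [poweR_young]. *)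
Lemma poweR_interp_le x y t : (0 <= t)%R -> (t <= 1)%R -> 0 <= x -> 0 <= y ->
  x `^ t * y `^ (1 - t) <= x + y.
Proof.
move=> t0 t1 x0 y0; set M := maxe x y.
have M0 : 0 <= M by rewrite le_max x0.
apply: (@le_trans _ _ (M `^ t * M `^ (1 - t))).
  apply: lee_pmul; rewrite ?poweR_ge0//; apply: le_poweR => //.
  - by rewrite le_max lexx.
  - by rewrite subr_ge0.
  - by rewrite le_max lexx orbT.
rewrite -poweRDe; last by rewrite subrKC oner_neq0.
rewrite subrKC poweRe1// /M; have [xy|xy] := leP x y.
  by rewrite leeDr.
by rewrite leeDl.
Qed.

Lemma poweR_young x y t : (0 < t)%R -> (t < 1)%R -> 0 <= x -> 0 <= y ->
  x `^ t * y `^ (1 - t) <= t%:E * x + (1 - t)%:E * y.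
Proof.
move=> t0 t1; case: x => [x| |//]; case: y => [y| |//]; last 3 first.
- move=> _ _; rewrite gt0_muley ?lte_fin ?subr_gt0//.
  rewrite [leRHS](_ : _ = +oo) ?leey// addey// gt_eqF//.
- move=> _ y0; rewrite gt0_muley ?lte_fin ?subr_gt0//.
  rewrite [leRHS](_ : _ = +oo) ?leey// addye// gt_eqF//.
- move=> _ _; rewrite gt0_muley ?lte_fin// gt0_muley ?lte_fin ?subr_gt0//.
  by rewrite leey.
rewrite 2!lee_fin => x0 y0; rewrite !poweR_EFin -!EFinM -EFinD lee_fin.
have t1' : (0 < 1 - t)%R by rewrite subr_gt0.
have := @conjugate_powR R (x `^ t)%R (y `^ (1 - t))%R (t^-1)%R ((1 - t)^-1)%R.
rewrite !powR_ge0 !invr_gt0 t0 t1' !invrK -!powRrM !divff ?gt_eqF// !powRr1//.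
by rewrite subrKC mulrC [(y * _)%R]mulrC [(x * _)%R]mulrC; apply.
Qed.

End poweR_lemmas.

(** * Hölder's inequality for integrals in [0, +oo] *)

Section hoelder_int.
Context d (T : measurableType d) (R : realType).
Variable mu : {measure set T -> \bar R}.

(** If f vanishes a.e. then so does f * g, even where g = +oo, as 0 * +oo = 0. This settles the
    degenerate cases of Hölder. *)
Lemma int_eq0_mull (f g : T -> \bar R) : measurable_fun setT f ->
  measurable_fun setT g -> nneg1 f -> nneg1 g ->
  \int[mu]_x f x = 0 -> \int[mu]_x (f x * g x) = 0.
Proof.
move=> mF mg f0 g0 h.
have : ae_eq mu setT f (cst 0).
  apply/(ae_eq_integral_abs mu measurableT mF); rewrite -[RHS]h.
  by apply: eq_integral => x _; rewrite gee0_abs.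
move=> fae; rewrite (ge0_ae_eq_integral measurableT _ _ _ _ (g := cst 0)).
- exact: integral0.
- mf.
- exact: measurable_cst.
- by move=> x _; nn.
- by [].
- move: fae; apply: filterS => x /= h' _; rewrite h'//; exact: mul0e.
Qed.

Lemma hoelder_int (f g : T -> \bar R) (t : R) : (0 < t)%R -> (t < 1)%R ->
  measurable_fun setT f -> measurable_fun setT g -> nneg1 f -> nneg1 g ->
  \int[mu]_x (f x `^ t * g x `^ (1 - t)) <=
  (\int[mu]_x f x) `^ t * (\int[mu]_x g x) `^ (1 - t).
Proof.
move=> t0 t1 mF mg f0 g0.
have t1' : (0 < 1 - t)%R by rewrite subr_gt0.
have powint0 (h : T -> \bar R) (s : R) : (0 < s)%R -> measurable_fun setT h ->
   nneg1 h -> \int[mu]_x h x = 0 -> \int[mu]_x h x `^ s = 0.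
  move=> s0 mh h0 h00.
  have : ae_eq mu setT h (cst 0).
    apply/(ae_eq_integral_abs mu measurableT mh); rewrite -[RHS]h00.
    by apply: eq_integral => x _; rewrite gee0_abs.
  move=> fae; rewrite (ge0_ae_eq_integral measurableT _ _ _ _ (g := cst 0)).
  - exact: integral0.
  - mf.
  - exact: measurable_cst.
  - by move=> x _; nn.
  - by [].
  - move: fae; apply: filterS => x /= h' _; rewrite h'//.
    by rewrite poweR0r// gt_eqF.
have ig0 := int_ge0 mu g0; have if0 := int_ge0 mu f0.
have [a0|a0] := eqVneq (\int[mu]_x f x) 0.
  rewrite (int_eq0_mull (f := fun x => f x `^ t)) ?mule_ge0 ?poweR_ge0//; first mf.
  - mf.
  - nn.
  - nn.
  - exact: powint0.
have [b0|b0] := eqVneq (\int[mu]_x g x) 0.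
  under eq_integral do rewrite muleC.
  rewrite (int_eq0_mull (f := fun x => g x `^ (1 - t))) ?mule_ge0 ?poweR_ge0//; first mf.
  - mf.
  - nn.
  - nn.
  - exact: powint0.
have agt : 0 < \int[mu]_x f x by rewrite lt_neqAle eq_sym a0.
have bgt : 0 < \int[mu]_x g x by rewrite lt_neqAle eq_sym b0.
have [ay|ay] := eqVneq (\int[mu]_x f x) +oo.
  by rewrite ay poweRyr ?gt_eqF// gt0_mulye ?leey// poweR_gt0.
have [b_y|b_y] := eqVneq (\int[mu]_x g x) +oo.
  by rewrite b_y poweRyr ?gt_eqF// gt0_muley ?leey// poweR_gt0.
have [a [agt' aE]] : exists a : R, (0 < a)%R /\ \int[mu]_x f x = a%:E.
  exists (fine (\int[mu]_x f x)); rewrite fineK; last first.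
    by rewrite fin_numE ay andbT gt_eqF// (lt_trans _ agt).
  by split => //; rewrite fine_gt0// agt/= ltey.
have [b [bgt' bE]] : exists b : R, (0 < b)%R /\ \int[mu]_x g x = b%:E.
  exists (fine (\int[mu]_x g x)); rewrite fineK; last first.
    by rewrite fin_numE b_y andbT gt_eqF// (lt_trans _ bgt).
  by split => //; rewrite fine_gt0// bgt/= ltey.
(* With f and g divided by their integrals a and b, Young's inequality integrates to t + (1 - t) =
   1; the factor c undoes the normalisation. *)
pose c := (a `^ t * b `^ (1 - t))%R.
have c0 : (0 < c)%R by rewrite mulr_gt0 ?powR_gt0.
apply: (@le_trans _ _
   (\int[mu]_x (c%:E * (t%:E * (a^-1%:E * f x) + (1 - t)%:E * (b^-1%:E * g x))))).
  apply: le_int => x; first nn.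
  have h := @poweR_young R (a^-1%:E * f x) (b^-1%:E * g x) t t0 t1.
  have a10 : (0 <= a^-1)%R by rewrite invr_ge0 ltW.
  have b10 : (0 <= b^-1)%R by rewrite invr_ge0 ltW.
  apply: le_trans; last first.
    apply: lee_wpmul2l; last by apply: h; nn.
    by rewrite lee_fin ltW.
  rewrite !poweRM//; [|nn..].
  rewrite !poweR_EFin -!muleA [_ * (_ * g x `^ _)]muleCA !muleA -!EFinM.
  rewrite [X in X%:E](_ : _ = 1)%R ?mul1e//.
  rewrite /c.
  have -> : (a^-1 `^ t = (a `^ t)^-1)%R.
    by rewrite -powR_inv1 ?ltW// -powRrM mulN1r powRN.
  have -> : (b^-1 `^ (1 - t) = (b `^ (1 - t))^-1)%R.
    by rewrite -powR_inv1 ?ltW// -powRrM mulN1r powRN.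
  have h1 : (a `^ t != 0)%R by rewrite gt_eqF// powR_gt0.
  have h2 : (b `^ (1 - t) != 0)%R by rewrite gt_eqF// powR_gt0.
  by field; rewrite h1 h2.
have a10 : (0 <= a^-1)%R by rewrite invr_ge0 ltW.
have b10 : (0 <= b^-1)%R by rewrite invr_ge0 ltW.
rewrite ge0_integralZl//; [|mf|by move=> x _; nn|by rewrite lee_fin ltW].
rewrite ge0_integralD//; [|by move=> x _; nn|mf|by move=> x _; nn|mf].
rewrite !ge0_integralZl//; try mf; try (by move=> x _; nn); try by rewrite lee_fin// ltW.
rewrite aE bE -!EFinM !mulVf ?gt_eqF// !mulr1 subrKC mulr1.
exact: lexx.
Qed.

End hoelder_int.

(** * Affine substitutions on the line, and a dyadic integrability test *)

Section affine.
Context (R : realType).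
Local Notation RR := (measurableTypeR R).
Local Notation mu := (@lebesgue_measure R).

Lemma measurable_affine (c b : R) :
  measurable_fun [set: RR] ((fun x => c * x + b)%R : RR -> RR).
Proof.
apply: (@measurable_funD _ RR R); last exact: measurable_cst.
apply: (@measurable_funM _ RR R); first exact: measurable_cst.
exact: measurable_id.
Qed.

Let pf (c b : R) : {measure set RR -> \bar R} :=
  measure_function_pushforward__canonical__measure_function_Measure
    mu (@measurable_affine c b).

(** The image of Lebesgue measure under x |-> c x + b, multiplied by c, agrees with Lebesgue measure
    on half-open intervals, hence everywhere. *)
Lemma int_affine_pos (c b : R) (f : RR -> \bar R) : (0 < c)%R -> nneg1 f ->
  measurable_fun setT f ->
  \int[mu]_x f (c * x + b)%R = (c^-1)%:E * \int[mu]_x f x.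
Proof.
move=> c0 f0 mF; have c10 : (0 <= c^-1)%R by rewrite invr_ge0 ltW.
transitivity (\int[pf c b]_y f y).
  have := ge0_integral_pushforward (@measurable_affine c b) mu measurableT mF.
  by rewrite preimage_setT => <-// y _.
rewrite -(ge0_integral_mscale mu measurableT (NngNum c10))//.
apply: eq_measure_integral => A mA _.
suff E : mu A = c%:E * pf c b A.
  have E2 : pf c b A = c^-1%:E * mu A.
    by rewrite E muleA -EFinM mulVf ?gt_eqF// mul1e.
  by first [exact: E2 | exact: (esym E2)].
pose c_ := NngNum (ltW c0).
apply: (@lebesgue_measure_unique R (mscale c_ (pf c b))) => // _ [[p q]] _ <-.
rewrite /= /mscale/= /pushforward lebesgue_measure_itv/=.
have -> : ((fun x : R => (c * x + b)%R) @^-1` `]p, q])%classic =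
    `]((p - b) / c)%R, ((q - b) / c)%R]%classic.
  apply/seteqP; split => x /=; rewrite !in_itv/=;
    by rewrite ltr_pdivrMr// ler_pdivlMr// ltrBlDr lerBrDr [(c * x)%R]mulrC.
rewrite lebesgue_measure_itv/= !lte_fin ltr_pM2r ?invr_gt0// ltrD2r.
case: ifP => _; last by rewrite mule0.
by rewrite -!EFinD -EFinM; congr EFin; field; rewrite gt_eqF.
Qed.

Lemma int_opp (f : RR -> \bar R) : nneg1 f -> measurable_fun setT f ->
  \int[mu]_x f (- x)%R = \int[mu]_x f x.
Proof.
move=> f0 mF.
have mN : measurable_fun [set: RR] (-%R : RR -> RR).
  by apply: (@measurable_funN _ RR R); exact: measurable_id.
transitivity (\int[(measure_function_pushforward__canonical__measure_function_Measure
    mu mN)]_y f y).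
  have := ge0_integral_pushforward mN mu measurableT mF.
  by rewrite preimage_setT => <-// y _.
by apply: eq_measure_integral => A mA _; exact: lebesgue_measureN.
Qed.

Lemma int_affine (c b : R) (f : RR -> \bar R) : c != 0%R -> nneg1 f ->
  measurable_fun setT f ->
  \int[mu]_x f (c * x + b)%R = (`|c|^-1)%:E * \int[mu]_x f x.
Proof.
move=> c0 f0 mF; have [cp|cn|c00] := ltgtP 0%R c.
- by rewrite int_affine_pos// gtr0_norm.
- rewrite -(@int_opp (fun x => f (c * x + b)%R))//; last first.
    exact: (measurableT_comp mF (@measurable_affine c b)).
  under eq_integral do rewrite mulrN -mulNr.
  by rewrite int_affine_pos ?oppr_gt0// ltr0_norm.
- by rewrite -c00 eqxx in c0.
Qed.

Lemma int_shift (b : R) (f : RR -> \bar R) : nneg1 f ->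
  measurable_fun setT f -> \int[mu]_x f (x + b)%R = \int[mu]_x f x.
Proof.
move=> f0 mF; have := @int_affine 1%R b f (oner_neq0 _) f0 mF.
by rewrite normr1 invr1 mul1e; under eq_integral do rewrite mul1r.
Qed.

(** A dyadic integrability test: h is dominated by the sum over k of a k on the ball |y| < b k, and
    the integrals 2 a k b k of the summands are bounded by a geometric series. *)
Lemma series_int_lty (h : RR -> \bar R) (a b : nat -> R) (A q : R) :
  nneg1 h -> (forall k, 0 <= a k)%R -> (forall k, 0 <= b k)%R ->
  (0 <= q)%R -> (q < 1)%R ->
  (forall k, a k * b k <= A * q ^+ k)%R ->
  (forall y, h y = 0 \/ exists2 k, (`|y| < b k)%R & h y <= (a k)%:E) ->
  \int[mu]_y h y < +oo.
Proof.
move=> h0 a0 b0 q0 q1 ab hb.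
pose g k (y : RR) : \bar R := if (`|y| < b k)%R then (a k)%:E else 0.
have g0 k y : 0 <= g k y by rewrite /g; nn.
have mg k : measurable_fun setT (g k) by rewrite /g; mf.
apply: (@le_lt_trans _ _ (\int[mu]_y \sum_(k <oo) g k y)).
  apply: le_int => // y; have [->|[k yb hk]] := hb y.
    by apply: nneseries_ge0 => k _ _; exact: g0.
  apply: (le_trans hk); rewrite (@nneseriesD1 _ (fun k => g k y) k predT)//.
  by rewrite {1}/g yb leeDl// nneseries_ge0.
rewrite (integral_nneseries mu measurableT mg)//.
have A0 : (0 <= A)%R.
  by have := ab 0%N; rewrite expr0 mulr1; apply: le_trans; rewrite mulr_ge0.
have ig k : \int[mu]_y g k y <= (2 * A * q ^+ k)%:E.
  rewrite (_ : \int[mu]_y g k y = \int[mu]_(y in `](- b k)%R, (b k)%R[) cst (a k)%:E y).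
    rewrite integral_cst//= lebesgue_measure_itv/= lte_fin.
    case: ifP => _; last first.
      by rewrite mule0 lee_fin !mulr_ge0// exprn_ge0.
    rewrite -EFinD -EFinM lee_fin opprK -mulrA.
    have := ab k; lra.
  rewrite [RHS]integral_mkcond; apply: eq_integral => y _.
  by rewrite /g patchE mem_setE in_itv/= -ltr_norml.
apply: (@le_lt_trans _ _ (\sum_(k <oo) (2 * A * q ^+ k)%:E)).
  by apply: lee_nneseries => k _; rewrite ?int_ge0.
have h1 := @cvg_geometric_series R (2 * A)%R q.
have h2 : (eseries (fun k => (2 * A * q ^+ k)%:E)) @ \oo --> (2 * A * (1 - q)^-1)%:E.
  rewrite (_ : eseries _ = EFin \o series (geometric (2 * A)%R q)); last first.
    by apply/funext => n; rewrite /eseries/series/= sumEFin.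
  apply: cvg_EFin; first by near=> n.
  by apply: h1; rewrite ger0_norm.
by have -> := cvg_lim _ h2; rewrite ?ltry.
Unshelve. all: end_near. Qed.

End affine.

(** * Riesz kernels on the line *)

Section kernels.
Context (R : realType).
Local Notation RR := (measurableTypeR R).
Local Notation mu := (@lebesgue_measure R).

Lemma exists_expn_gt (x : R) : exists n, (x < 2 ^+ n)%R.
Proof.
exists (Num.bound `|x|); apply: (le_lt_trans (ler_norm x)).
apply: (lt_le_trans (archi_boundP (normr_ge0 x))).
by rewrite -natrX ler_nat ltnW// ltn_expl.
Qed.

Lemma powRN_anti (x y c : R) : (0 <= c)%R -> (0 < x)%R -> (x <= y)%R ->
  (y `^ (- c) <= x `^ (- c))%R.
Proof.
move=> c0 x0 xy; have y0 := lt_le_trans x0 xy.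
rewrite !powRN lef_pV2 ?posrE ?powR_gt0//.
by apply: ge0_ler_powR => //; rewrite nnegrE ltW.
Qed.

Lemma powRD_gt0 (x r t : R) : (0 < x)%R -> (x `^ (r + t) = x `^ r * x `^ t)%R.
Proof. by move=> x0; rewrite powRD// (gt_eqF x0) implybT. Qed.

Lemma powRV (x r : R) : (0 <= x)%R -> (x^-1 `^ r = (x `^ r)^-1)%R.
Proof. by move=> x0; rewrite -powR_inv1// -powRrM mulN1r powRN. Qed.

Lemma ltr_powR_exp (b x y : R) : (1 < b)%R -> (x < y)%R -> (b `^ x < b `^ y)%R.
Proof.
move=> b1 xy; rewrite /powR gt_eqF ?(lt_trans _ b1)// ltr_expR.
by rewrite ltr_pM2r// ln_gt0.
Qed.

(** On the shell 2^-(k+1) <= |y| < 2^-k the integrand is at most 2^(l (k+1)), so that the ratio of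
    the geometric series is 2^l / 2 < 1. *)
Lemma near_unit_lty (l : R) : (0 < l)%R -> (l < 1)%R ->
  \int[mu]_y (if (`|y| < 1)%R then (`|y| `^ (- l))%:E else 0) < +oo.
Proof.
move=> l0 l1; pose q := (2 `^ l / 2)%R.
have tl0 : (0 < 2 `^ l)%R by rewrite powR_gt0.
apply: (@series_int_lty _ _ (fun k => (2 `^ l) ^+ k.+1)%R (fun k => 2^-1 ^+ k)%R
  (2 `^ l)%R q).
- nn.
- by move=> k; rewrite exprn_ge0// ltW.
- by move=> k; rewrite exprn_ge0// invr_ge0.
- by rewrite /q divr_ge0// ltW.
- rewrite /q ltr_pdivrMr// mul1r -[ltRHS]powRr1//.
  by rewrite ltr_powR_exp// ltr1n.
- by move=> k; rewrite exprS -mulrA -exprMn.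
- move=> y; case: ifPn => [y1|_]; last by left.
  (* The power of 0 with exponent - l is 0 by convention, so the kernel takes a finite value at its
     singularity. *)
  have [->|y0] := eqVneq y 0%R.
    by left; rewrite normr0 powR0// oppr_eq0 gt_eqF.
  right; have y0' : (0 < `|y|)%R by rewrite normr_gt0.
  have [n0 hn0] := exists_expn_gt (`|y|^-1).
  have ex : exists n, (2^-1 ^+ n <= `|y|)%R.
    exists n0; rewrite exprVn -[leRHS]invrK lef_pV2 ?posrE ?invr_gt0 ?exprn_gt0//.
    exact: ltW.
  case: (ex_minnP ex) => -[|k] hk mink.
    by move: hk; rewrite expr0 leNgt y1.
  exists k.
    by rewrite ltNge; apply/negP => /mink; rewrite ltnn.
  have k0 : (0 < 2^-1 ^+ k.+1 :> R)%R by rewrite exprn_gt0// invr_gt0.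
  rewrite lee_fin (le_trans (powRN_anti (ltW l0) k0 hk))//.
  rewrite exprVn powRV ?exprn_ge0// powRN invrK.
  by rewrite -!powR_mulrn ?powR_ge0// -!powRrM mulrC.
Qed.

(** Shells 2^k <= |y| < 2^(k+1), with ratio 2 * 2^-c < 1. *)
Lemma far_unit_lty (c : R) : (1 < c)%R ->
  \int[mu]_y (if (1 <= `|y|)%R then (`|y| `^ (- c))%:E else 0) < +oo.
Proof.
move=> c1; have c0 : (0 < c)%R by rewrite (lt_trans _ c1).
pose q := (2 * 2 `^ (- c))%R.
apply: (@series_int_lty _ _ (fun k => (2 `^ (- c)) ^+ k)%R (fun k => 2 ^+ k.+1)%R
  2%R q).
- nn.
- by move=> k; rewrite exprn_ge0// powR_ge0.
- by move=> k; rewrite exprn_ge0.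
- by rewrite /q mulr_ge0// powR_ge0.
- rewrite /q powRN ltr_pdivrMr ?powR_gt0// mul1r -[ltLHS]powRr1//.
  by rewrite ltr_powR_exp// ltr1n.
- by move=> k; rewrite mulrC exprS -mulrA -exprMn.
- move=> y; case: ifPn => [y1|_]; last by left.
  right; have ex := exists_expn_gt (`|y|).
  case: (ex_minnP ex) => -[|k] hk mink.
    by move: hk; rewrite expr0 ltNge y1.
  exists k => //.
  have h : (2 ^+ k <= `|y|)%R.
    by rewrite leNgt; apply/negP => /mink; rewrite ltnn.
  rewrite lee_fin (le_trans (powRN_anti (ltW c0) (exprn_gt0 k (ltr0n _ 2)) h))//.
  by rewrite -!powR_mulrn ?powR_ge0// -!powRrM mulrC.
Qed.

(** A dilation by s reduces to unit scale. Here s is an inverse length: a value of F or G in the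
    proof of [hls], and 1/m(E) in the weak type bound. *)
Lemma near_kernel (l : R) : (0 < l)%R -> (l < 1)%R ->
  exists2 K : R, (0 < K)%R & forall s x : R, (0 < s)%R ->
  \int[mu]_y (if (s * `|x - y| < 1)%R then (`|x - y| `^ (- l))%:E else 0) <=
  (K * s `^ (l - 1))%:E.
Proof.
move=> l0 l1; pose h (y : RR) : \bar R :=
  if (`|y| < 1)%R then (`|y| `^ (- l))%:E else 0.
have h0 : nneg1 h by move=> y; rewrite /h; nn.
have mh : measurable_fun setT h by rewrite /h; mf.
have := near_unit_lty l0 l1; rewrite -/(h _) => hy.
exists (fine (\int[mu]_y h y) + 1)%R => [|s x s0].
  by rewrite ltr_wpDl// fine_ge0// int_ge0.
have E y : (if (s * `|x - y| < 1)%R then (`|x - y| `^ (- l))%:E else 0) =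
    (s `^ l)%:E * h (- s * y + s * x)%R.
  rewrite /h (_ : - s * y + s * x = s * (x - y))%R; last by ring.
  rewrite normrM (gtr0_norm s0); case: ifPn => _; last by rewrite mule0.
  rewrite -EFinM (powRM _ (ltW s0) (normr_ge0 _)) mulrA -powRD_gt0//.
  by rewrite subrr powRr0 mul1r.
under eq_integral do rewrite E.
rewrite ge0_integralZl//; last 2 first.
- exact: (measurableT_comp mh (@measurable_affine R _ _)).
- by rewrite lee_fin powR_ge0.
rewrite int_affine// ?oppr_eq0 ?gt_eqF// normrN (gtr0_norm s0).
rewrite -(@fineK _ (\int[mu]_x0 h x0)); last by rewrite ge0_fin_numE// int_ge0.
rewrite -!EFinM lee_fin mulrA.
have -> : (s `^ l / s = s `^ (l - 1))%R.
  by rewrite powRD_gt0// powRN powRr1// ltW.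
by rewrite mulrC ler_wpM2r ?powR_ge0// lerDl.
Qed.

Lemma far_kernel (c : R) : (1 < c)%R ->
  exists2 K : R, (0 < K)%R & forall s x : R, (0 < s)%R ->
  \int[mu]_y (if (1 <= s * `|x - y|)%R then (`|x - y| `^ (- c))%:E else 0) <=
  (K * s `^ (c - 1))%:E.
Proof.
move=> c1; pose h (y : RR) : \bar R :=
  if (1 <= `|y|)%R then (`|y| `^ (- c))%:E else 0.
have h0 : nneg1 h by move=> y; rewrite /h; nn.
have mh : measurable_fun setT h by rewrite /h; mf.
have := far_unit_lty c1; rewrite -/(h _) => hy.
exists (fine (\int[mu]_y h y) + 1)%R => [|s x s0].
  by rewrite ltr_wpDl// fine_ge0// int_ge0.
have E y : (if (1 <= s * `|x - y|)%R then (`|x - y| `^ (- c))%:E else 0) =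
    (s `^ c)%:E * h (- s * y + s * x)%R.
  rewrite /h (_ : - s * y + s * x = s * (x - y))%R; last by ring.
  rewrite normrM (gtr0_norm s0); case: ifPn => _; last by rewrite mule0.
  rewrite -EFinM (powRM _ (ltW s0) (normr_ge0 _)) mulrA -powRD_gt0//.
  by rewrite subrr powRr0 mul1r.
under eq_integral do rewrite E.
rewrite ge0_integralZl//; last 2 first.
- exact: (measurableT_comp mh (@measurable_affine R _ _)).
- by rewrite lee_fin powR_ge0.
rewrite int_affine// ?oppr_eq0 ?gt_eqF// normrN (gtr0_norm s0).
rewrite -(@fineK _ (\int[mu]_x0 h x0)); last by rewrite ge0_fin_numE// int_ge0.
rewrite -!EFinM lee_fin mulrA.
have -> : (s `^ c / s = s `^ (c - 1))%R.
  by rewrite powRD_gt0// powRN powRr1// ltW.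
by rewrite mulrC ler_wpM2r ?powR_ge0// lerDl.
Qed.

End kernels.

(** * The trilinear Hardy-Littlewood-Sobolev inequality *)

Section hls.
Context (R : realType).
Local Notation RR := (measurableTypeR R).
Local Notation mu := (@lebesgue_measure R).
Implicit Types (F G : RR -> \bar R) (a : R).

(** As F has integral at most 1, 1 / F x is a length scale at x. [near] is supported where |x - y|
    is at least this length, [far] where it is smaller and moreover G y <= F x. *)
Let near a1 a2 a3 F G (x y : RR) : \bar R :=
  if (1 <= `|x - y|%:E * F x)
  then F x `^ a1 * G y `^ a2 * (`|x - y| `^ (- a3))%:E else 0.

Let far a1 a2 a3 F G (x y : RR) : \bar R :=
  if (`|x - y|%:E * F x < 1) && (G y <= F x)
  then F x `^ (a1 + a2) * (`|x - y| `^ (- a3))%:E else 0.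

(** Hölder with G in L^1 leaves the kernel with the power c = a3 / (1 - a2), and c > 1 because a1 <
    1. The powers of F x add up to 1 because a1 + a2 + a3 = 2. *)
Let int_near a1 a2 a3 : (0 < a1)%R -> (0 < a2)%R -> (0 < a3)%R ->
  (a1 < 1)%R -> (a2 < 1)%R -> (a1 + a2 + a3 = 2)%R ->
  exists2 C : R, (0 < C)%R & forall F G, nneg1 F -> nneg1 G ->
    measurable_fun setT F -> measurable_fun setT G ->
    \int[mu]_y G y <= 1 ->
    forall x, \int[mu]_y near a1 a2 a3 F G x y <= C%:E * F x.
Proof.
move=> a10 a20 a30 a11 a21 a123; pose c := (a3 / (1 - a2))%R.
have b0 : (0 < 1 - a2)%R by rewrite subr_gt0.
have c1 : (1 < c)%R by rewrite /c ltr_pdivlMr// mul1r; lra.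
have [K K0 hK] := far_kernel c1.
exists (K `^ (1 - a2))%R => [|F G F0 G0 mF mG iG x]; first by rewrite powR_gt0.
case Fx : (F x) (F0 x) => [s| |//] s0; last first.
  by rewrite gt0_muley ?lte_fin ?powR_gt0// leey.
move: s0; rewrite lee_fin le_eqVlt => /predU1P[s0|s0].
  rewrite -s0 mule0 le_eqVlt; apply/orP; left; apply/eqP.
  by apply: integral0_eq => y _; rewrite /near Fx -s0 mule0 leNgt lte_fin ltr01.
pose k y : \bar R := if (1 <= s * `|x - y|)%R then (`|x - y| `^ (- c))%:E else 0.
have mk : measurable_fun [set: RR] k by rewrite /k; mf.
have k0 : nneg1 k by move=> y; rewrite /k; nn.
have E y : near a1 a2 a3 F G x y = (s `^ a1)%:E * (G y `^ a2 * k y `^ (1 - a2)).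
  rewrite /near Fx -EFinM lee_fin mulrC /k; case: ifPn => _.
    by rewrite muleA poweR_EFin poweR_EFin -powRrM mulNr /c divfK// gt_eqF.
  by rewrite poweR0r ?gt_eqF// !mule0.
under eq_integral do rewrite E.
rewrite ge0_integralZl//; [|mf|by move=> y _; nn|nn].
apply: le_trans.
  apply: lee_wpmul2l; first nn.
  exact: hoelder_int.
apply: (@le_trans _ _ ((s `^ a1)%:E * (1 * (K * s `^ (c - 1))%:E `^ (1 - a2)))).
  apply: lee_wpmul2l; first nn.
  apply: lee_pmul; [nn|nn| |].
    rewrite -[leRHS](poweR1r a2); apply: le_poweR => //; first exact: ltW.
    exact: int_ge0.
  apply: le_poweR; [exact: ltW|exact: int_ge0|exact: hK].
rewrite mul1e poweR_EFin (powRM _ (ltW K0) (powR_ge0 _ _)) -!EFinM lee_fin mulrCA.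
rewrite ler_pM2l ?powR_gt0// -powRrM -powRD_gt0//.
have -> : (a1 + (c - 1) * (1 - a2) = 1)%R.
  rewrite mulrBl /c divfK ?gt_eqF//; lra.
by rewrite powRr1// ltW.
Qed.

(** The kernel is locally integrable as a3 < 1; integrated up to distance 1 / F x it gives (F x)^(a3
    - 1), and again the total power of F x is 1. *)
Let int_far a1 a2 a3 : (0 < a1)%R -> (0 < a2)%R -> (0 < a3)%R ->
  (a3 < 1)%R -> (a1 + a2 + a3 = 2)%R ->
  exists2 C : R, (0 < C)%R & forall F G, nneg1 F -> nneg1 G ->
    measurable_fun setT F -> measurable_fun setT G ->
    forall x, \int[mu]_y far a1 a2 a3 F G x y <= C%:E * F x.
Proof.
move=> a10 a20 a30 a31 a123.
have [K K0 hK] := near_kernel a30 a31.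
exists K => // F G F0 G0 mF mG x.
case Fx : (F x) (F0 x) => [s| |//] s0; last first.
  by rewrite gt0_muley ?lte_fin// leey.
have a12 : (a1 + a2 != 0)%R by rewrite gt_eqF// addr_gt0.
move: s0; rewrite lee_fin le_eqVlt => /predU1P[s0|s0].
  rewrite -s0 mule0 le_eqVlt; apply/orP; left; apply/eqP.
  apply: integral0_eq => y _; rewrite /far Fx -s0 poweR0r// mul0e.
  by case: ifP.
pose k y : \bar R := if (s * `|x - y| < 1)%R then (`|x - y| `^ (- a3))%:E else 0.
have mk : measurable_fun [set: RR] k by rewrite /k; mf.
have k0 : nneg1 k by move=> y; rewrite /k; nn.
apply: (@le_trans _ _ (\int[mu]_y ((s `^ (a1 + a2))%:E * k y))).
  apply: le_int => y; first by rewrite /far; nn.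
  rewrite /far Fx -EFinM lte_fin mulrC /k; case: ifPn => [/andP[-> _]//|_].
  by case: ifP => _; nn.
rewrite ge0_integralZl//; [|nn].
apply: le_trans.
  apply: lee_wpmul2l; first nn.
  exact: hK.
rewrite -!EFinM lee_fin mulrCA -powRD_gt0//.
have -> : (a1 + a2 + (a3 - 1) = 1)%R by lra.
by rewrite powRr1// ltW.
Qed.

Lemma hls a1 a2 a3 : (0 < a1)%R -> (0 < a2)%R -> (0 < a3)%R ->
  (a1 < 1)%R -> (a2 < 1)%R -> (a3 < 1)%R -> (a1 + a2 + a3 = 2)%R ->
  exists2 C : R, (0 < C)%R & forall F G, nneg1 F -> nneg1 G ->
    measurable_fun setT F -> measurable_fun setT G ->
    \int[mu]_x F x <= 1 -> \int[mu]_y G y <= 1 ->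
    \int[mu]_x \int[mu]_y (F x `^ a1 * G y `^ a2 * (`|x - y| `^ (- a3))%:E) <= C%:E.
Proof.
move=> a10 a20 a30 a11 a21 a31 a123.
have a123' : (a2 + a1 + a3 = 2)%R by lra.
have [C1 C10 hC1] := int_near a10 a20 a30 a11 a21 a123.
have [C2 C20 hC2] := int_near a20 a10 a30 a21 a11 a123'.
have [C3 C30 hC3] := int_far a10 a20 a30 a31 a123.
have [C4 C40 hC4] := int_far a20 a10 a30 a31 a123'.
exists ((C1 + C3) + (C2 + C4))%R => [|F G F0 G0 mF mG iF iG].
  by rewrite !addr_gt0.
pose P (x y : RR) := near a1 a2 a3 F G x y + far a1 a2 a3 F G x y.
pose Q (y x : RR) := near a2 a1 a3 G F y x + far a2 a1 a3 G F y x.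
have P0 : nneg2 P by move=> x y; rewrite /P /near /far; nn.
have Q0 : nneg2 Q by move=> x y; rewrite /Q /near /far; nn.
have mP : meas2 P by rewrite /P /near /far; mf.
have mQ : meas2 Q by rewrite /Q /near /far; mf.
have iP : \int[mu]_x \int[mu]_y P x y <= (C1 + C3)%:E.
  apply: (@le_trans _ _ (\int[mu]_x ((C1 + C3)%:E * F x))).
    apply: le_int => x; first nn.
    rewrite /P ge0_integralD//; [|by move=> *; rewrite /near; nn
      |rewrite /near; mf|by move=> *; rewrite /far; nn|rewrite /far; mf].
    rewrite EFinD ge0_muleDl; [|nn|nn].
    by apply: leeD; [exact: hC1|exact: hC3].
  rewrite ge0_integralZl//; last by rewrite lee_fin addr_ge0// ltW.
  by rewrite -[leRHS]mule1 lee_wpmul2l// lee_fin addr_ge0// ltW.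
have iQ : \int[mu]_x \int[mu]_y Q x y <= (C2 + C4)%:E.
  apply: (@le_trans _ _ (\int[mu]_x ((C2 + C4)%:E * G x))).
    apply: le_int => x; first nn.
    rewrite /Q ge0_integralD//; [|by move=> *; rewrite /near; nn
      |rewrite /near; mf|by move=> *; rewrite /far; nn|rewrite /far; mf].
    rewrite EFinD ge0_muleDl; [|nn|nn].
    by apply: leeD; [exact: hC2|exact: hC4].
  rewrite ge0_integralZl//; last by rewrite lee_fin addr_ge0// ltW.
  by rewrite -[leRHS]mule1 lee_wpmul2l// lee_fin addr_ge0// ltW.
(* Either |x - y| reaches 1 / F x, or it reaches 1 / G y, or neither, and then the larger of F x and
   G y absorbs the smaller. Each case is one summand of P or Q. *)
have ptw x y : F x `^ a1 * G y `^ a2 * (`|x - y| `^ (- a3))%:E <= P x y + Q y x.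
  set d := (`|x - y|)%R; have d' : `|y - x|%R = d by rewrite distrC.
  rewrite /P /Q /near /far d' -/d.
  have [h1|h1] := leP 1 (d%:E * F x).
    by rewrite /= -addeA leeDl//; nn.
  have [h2|h2] := leP 1 (d%:E * G y).
    rewrite /= addeCA addeA [F x `^ _ * _]muleC.
    by rewrite -addeA leeDl//; nn.
  rewrite /= !add0e.
  have k0 : 0 <= (d `^ (- a3))%:E by nn.
  have [h3|h3] := leP (G y) (F x).
    apply: (@le_trans _ _ (F x `^ (a1 + a2) * (d `^ (- a3))%:E)); last first.
      by rewrite leeDl//; nn.
    rewrite poweRDe; last by rewrite gt_eqF// addr_gt0.
    apply: lee_wpmul2r => //; apply: lee_wpmul2l; first nn.
    by apply: le_poweR => //; exact: ltW.
  rewrite add0e (ltW h3) poweRDe; last by rewrite gt_eqF// addr_gt0.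
  apply: lee_wpmul2r => //; rewrite muleC; apply: lee_wpmul2l; first nn.
  by apply: le_poweR => //; exact: ltW.
clearbody P Q.
apply: (@le_trans _ _ (\int[mu]_x \int[mu]_y (P x y + Q y x))).
  apply: le_int => x; first nn.
  by apply: le_int => y; first nn.
have mQ' : meas2 (fun x y => Q y x) by mf.
have -> : \int[mu]_x \int[mu]_y (P x y + Q y x) =
    \int[mu]_x (\int[mu]_y P x y + \int[mu]_y Q y x).
  apply: eq_integral => x _; rewrite ge0_integralD//.
  - mf.
  - mf.
rewrite ge0_integralD//; [|by move=> x _; nn|mf|by move=> x _; nn|mf].
rewrite EFinD; apply: leeD; first exact: iP.
rewrite (tonelli mu mu (f := fun x y => Q y x)) //; nn.
Qed.

End hls.

(** * Duality and Minkowski inequality for mixed norms *)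

Section sup_lemmas.
Context (R : realType).

Lemma limn_nd_eq (u : nat -> \bar R) (l : \bar R) :
  (forall k k', (k <= k')%N -> u k <= u k') -> (forall k, u k <= l) ->
  (forall b, (forall k, u k <= b) -> l <= b) -> limn u = l.
Proof.
move=> nd ul lu; have -> : limn u = ereal_sup (range u).
  by apply/cvg_lim => //; exact: ereal_nondecreasing_cvgn.
apply/eqP; rewrite eq_le; apply/andP; split.
  by apply: ge_ereal_sup => _ [k _ <-].
by apply: lu => k; apply: ereal_sup_ubound; exists k.
Qed.

(** The increasing limit is a supremum, and upper bounds are carried back by the inverse power; this
    includes the limit +oo. *)
Lemma limn_poweR (u : nat -> \bar R) (s : R) : (0 < s)%R -> nneg1 u ->
  (forall k k', (k <= k')%N -> u k <= u k') ->
  limn (fun k => u k `^ s) = (limn u) `^ s.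
Proof.
move=> s0 u0 nd.
have ul k : u k <= limn u.
  have -> : limn u = ereal_sup (range u).
    by apply/cvg_lim => //; exact: ereal_nondecreasing_cvgn.
  by apply: ereal_sup_ubound; exists k.
have l0 : 0 <= limn u by apply: le_trans (ul 0%N).
apply: limn_nd_eq.
- by move=> k k' kk'; apply: le_poweR (nd _ _ kk') => //; exact: ltW.
- by move=> k; apply: le_poweR (ul k) => //; exact: ltW.
- move=> b hb; have b0 : 0 <= b by apply: le_trans (hb 0%N); exact: poweR_ge0.
  rewrite -(poweRVK (r := s) _ b0) ?gt_eqF//; apply: le_poweR => //; first exact: ltW.
  have -> : limn u = ereal_sup (range u).
    by apply/cvg_lim => //; exact: ereal_nondecreasing_cvgn.
  apply: ge_ereal_sup => _ [k _ <-]; rewrite -(poweRK (r := s) _ (u0 k)) ?gt_eqF//.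
  by apply: le_poweR; rewrite ?poweR_ge0// invr_ge0 ltW.
Qed.

End sup_lemmas.

Section mixed_norm_duality.
Context d1 d2 (U : measurableType d1) (V : measurableType d2) (R : realType).
Variables (m1 : {sigma_finite_measure set U -> \bar R})
  (m2 : {sigma_finite_measure set V -> \bar R}).
Variables (e j : R).
Hypotheses (e0 : (0 < e)%R) (e1 : (e < 1)%R) (j0 : (0 < j)%R) (j1 : (j < 1)%R).

Let s := (j^-1)%R.
Let t := (j / e)%R.
Let s0 : (0 < s)%R. Proof. by rewrite invr_gt0. Qed.
Let t0 : (0 < t)%R. Proof. by rewrite divr_gt0. Qed.

(** The form is tested on the extremal pair of Hölder, Q = N^t / J and G = A^s / N, on which it
    equals J^e. The majorant built from iU and iV makes N and J finite, so that these quotients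
    behave as expected. *)
Let dual_bounded (A : U -> V -> \bar R) (C : R) (k : R)
    (iU : U -> R) (iV : V -> R) : (0 <= C)%R -> (0 <= k)%R ->
  nneg2 A -> meas2 A ->
  (forall u, 0 <= iU u)%R -> (forall v, 0 <= iV v)%R ->
  measurable_fun setT iU -> measurable_fun setT iV ->
  \int[m1]_u (iU u `^ t)%:E < +oo -> \int[m2]_v (iV v `^ s)%:E < +oo ->
  (forall u v, A u v <= (k * iU u `^ j * iV v)%:E) ->
  (forall (Q : U -> \bar R) (G : U -> V -> \bar R),
    nneg1 Q -> measurable_fun setT Q -> nneg2 G -> meas2 G ->
    \int[m1]_u Q u <= 1 -> (forall u, \int[m2]_v G u v <= 1) ->
    \int[m1]_u \int[m2]_v (A u v * (Q u `^ (1 - e) * G u v `^ (1 - j))) <= C%:E) ->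
  \int[m1]_u (\int[m2]_v A u v `^ s) `^ t <= (C `^ e^-1)%:E.
Proof.
move=> C0 k0 A0 mA iU0 iV0 miU miV fU fV Ab hA.
pose N u := \int[m2]_v A u v `^ s.
have N0 : nneg1 N by move=> u; rewrite /N; nn.
have mN : measurable_fun setT N by rewrite /N; mf.
have [cV [cV0 cVE]] : exists c : R, (0 <= c)%R /\ \int[m2]_v (iV v `^ s)%:E = c%:E.
  exists (fine (\int[m2]_v (iV v `^ s)%:E)); split.
    by rewrite fine_ge0// int_ge0// => v; rewrite lee_fin powR_ge0.
  by rewrite fineK// ge0_fin_numE// int_ge0// => v; rewrite lee_fin powR_ge0.
have Nb u : N u <= (k `^ s * iU u * cV)%:E.
  apply: (@le_trans _ _ (\int[m2]_v ((k `^ s * iU u)%:E * (iV v `^ s)%:E))).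
    apply: le_int => v; first nn.
    apply: le_trans.
      by apply: le_poweR (Ab u v) => //; exact: ltW.
    rewrite poweR_EFin powRM//; last by rewrite mulr_ge0// powR_ge0.
    rewrite powRM//; last exact: powR_ge0.
    by rewrite -powRrM /s divff ?gt_eqF// powRr1// EFinM.
  by rewrite intZl; [rewrite cVE -EFinM|nn|mf|nn].
have Nfin u : N u \is a fin_num.
  by rewrite ge0_fin_numE//; apply: le_lt_trans (Nb u) _; rewrite ltry.
have Jfin : \int[m1]_u N u `^ t < +oo.
  apply: (@le_lt_trans _ _ (\int[m1]_u (((k `^ s * cV) `^ t)%:E * (iU u `^ t)%:E))).
    apply: le_int => u; first nn.
    apply: le_trans.
      by apply: le_poweR (Nb u) => //; exact: ltW.
    have kc : (0 <= k `^ s * cV)%R by rewrite mulr_ge0// powR_ge0.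
    by rewrite poweR_EFin mulrAC (powRM _ kc (iU0 u)) EFinM.
  rewrite intZl; [|nn|mf|nn].
  by apply: lte_mul_pinfty => //; nn.
set J := \int[m1]_u _; rewrite -/J in Jfin.
have J0 : 0 <= J by apply: int_ge0 => u; nn.
have JE : J = \int[m1]_u N u `^ t by [].
case EJ : J J0 Jfin => [r| |]// r0 _.
move: r0; rewrite lee_fin le_eqVlt => /predU1P[<-|r0].
  by rewrite lee_fin powR_ge0.
pose Q u := (r^-1)%:E * N u `^ t.
pose G u v := A u v `^ s * N u `^ (-1).
have r10 : (0 <= r^-1)%R by rewrite invr_ge0 ltW.
have Q0 : nneg1 Q by move=> u; rewrite /Q; nn.
have mQ : measurable_fun setT Q by rewrite /Q; mf.
have G0 : nneg2 G by move=> u v; rewrite /G; nn.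
have mG : meas2 G by rewrite /G; mf.
have iQ : \int[m1]_u Q u <= 1.
  rewrite /Q ge0_integralZl//; [|mf|by move=> u _; nn].
  by rewrite -JE EJ -EFinM mulVf// gt_eqF.
have iG u : \int[m2]_v G u v <= 1.
  rewrite /G ge0_integralZr//; [|mf|by move=> v _; nn|nn].
  rewrite -/(N u) -(fineK (Nfin u)) poweR_EFin -EFinM lee_fin.
  have [->|n0] := eqVneq (fine (N u)) 0%R; first by rewrite mul0r.
  by rewrite powR_inv1 ?fine_ge0// divff.
have := hA Q G Q0 mQ G0 mG iQ iG.
have -> : \int[m1]_u \int[m2]_v (A u v * (Q u `^ (1 - e) * G u v `^ (1 - j))) =
    \int[m1]_u ((r `^ (e - 1))%:E * N u `^ t).
  apply: eq_integral => u _.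
  pose c := Q u `^ (1 - e) * (N u `^ (-1)) `^ (1 - j).
  transitivity (\int[m2]_v (c * A u v `^ s)).
    apply: eq_integral => v _; rewrite /G poweRM ?poweR_ge0//.
    rewrite -(poweRrM (A u v)) (muleC (A u v `^ _)) (muleA (Q u `^ _)).
    rewrite (muleCA (A u v)) -/c; congr (_ * _).
    rewrite -[X in X * _](poweRe1 (A0 u v)) -poweRDe.
      by congr (_ `^ _); rewrite /s; field; rewrite gt_eqF.
    by rewrite gt_eqF// addr_gt0// mulr_gt0// subr_gt0.
  rewrite intZl; [|nn|mf|rewrite /c; nn].
  rewrite -/(N u) /c /Q -(fineK (Nfin u)); set n := fine _.
  have n0 : (0 <= n)%R by rewrite fine_ge0.
  rewrite !poweR_EFin -!EFinM; congr EFin.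
  have [->|nn0] := eqVneq n 0%R.
    by rewrite mulr0 powR0 ?mulr0// gt_eqF.
  have np : (0 < n)%R by rewrite lt_neqAle eq_sym nn0.
  rewrite powRM ?powR_ge0// powRV ?(ltW r0)// -powRN opprB -!mulrA; congr (_ * _)%R.
  rewrite -!powRrM -[X in (_ * (_ * X))%R](powRr1 n0) -!powRD_gt0//.
  congr (_ `^ _)%R; rewrite /t; field; rewrite gt_eqF//.
rewrite intZl; [|nn|mf|nn].
rewrite -JE EJ -EFinM lee_fin => rC.
have {}rC : (r `^ e <= C)%R.
  apply: le_trans rC; rewrite -[X in (_ * X)%R](powRr1 (ltW r0)) -powRD_gt0//.
  by rewrite subrK.
rewrite lee_fin -(powRr1 (ltW r0)) -(divff (lt0r_neq0 e0)) powRrM.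
by apply: ge0_ler_powR => //; rewrite ?nnegrE ?powR_ge0// invr_ge0 ltW.
Qed.

Let sigma_finite_indic d (T : measurableType d)
    (m : {sigma_finite_measure set T -> \bar R}) (r : R) : (0 < r)%R ->
  exists i : nat -> T -> R, [/\ forall k x, (0 <= i k x <= 1)%R,
    forall k k' x, (k <= k')%N -> (i k x <= i k' x)%R,
    forall x, exists k, i k x = 1%R,
    forall k, measurable_fun setT (i k) &
    forall k, \int[m]_x (i k x `^ r)%:E < +oo].
Proof.
move=> r0.
have /sigma_finiteP[F [FT ndF mF]] := sigma_finiteT m.
exists (fun k => \1_(F k)); split.
- by move=> k x; rewrite indicE; case: (_ \in _); rewrite ?lexx ?ler01.
- move=> k k' x kk'; rewrite !indicE ler_nat.
  case xF : (x \in F k) => //; rewrite (_ : x \in F k')//.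
  by apply/mem_set; have /subsetPset h := ndF _ _ kk'; exact: h (set_mem xF).
- move=> x; have : [set: T] x by [].
  by rewrite FT => -[k _ Fx]; exists k; rewrite indicE mem_set.
- by move=> k; apply: measurable_indic; exact: (mF k).1.
- move=> k; under eq_integral => x _.
    rewrite (_ : (\1_(F k) x `^ r)%R = \1_(F k) x); last first.
      by rewrite indicE; case: (_ \in _); rewrite ?powR1// powR0// gt_eqF.
    over.
  by rewrite integral_indic ?setIT//; have [] := mF k.
Qed.

(** The left-hand side is the power 1/e of the norm of A in L^(1/e) in u of L^(1/j) in v. The
    truncations [B k], in value and in support, have finite norm, and monotone convergence passes
    through both integrals. *)
Lemma mixed_norm_dual (A : U -> V -> \bar R) (C : R) : (0 <= C)%R ->
  nneg2 A -> meas2 A ->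
  (forall (Q : U -> \bar R) (G : U -> V -> \bar R),
    nneg1 Q -> measurable_fun setT Q -> nneg2 G -> meas2 G ->
    \int[m1]_u Q u <= 1 -> (forall u, \int[m2]_v G u v <= 1) ->
    \int[m1]_u \int[m2]_v (A u v * (Q u `^ (1 - e) * G u v `^ (1 - j))) <= C%:E) ->
  \int[m1]_u (\int[m2]_v A u v `^ j^-1) `^ (j / e) <= (C `^ e^-1)%:E.
Proof.
move=> C0 A0 mA hA; rewrite -/s -/t.
have [iU [iU01 ndU exU miU fU]] := sigma_finite_indic m1 t0.
have [iV [iV01 ndV exV miV fV]] := sigma_finite_indic m2 s0.
have iU0 k x : (0 <= iU k x)%R by case/andP: (iU01 k x).
have iV0 k x : (0 <= iV k x)%R by case/andP: (iV01 k x).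
have iU1 k x : (iU k x <= 1)%R by case/andP: (iU01 k x).
have iV1 k x : (iV k x <= 1)%R by case/andP: (iV01 k x).
pose B k u v : \bar R := (iU k u `^ j * iV k v)%:E * mine (A u v) k%:R%:E.
have min0 k u v : 0 <= mine (A u v) k%:R%:E by rewrite le_min A0 lee_fin ler0n.
have B0 k u v : 0 <= B k u v.
  by rewrite /B mule_ge0// lee_fin mulr_ge0// powR_ge0.
have mB k : meas2 (B k).
  rewrite /B; have := miU k; have := miV k => ? ?; mf.
have BA k u v : B k u v <= A u v.
  rewrite /B -[leRHS]mul1e; apply: lee_pmul => //.
  - by rewrite lee_fin mulr_ge0// powR_ge0.
  - rewrite lee_fin -[leRHS]mulr1 ler_pM// ?powR_ge0//.
    have := @ge0_ler_powR R j (ltW j0) (iU k u) 1%R.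
    by rewrite powR1 !nnegrE; apply.
  - by rewrite ge_min lexx.
have ndB k k' u v : (k <= k')%N -> B k u v <= B k' u v.
  move=> kk'; rewrite /B; apply: lee_pmul => //.
  - by rewrite lee_fin mulr_ge0// powR_ge0.
  - rewrite lee_fin ler_pM ?powR_ge0// ?ndV//.
    by rewrite ge0_ler_powR ?nnegrE ?ndU// ltW.
  - rewrite le_min ge_min lexx/= ge_min lee_fin ler_nat kk' orbT//.
have supB u v b : (forall k, B k u v <= b) -> A u v <= b.
  move=> hb; have [k1 hk1] := exU u; have [k2 hk2] := exV v.
  pose K := maxn k1 k2.
  have BE k : (K <= k)%N -> B k u v = mine (A u v) k%:R%:E.
    move=> Kk; rewrite /B.
    have -> : iU k u = 1%R.
      apply/eqP; rewrite eq_le iU1/= -hk1 ndU//.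
      by rewrite (leq_trans _ Kk)// leq_maxl.
    have -> : iV k v = 1%R.
      apply/eqP; rewrite eq_le iV1/= -hk2 ndV//.
      by rewrite (leq_trans _ Kk)// leq_maxr.
    by rewrite powR1 mulr1 mul1e.
  case EA : (A u v) (A0 u v) => [a| |]// a0.
    pose k := maxn K (Num.bound a).
    have := hb k; rewrite BE ?leq_maxl// EA; congr (_ <= _).
    apply/min_idPl; rewrite lee_fin.
    apply: (le_trans (ltW (archi_boundP _))) => //.
    by rewrite ler_nat leq_maxr.
  rewrite leye_eq; apply/eqP/eqyP => r r0.
  pose k := maxn K (Num.bound r); apply: (le_trans _ (hb k)).
  rewrite BE ?leq_maxl// EA min_r ?leey// lee_fin.
  apply: (le_trans (ltW (archi_boundP (ltW r0)))).
  by rewrite ler_nat leq_maxr.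
have limB u v : limn (fun k => B k u v) = A u v.
  by apply: limn_nd_eq; [move=> k k'; exact: ndB|move=> k; exact: BA|exact: supB].
have powB u v : A u v `^ s = limn (fun k => B k u v `^ s).
  by rewrite limn_poweR ?limB// => k k'; exact: ndB.
have iB u : \int[m2]_v A u v `^ s = limn (fun k => \int[m2]_v B k u v `^ s).
  rewrite -monotone_convergence//.
  - by apply: eq_integral => v _; rewrite powB.
  - by move=> k; have := mB k => ?; mf.
  - by move=> k v _; nn.
  - move=> v _ k k' kk'; apply: le_poweR (ndB _ _ _ _ kk') => //.
    exact: ltW.
have ndiB u k k' : (k <= k')%N ->
    \int[m2]_v B k u v `^ s <= \int[m2]_v B k' u v `^ s.
  move=> kk'; apply: le_int => v; first nn.
  by apply: le_poweR (ndB _ _ _ _ kk') => //; exact: ltW.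
have -> : \int[m1]_u (\int[m2]_v A u v `^ s) `^ t =
    limn (fun k => \int[m1]_u (\int[m2]_v B k u v `^ s) `^ t).
  rewrite -monotone_convergence//.
  - apply: eq_integral => u _; rewrite iB limn_poweR//.
    + by move=> k; nn.
    + by move=> k k'; exact: ndiB.
  - by move=> k; have := mB k => ?; mf.
  - by move=> k u _; nn.
  - move=> u _ k k' kk'; apply: le_poweR (ndiB _ _ _ kk'); first exact: ltW.
    by nn.
apply: lime_le.
  apply: ereal_nondecreasing_is_cvgn => k k' kk'.
  apply: le_int => u; first nn.
  apply: le_poweR (ndiB _ _ _ kk'); first exact: ltW.
  by nn.
apply: nearW => k.
apply: (@dual_bounded (B k) C k%:R (iU k) (iV k)) => //.
- move=> u v; rewrite /B.
  apply: (@le_trans _ _ ((iU k u `^ j * iV k v)%:E * k%:R%:E)).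
    apply: lee_wpmul2l; first by rewrite lee_fin mulr_ge0// powR_ge0.
    by rewrite ge_min lexx orbT.
  by rewrite -EFinM lee_fin mulrC mulrA.
- move=> Q G Q0 mQ G0 mG iQ iG.
  apply: le_trans (hA Q G Q0 mQ G0 mG iQ iG).
  apply: le_int => u; first nn.
  apply: le_int => v; first nn.
  by apply: lee_wpmul2r; first nn.
Qed.

End mixed_norm_duality.

(** Homogeneous estimates need only be checked on data normalised to N <= 1. If N = 0, every c is
    admissible, which forces J = 0; if N = +oo, the right-hand side is +oo. *)
Lemma homogeneous_le (R : realType) (J N : \bar R) (p C : R) :
  (0 < p)%R -> (0 < C)%R -> 0 <= J -> 0 <= N ->
  (forall c : R, (0 < c)%R -> c%:E * N <= 1 -> (c `^ p)%:E * J <= C%:E) ->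
  J <= C%:E * N `^ p.
Proof.
move=> p0 C0 J0 N0 h; case: N N0 h => [n| |//] n0 h; last first.
  by rewrite poweRyr ?gt_eqF// gt0_muley ?leey// lte_fin.
move: n0; rewrite lee_fin le_eqVlt => /predU1P[n0|n0].
  have {}h c : (0 < c)%R -> (c `^ p)%:E * J <= C%:E.
    by move=> c0; apply: h => //; rewrite -n0 mule0 lee01.
  rewrite -n0 poweR0r ?gt_eqF// mule0.
  case: J J0 h => [j| |//] j0 h; last first.
    by have := h 1%R ltr01; rewrite powR1 mul1e.
  rewrite lee_fin leNgt; apply/negP => jp.
  have c0 : (0 < ((C + 1) / j) `^ p^-1)%R by rewrite powR_gt0// divr_gt0// addr_gt0.
  have := h _ c0; rewrite -powRrM mulVf ?gt_eqF// powRr1; last first.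
    by rewrite divr_ge0// addr_ge0// ltW.
  rewrite -EFinM lee_fin divfK ?gt_eqF//; lra.
have n10 : (0 < n^-1)%R by rewrite invr_gt0.
have := h _ n10; rewrite -EFinM mulVf ?gt_eqF// => /(_ (lexx _)).
rewrite powRV ?(ltW n0)// => hJ.
have np : (0 < n `^ p)%R by rewrite powR_gt0.
rewrite poweR_EFin muleC -[J]mul1e -(@mulfV _ (n `^ p)%R) ?gt_eqF// EFinM -muleA.
by apply: lee_wpmul2l => //; rewrite lee_fin ltW.
Qed.

Section norm_duality.
Context d1 (U : measurableType d1) (R : realType).
Variables (m1 : {sigma_finite_measure set U -> \bar R}).
Variables (e : R).
Hypotheses (e0 : (0 < e)%R) (e1 : (e < 1)%R).

Lemma norm_dual (A : U -> \bar R) (C : R) : (0 <= C)%R ->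
  nneg1 A -> measurable_fun setT A ->
  (forall (Q : U -> \bar R), nneg1 Q -> measurable_fun setT Q ->
    \int[m1]_u Q u <= 1 -> \int[m1]_u (A u * Q u `^ (1 - e)) <= C%:E) ->
  \int[m1]_u A u `^ e^-1 <= (C `^ e^-1)%:E.
Proof.
(* The mixed-norm statement is applied with a one-point inner space, where any inner exponent will
   do; 1/2 is an arbitrary choice. *)
move=> C0 A0 mA hA; pose j := (2^-1 : R)%R.
have j0 : (0 < j)%R by rewrite invr_gt0.
have j1 : (j < 1)%R by rewrite invf_lt1// ltr1n.
pose dd : {sigma_finite_measure set unit -> \bar R} := \d_ tt.
have id (f : unit -> \bar R) : \int[dd]_v f v = f tt.
  by rewrite integral_dirac// diracT mul1e.
have := @mixed_norm_dual _ _ U unit R m1 dd e j e0 j0 j1 (fun u _ => A u) C C0.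
have -> : \int[m1]_u (\int[dd]_v A u `^ j^-1) `^ (j / e) = \int[m1]_u A u `^ e^-1.
  apply: eq_integral => u _; rewrite id -poweRrM; congr (_ `^ _).
  by field; rewrite /j invr_eq0 pnatr_eq0/= gt_eqF.
apply => //.
- by mf.
- move=> Q G Q0 mQ G0 mG iQ iG.
  apply: le_trans (hA Q Q0 mQ iQ).
  apply: le_int => u; first nn.
  rewrite id muleA -[leRHS]mule1; apply: lee_wpmul2l; first nn.
  have := iG u; rewrite id => hG.
  rewrite -[leRHS](poweR1r (1 - j)); apply: le_poweR => //.
  by rewrite subr_ge0 ltW.
Qed.

End norm_duality.

Section minkowski_integral.
Context d1 d2 (U : measurableType d1) (X : measurableType d2) (R : realType).
Variables (m1 : {sigma_finite_measure set U -> \bar R})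
  (m2 : {sigma_finite_measure set X -> \bar R}).

(** By duality in u it suffices to pair with Q^(1-e); Tonelli moves x outside, and Hölder applies
    for each x separately. *)
Lemma minkowski_int (e : R) (P : U -> X -> \bar R) : (0 < e)%R -> (e < 1)%R ->
  nneg2 P -> meas2 P ->
  \int[m1]_u (\int[m2]_x P u x) `^ e^-1 <=
  (\int[m2]_x (\int[m1]_u P u x `^ e^-1) `^ e) `^ e^-1.
Proof.
move=> e0 e1 P0 mP.
have mP' : meas2 (fun x u => P u x).
  exact: (measurable_comp2 mP measurable_snd measurable_fst).
set N := \int[m2]_x _.
have N0 : 0 <= N by rewrite /N; nn.
case EN : N N0 => [C| |//] C0; last first.
  by rewrite poweRyr ?leey// invr_neq0// gt_eqF.
rewrite poweR_EFin; apply: norm_dual => //; [by move=> u; nn|by mf|].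
move=> Q Q0 mQ iQ.
have -> : \int[m1]_u ((\int[m2]_x P u x) * Q u `^ (1 - e)) =
    \int[m1]_u \int[m2]_x (P u x * Q u `^ (1 - e)).
  by apply: eq_integral => u _; rewrite intZr; [|nn|mf|nn].
rewrite tonelli; [|nn|mf].
rewrite -EN /N; apply: le_int => x; first nn.
apply: le_trans.
  apply: (@le_trans _ _ (\int[m1]_u ((P u x `^ e^-1) `^ e * Q u `^ (1 - e)))).
    by apply: le_int => u; [nn|rewrite poweRVK// gt_eqF].
  apply: hoelder_int => //.
  - mf.
  - nn.
rewrite -[leRHS]mule1; apply: lee_wpmul2l; first nn.
rewrite -[leRHS](poweR1r (1 - e)); apply: le_poweR => //.
  by rewrite subr_ge0 ltW.
by nn.
Qed.

End minkowski_integral.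

(** * Fractional integration on the line *)

Section fractional_integral.
Context (R : realType).
Local Notation RR := (measurableTypeR R).
Local Notation mu := (@lebesgue_measure R).

(** The dual form is [hls] with exponents 1 - i, i + a and 1 - a, whose sum is 2. *)
Lemma fractional_integral_le (a i : R) :
  (0 < a)%R -> (a < 1)%R -> (0 < i)%R -> (i + a < 1)%R ->
  exists2 C : R, (0 < C)%R & forall f : RR -> \bar R,
    nneg1 f -> measurable_fun setT f ->
    \int[mu]_s (\int[mu]_y ((`|s - y| `^ (a - 1))%:E * f y)) `^ i^-1 <=
    C%:E * (\int[mu]_y f y `^ (i + a)^-1) `^ ((i + a) / i).
Proof.
move=> a0 a1 i0 ia1; have ia0 : (0 < i + a)%R by rewrite addr_gt0.
have i1 : (i < 1)%R by lra.
have [C C0 hC] : exists2 C : R, (0 < C)%R & forall F G : RR -> \bar R,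
    nneg1 F -> nneg1 G -> measurable_fun setT F -> measurable_fun setT G ->
    \int[mu]_x F x <= 1 -> \int[mu]_y G y <= 1 ->
    \int[mu]_x \int[mu]_y (F x `^ (1 - i) * G y `^ (i + a) * (`|x - y| `^ (- (1 - a)))%:E) <= C%:E.
  by apply: hls; lra.
exists (C `^ i^-1)%R => [|f f0 mF]; first by rewrite powR_gt0.
apply: homogeneous_le.
- by rewrite divr_gt0.
- by rewrite powR_gt0.
- by nn.
- by nn.
move=> c c0 hc; pose b := (c `^ (i + a))%R.
have b0 : (0 < b)%R by rewrite powR_gt0.
pose g y := b%:E * f y.
have g0 : nneg1 g by move=> y; rewrite /g; nn.
have mg : measurable_fun setT g by rewrite /g; mf.
have ig : \int[mu]_y g y `^ (i + a)^-1 <= 1.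
  apply: le_trans hc; rewrite -intZl; [|nn|mf|nn].
  apply: le_int => y; first nn.
  rewrite /g poweRM//; last nn.
  by rewrite poweR_EFin /b -powRrM mulfV ?gt_eqF// powRr1// ltW.
have -> : (c `^ ((i + a) / i))%:E *
    \int[mu]_s (\int[mu]_y ((`|s - y| `^ (a - 1))%:E * f y)) `^ i^-1 =
   \int[mu]_s (\int[mu]_y ((`|s - y| `^ (a - 1))%:E * g y)) `^ i^-1.
  rewrite -intZl; [|nn|mf|nn]; apply: eq_integral => s _.
  have -> : \int[mu]_y ((`|s - y| `^ (a - 1))%:E * g y) =
      b%:E * \int[mu]_y ((`|s - y| `^ (a - 1))%:E * f y).
    rewrite -intZl; [|nn|mf|nn]; apply: eq_integral => y _.
    by rewrite /g muleCA.
  rewrite poweRM; [|nn|nn].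
  by rewrite poweR_EFin /b -powRrM.
apply: norm_dual => //; [exact: ltW|by move=> s; nn|by mf|].
move=> Q Q0 mQ iQ.
apply: le_trans (hC Q (fun y => g y `^ (i + a)^-1) Q0 _ mQ _ iQ ig).
- apply: le_int => s; first nn.
  rewrite -intZr; [|nn|mf|nn]; apply: le_int => y; first nn.
  rewrite poweRVK ?gt_eqF// opprB muleC -muleA [g y * _]muleC//.
- by nn.
- by mf.
Qed.

End fractional_integral.

(** * Lebesgue measure on tuples *)

Section product_sigma_finite.
Context d1 d2 (T1 : measurableType d1) (T2 : measurableType d2) (R : realType).
Variables (m1 : {sigma_finite_measure set T1 -> \bar R})
  (m2 : {sigma_finite_measure set T2 -> \bar R}).

Lemma product_measure_sigma_finite : sigma_finite setT (m1 \x m2).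
Proof.
have /sigma_finiteP[F [FT ndF mF]] := sigma_finiteT m1.
have /sigma_finiteP[G [GT ndG mG]] := sigma_finiteT m2.
exists (fun k => F k `*` G k).
  apply/seteqP; split => // -[x y] _.
  have [i _ Fx] : (\bigcup_i F i) x by rewrite -FT.
  have [j _ Gy] : (\bigcup_i G i) y by rewrite -GT.
  exists (maxn i j) => //; split => /=.
    by have /subsetPset h := ndF _ _ (leq_maxl i j); exact: h.
  by have /subsetPset h := ndG _ _ (leq_maxr i j); exact: h.
move=> k; have [mFk Fk] := mF k; have [mGk Gk] := mG k; split.
  exact: measurableX.
by rewrite product_measure1E//; apply: lte_mul_pinfty => //; rewrite ge0_fin_numE.
Qed.


Definition sigma_finite_prod : {sigma_finite_measure set (T1 * T2)%type -> \bar R} :=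
  HB.pack (m1 \x m2)%E (Measure_isSigmaFinite.Build _ _ _ (m1 \x m2)%E product_measure_sigma_finite).

End product_sigma_finite.

Section lebesgue_tuple_sigma_finite.
Context (R : realType).

(** Tonelli on tuples rests on this. The exhaustion of the product is pulled back along [h], which
    inverts the prepending of a coordinate. *)
Lemma lebesgue_tuple_sigma_finite n : sigma_finite setT (@lebesgue_tuple R n).
Proof.
elim: n => [|n [F FT mF]].
  exists (fun=> setT); first by rewrite bigcup_const.
  move=> _; split => //.
  by rewrite /= diracE mem_set// ltry.
pose m : {sigma_finite_measure set (n.-tuple R) -> \bar R} :=
  HB.pack (@lebesgue_tuple R n) (Measure_isSigmaFinite.Build _ _ _
    (@lebesgue_tuple R n) (ex_intro2 _ _ F FT mF)).
have [G GT mG] := product_measure_sigma_finite m (@lebesgue_measure R).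
pose h (x : n.+1.-tuple R) : n.-tuple R * measurableTypeR R :=
  ([tuple of behead x], thead x).
have mh : measurable_fun setT h.
  apply: measurable_fun_pair; first exact: measurable_behead.
  exact: measurable_tnth.
exists (fun k => h @^-1` G k).
  by rewrite -preimage_bigcup -GT preimage_setT.
move=> k; have [mGk Gk] := mG k; split.
  by rewrite -[X in measurable X]setTI; exact: mh.
rewrite /= /pushforward (_ : _ @^-1` _ = G k)//.
apply/seteqP; split => -[x t] /=; rewrite /h theadE (_ : [tuple of _] = x)//;
  exact: val_inj.
Qed.

HB.instance Definition _ n := Measure_isSigmaFinite.Build _ _ _ (@lebesgue_tuple R n)
  (@lebesgue_tuple_sigma_finite n).
End lebesgue_tuple_sigma_finite.

Lemma dotp_cons (R : realType) n (s t : R) (x y : n.-tuple R) :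
  dotp (cons_tuple s x) (cons_tuple t y) = (s * t + dotp x y)%R.
Proof.
rewrite /dotp big_ord_recl !tnth0; congr (_ + _)%R.
by apply: eq_bigr => i _; rewrite !tnthS.
Qed.

Section lebesgue_tuple_integral.
Context (R : realType).
Local Notation RR := (measurableTypeR R).
Local Notation mu := (@lebesgue_measure R).
Local Notation L := (lebesgue_tuple R).

Lemma int_tuple0 (F : 0.-tuple R -> \bar R) : measurable_fun setT F ->
  \int[L 0%N]_x F x = F [tuple].
Proof.
move=> mF; transitivity (\int[\d_ ([tuple] : 0.-tuple R)]_x F x).
  by apply: eq_measure_integral.
by rewrite integral_dirac// diracT mul1e.
Qed.

Lemma int_tupleS m (F : m.+1.-tuple R -> \bar R) : nneg1 F ->
  measurable_fun setT F ->
  \int[L m.+1]_x F x = \int[L m]_x \int[mu]_t F (cons_tuple t x).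
Proof.
move=> F0 mF.
pose h (z : m.-tuple R * RR) : m.+1.-tuple R := [tuple of z.2 :: z.1].
have mh : measurable_fun setT h := @measurable_cons_pair R m.
transitivity (\int[measure_function_pushforward__canonical__measure_function_Measure
    (L m \x mu) mh]_x F x).
  by apply: eq_measure_integral.
have E := ge0_integral_pushforward mh (L m \x mu) measurableT mF (fun y _ => F0 y).
rewrite E preimage_setT.
rewrite (fubini_tonelli1 (F \o h))//; first exact: (measurableT_comp mF mh).
by move=> z; exact: F0.
Qed.

End lebesgue_tuple_integral.

(** * The X-ray transform in the plane *)

Section xray.
Context (R : realType).
Local Notation RR := (measurableTypeR R).
Local Notation mu := (@lebesgue_measure R).

(** For comparisons that break down at one point: equal slopes in the plane, and z = 0 in the chart
    of the sphere. *)
Lemma le_int_neq (x0 : RR) (f g : RR -> \bar R) : nneg1 f -> nneg1 g ->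
  measurable_fun setT f -> measurable_fun setT g ->
  (forall x, x != x0 -> f x <= g x) -> \int[mu]_x f x <= \int[mu]_x g x.
Proof.
move=> f0 g0 mF mg fg; apply: ae_ge0_le_integral => //.
exists [set x0]; split => //.
  exact: lebesgue_measure_set1.
move=> x /= h; apply/eqP; apply: contra_notT h => xx0 _; exact: fg.
Qed.

(* Two lines of distinct slopes are transversal: (x, w) |-> (w + u x, w + u' x)
   has Jacobian u - u'. *)
Lemma int_two_lines (a b : RR -> \bar R) (u u' : R) : u' != u ->
  nneg1 a -> nneg1 b -> measurable_fun setT a -> measurable_fun setT b ->
  \int[mu]_x \int[mu]_w (a (w + u * x)%R * b (w + u' * x)%R) =
  (`|u - u'|^-1)%:E * (\int[mu]_w a w * \int[mu]_w b w).
Proof.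
move=> uu' a0 b0 ma mb.
have mb' (c : R) : measurable_fun [set: RR * RR] (fun z => b (z.2 + c * z.1)%R) by mf.
have -> : \int[mu]_x \int[mu]_w (a (w + u * x)%R * b (w + u' * x)%R) =
    \int[mu]_x \int[mu]_w (a w * b (w + (u' - u) * x)%R).
  apply: eq_integral => x _.
  rewrite -[RHS](@int_shift R (u * x)); [|nn|mf].
  by apply: eq_integral => w _; congr (_ * b _); ring.
rewrite tonelli; [|nn|mf].
rewrite [RHS]muleC -muleA -intZr; [|nn|mf|nn].
apply: eq_integral => w _; rewrite intZl; [|nn|mf|nn].
congr (_ * _); rewrite [RHS]muleC.
rewrite -normrN opprB -(@int_affine R (u' - u) w b)//; last by rewrite subr_eq0.
by apply: eq_integral => x _; rewrite addrC.
Qed.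

(** The dual form of the bound of the X-ray transform from L^(3/2) to L^3. Squaring the average Y
    over slopes produces pairs of lines, whose transversality yields the kernel |u - u'|^(-2/3);
    this is [hls] with all three exponents equal to 2/3. *)
Lemma xray_form_endpoint : exists2 C : R, (0 < C)%R & forall F G : RR -> RR -> \bar R,
  nneg2 F -> nneg2 G -> meas2 F -> meas2 G ->
  \int[mu]_x \int[mu]_w F x w <= 1 -> \int[mu]_u \int[mu]_v G u v <= 1 ->
  \int[mu]_x \int[mu]_u \int[mu]_w (F x w `^ (2 / 3) * G u (w + u * x)%R `^ (2 / 3))
    <= C%:E.
Proof.
have [C C0 hC] : exists2 C : R, (0 < C)%R & forall F G : RR -> \bar R,
    nneg1 F -> nneg1 G -> measurable_fun setT F -> measurable_fun setT G ->
    \int[mu]_x F x <= 1 -> \int[mu]_y G y <= 1 ->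
    \int[mu]_x \int[mu]_y (F x `^ (2/3) * G y `^ (2/3) * (`|x - y| `^ (- (2/3)))%:E) <= C%:E.
  by apply: hls; lra.
exists (1 + C)%R => [|F G F0 G0 mF mG iF iG]; first by rewrite addr_gt0.
pose m2 := sigma_finite_prod mu mu.
pose f (z : RR * RR) := F z.1 z.2.
pose g (u : RR) (z : RR * RR) := G u (z.2 + u * z.1)%R `^ (2 / 3).
have f0 : nneg1 f by move=> z; rewrite /f; nn.
have g0 : nneg2 g by move=> u z; rewrite /g; nn.
have mf_ : measurable_fun setT f by rewrite /f; mf.
have mg : meas2 g by rewrite /g; mf.
have m2E (h : RR -> RR -> \bar R) : nneg2 h -> meas2 h ->
    \int[m2]_z h z.1 z.2 = \int[mu]_x \int[mu]_w h x w.
  by move=> h0 mh; exact: (fubini_tonelli1 (fun z => h z.1 z.2)).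
pose H u := \int[mu]_v G u v.
have H0 : nneg1 H by move=> u; rewrite /H; nn.
have mH : measurable_fun setT H by rewrite /H; mf.
pose Y (z : RR * RR) := \int[mu]_u g u z.
have Y0 : nneg1 Y by move=> z; rewrite /Y; nn.
have mY : measurable_fun setT Y by rewrite /Y; mf.
have -> : \int[mu]_x \int[mu]_u \int[mu]_w
    (F x w `^ (2 / 3) * G u (w + u * x)%R `^ (2 / 3)) =
    \int[m2]_z (f z `^ (2 / 3) * Y z).
  rewrite (m2E (fun x w => F x w `^ (2/3) * \int[mu]_u (G u (w + u * x)%R `^ (2/3))));
    [|nn|mf].
  apply: eq_integral => x _; rewrite tonelli; [|nn|mf].
  by apply: eq_integral => w _; rewrite intZl; [|nn|mf|nn].
(* f^(2/3) Y is the geometric mean of f and f^(1/3) Y^2, hence at most their sum; the square is then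
   written as a double integral over u and u'. *)
apply: (@le_trans _ _ (\int[m2]_z (f z + f z `^ (1 / 3) * (Y z * Y z)))).
  apply: le_int => z; first nn.
  have -> : f z `^ (2 / 3) * Y z =
      f z `^ (1 / 2) * (f z `^ (1 / 3) * (Y z * Y z)) `^ (1 - 1 / 2).
    have -> : (1 - 1 / 2 = 1 / 2 :> R)%R by lra.
    rewrite !poweRM; [|nn..].
    rewrite -(@poweRDe _ (Y z) (1 / 2) (1 / 2)); last by apply: lt0r_neq0; lra.
    have -> : (1 / 2 + 1 / 2 = 1 :> R)%R by lra.
    rewrite poweRe1// muleA -(poweRrM (f z)) -(@poweRDe _ (f z)); last first.
      by apply: lt0r_neq0; lra.
    by congr (_ `^ _ * _); lra.
  apply: poweR_interp_le; [lra|lra|nn|nn].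
rewrite intD; [|nn|mf|nn|mf].
rewrite EFinD; apply: leeD; first by rewrite (m2E F).
have -> : \int[m2]_z (f z `^ (1 / 3) * (Y z * Y z)) =
    \int[mu]_u \int[mu]_u' \int[m2]_z (f z `^ (1 / 3) * (g u z * g u' z)).
  have -> : \int[m2]_z (f z `^ (1 / 3) * (Y z * Y z)) =
      \int[m2]_z \int[mu]_u \int[mu]_u' (f z `^ (1 / 3) * (g u z * g u' z)).
    apply: eq_integral => z _; rewrite {1}/Y -intZr; [|nn|mf|nn].
    rewrite -intZl; [|nn|mf|nn]; apply: eq_integral => u _.
    rewrite /Y -intZl; [|nn|mf|nn]; rewrite -intZl; [|nn|mf|nn].
    by [].
  rewrite tonelli; [|nn|mf]; apply: eq_integral => u _.
  by rewrite tonelli; [|nn|mf].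
apply: le_trans (hC H H H0 H0 mH mH iG iG).
apply: le_int => u; first nn.
(* The two lines have distinct slopes except for the single value u' = u. *)
apply: (le_int_neq (x0 := u)); [nn|nn|mf|mf|].
move=> u' uu'.
pose k (z : RR * RR) := G u (z.2 + u * z.1)%R * G u' (z.2 + u' * z.1)%R.
have k0 : nneg1 k by move=> z; rewrite /k; nn.
have mk : measurable_fun setT k by rewrite /k; mf.
apply: (@le_trans _ _ (\int[m2]_z (f z `^ (1 / 3) * k z `^ (1 - 1 / 3)))).
  apply: le_int => z; first nn.
  rewrite /k poweRM// /g.
  by have -> : (1 - 1 / 3 = 2 / 3 :> R)%R by lra.
apply: le_trans.
  by apply: hoelder_int => //; lra.
have -> : (1 - 1 / 3 = 2 / 3 :> R)%R by lra.
apply: (@le_trans _ _ (1 * ((`|u - u'|^-1)%:E * (H u * H u')) `^ (2 / 3))).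
  apply: lee_pmul; [nn|nn| |].
    rewrite -[leRHS](poweR1r (1/3)); apply: le_poweR; [lra|nn|by rewrite (m2E F)].
  rewrite (m2E (fun x w => G u (w + u * x)%R * G u' (w + u' * x)%R)); [|nn|mf].
  rewrite (int_two_lines (a := G u) (b := G u') uu'); [exact: lexx|nn|nn|mf|mf].
rewrite mul1e poweRM; [|nn|nn]; rewrite [(H u * H u') `^ _]poweRM//.
by rewrite poweR_EFin powRV// -powRN muleC.
Qed.
End xray.

(** * Mixed-norm estimates for the X-ray transform in the plane *)

Section xray_mixed.
Context (R : realType).
Local Notation RR := (measurableTypeR R).
Local Notation mu := (@lebesgue_measure R).
Implicit Types e i : R.

(** The exponents (1 - e, i, 1 - (i - e)) are the mean, with weights 1 - 3e and 3e, of (1, a, 1 -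
    a), where the form is trivially bounded, and (2/3, 2/3, 2/3), the endpoint form. The range 2e <=
    i <= 1 - e says exactly that a lies in [0, 1]. *)
Let interp_pointwise e i (p q f g : \bar R) : (0 < e)%R -> (3 * e < 1)%R ->
  (2 * e <= i)%R -> (i <= 1 - e)%R -> 0 <= p -> 0 <= q -> 0 <= f -> 0 <= g ->
  p `^ (1 - e) * f `^ i * (q `^ (1 - e) * g `^ (1 - (i - e))) <=
  p * q * (f + g) + (p * f) `^ (2 / 3) * (q * g) `^ (2 / 3).
Proof.
move=> e0 e3 ei i1 p0 q0 f0 g0; pose t := (3 * e)%R.
have d1 : (0 < 1 - t)%R by rewrite /t; lra.
have d0 := lt0r_neq0 d1.
pose a := ((i - 2 * e) / (1 - t))%R.
have a0 : (0 <= a)%R by rewrite divr_ge0// /t; lra.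
have a1 : (a <= 1)%R by rewrite /a ler_pdivrMr// /t; lra.
apply: (@le_trans _ _
  ((p * q * (f `^ a * g `^ (1 - a))) `^ (1 - t) *
   ((p * f) `^ (2 / 3) * (q * g) `^ (2 / 3)) `^ (1 - (1 - t)))); last first.
  apply: (@le_trans _ _ (p * q * (f `^ a * g `^ (1 - a)) +
      (p * f) `^ (2 / 3) * (q * g) `^ (2 / 3))).
    by apply: poweR_interp_le; [rewrite /t; lra|rewrite /t; lra|nn|nn].
  apply: leeD => //; apply: lee_wpmul2l; first nn.
  exact: poweR_interp_le.
rewrite !poweRM; [|nn..].
rewrite -!poweRrM.
rewrite mule.[AC ((2*2)*(2*2))%AC (((1*5)*(3*6))*((2*7)*(4*8)))%AC].
have adE : (a * (1 - t) = i - 2 * e)%R by rewrite /a divfK.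
have E1 : (1 - t + 2 / 3 * (1 - (1 - t)) = 1 - e)%R by rewrite /t; lra.
have E2 : (a * (1 - t) + 2 / 3 * (1 - (1 - t)) = i)%R by rewrite adE /t; lra.
have E3 : ((1 - a) * (1 - t) + 2 / 3 * (1 - (1 - t)) = 1 - (i - e))%R.
  by rewrite mulrBl mul1r adE /t; lra.
rewrite -!poweRDe ?E1 ?E2 ?E3//; by apply: lt0r_neq0; lra.
Qed.

Lemma xray_form_mixed e i : (0 < e)%R -> (3 * e < 1)%R ->
  (2 * e <= i)%R -> (i <= 1 - e)%R ->
  exists2 C : R, (0 < C)%R & forall (P Q : RR -> \bar R) (F G : RR -> RR -> \bar R),
  nneg1 P -> nneg1 Q -> nneg2 F -> nneg2 G ->
  measurable_fun setT P -> measurable_fun setT Q -> meas2 F -> meas2 G ->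
  \int[mu]_x P x <= 1 -> (forall x, \int[mu]_w F x w <= 1) ->
  \int[mu]_u Q u <= 1 -> (forall u, \int[mu]_w G u w <= 1) ->
  \int[mu]_x \int[mu]_u \int[mu]_w
    (P x `^ (1 - e) * F x w `^ i *
     (Q u `^ (1 - e) * G u (w + u * x)%R `^ (1 - (i - e)))) <= C%:E.
Proof.
move=> e0 e3 ei i1; have [C C0 hC] := xray_form_endpoint R.
exists (2 + C)%R => [|P Q F G P0 Q0 F0 G0 mP mQ mF mG iP iF iQ iG].
  by rewrite addr_gt0.
have normalized (S : RR -> \bar R) (K : RR -> RR -> \bar R) :
    nneg1 S -> nneg2 K -> measurable_fun setT S -> meas2 K ->
    \int[mu]_x S x <= 1 -> (forall x, \int[mu]_w K x w <= 1) ->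
    \int[mu]_x \int[mu]_w (S x * K x w) <= 1.
  move=> S0 K0 mS mK iS iK; apply: le_trans iS; apply: le_int => x; first nn.
  rewrite intZl; [|nn|mf|nn]; rewrite -[leRHS]mule1.
  by apply: lee_wpmul2l.
apply: (@le_trans _ _ (\int[mu]_x \int[mu]_u \int[mu]_w
   (P x * Q u * (F x w + G u (w + u * x)%R) +
    (P x * F x w) `^ (2 / 3) * (Q u * G u (w + u * x)%R) `^ (2 / 3)))).
  apply: le_int => x; first nn.
  apply: le_int => u; first nn.
  apply: le_int => w; first nn.
  exact: interp_pointwise.
have -> : \int[mu]_x \int[mu]_u \int[mu]_w
   (P x * Q u * (F x w + G u (w + u * x)%R) +
    (P x * F x w) `^ (2 / 3) * (Q u * G u (w + u * x)%R) `^ (2 / 3)) =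
  \int[mu]_x \int[mu]_u \int[mu]_w (P x * Q u * (F x w + G u (w + u * x)%R)) +
  \int[mu]_x \int[mu]_u \int[mu]_w
    ((P x * F x w) `^ (2 / 3) * (Q u * G u (w + u * x)%R) `^ (2 / 3)).
  rewrite -intD; [|nn|mf|nn|mf]; apply: eq_integral => x _.
  rewrite -intD; [|nn|mf|nn|mf]; apply: eq_integral => u _.
  by rewrite -intD; [|nn|mf|nn|mf].
rewrite EFinD; apply: leeD; last first.
  apply: (hC (fun x w => P x * F x w) (fun u w => Q u * G u w)); [nn|nn|mf|mf| |].
    exact: normalized.
  exact: normalized.
apply: (@le_trans _ _ (\int[mu]_x \int[mu]_u (P x * Q u * 2%:E))).
  apply: le_int => x; first nn.
  apply: le_int => u; first nn.
  rewrite intZl; [|nn|mf|nn]; apply: lee_wpmul2l; first nn.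
  rewrite intD; [|nn|mf|nn|mf].
  rewrite (_ : 2%R = 1 + 1)%R ?EFinD; last by lra.
  apply: leeD; first exact: iF.
  by rewrite (@int_shift R (u * x) (G u)); [exact: iG|nn|mf].
have -> : \int[mu]_x \int[mu]_u (P x * Q u * 2%:E) =
    \int[mu]_x P x * (\int[mu]_u Q u * 2%:E).
  rewrite -intZr; [|nn|mf|nn]; apply: eq_integral => x _.
  rewrite -intZr; [|nn|mf|nn]; rewrite -intZl; [|nn|mf|nn].
  by apply: eq_integral => u _; rewrite muleA.
rewrite -[leRHS]mul1e -[X in _ <= _ * X]mul1e.
by apply: lee_pmul; [nn|nn|exact: iP|apply: lee_pmul; [nn|nn|exact: iQ|]].
Qed.

(** The map goes from L^(1/(1-e)) in x of L^(1/i) in w to L^(1/e) in u of L^(1/(i-e)) in v. After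
    normalisation g factors as P^(1-e) F^i, with P of integral at most 1 and F of integral at most 1
    on every line, as [xray_form_mixed] requires. *)
Lemma xray_mixed e i : (0 < e)%R -> (3 * e < 1)%R ->
  (2 * e <= i)%R -> (i <= 1 - e)%R ->
  exists2 C : R, (0 < C)%R & forall f : RR -> RR -> \bar R, nneg2 f -> meas2 f ->
  \int[mu]_u (\int[mu]_v (\int[mu]_x f x (v - u * x)%R) `^ (i - e)^-1) `^ ((i - e) / e) <=
  C%:E * (\int[mu]_x (\int[mu]_w f x w `^ i^-1) `^ (i / (1 - e))) `^ ((1 - e) / e).
Proof.
move=> e0 e3 ei i1; have [C C0 hC] := xray_form_mixed e0 e3 ei i1.
have i0 : (0 < i)%R by lra.
have e10 : (0 < 1 - e)%R by lra.
have j0 : (0 < i - e)%R by lra.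
have j1 : (i - e < 1)%R by lra.
exists (C `^ e^-1)%R => [|f f0 mf_]; first by rewrite powR_gt0.
apply: homogeneous_le; [by rewrite divr_gt0|by rewrite powR_gt0|nn|nn|].
move=> c c0 hc; pose b := (c `^ (1 - e))%R.
have b0 : (0 < b)%R by rewrite powR_gt0.
pose g x w := b%:E * f x w.
have g0 : nneg2 g by move=> x w; rewrite /g; nn.
have mg : meas2 g by rewrite /g; mf.
pose n x := \int[mu]_w g x w `^ i^-1.
have n0 : nneg1 n by move=> x; rewrite /n; nn.
have mn : measurable_fun setT n by rewrite /n; mf.
pose P x := n x `^ (i / (1 - e)).
have P0 : nneg1 P by move=> x; rewrite /P; nn.
have mP : measurable_fun setT P by rewrite /P; mf.
have iP : \int[mu]_x P x <= 1.
  apply: le_trans hc; rewrite -intZl; [|nn|mf|nn].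
  apply: le_int => x; first nn; rewrite /P /n.
  have -> : \int[mu]_w g x w `^ i^-1 =
     (b `^ i^-1)%:E * \int[mu]_w f x w `^ i^-1.
    rewrite -intZl; [|nn|mf|nn]; apply: eq_integral => w _.
    by rewrite /g poweRM//; nn.
  rewrite poweRM; [|nn|nn]; rewrite poweR_EFin /b -!powRrM.
  rewrite [X in (c `^ X)%R](_ : _ = 1)%R; last by field; rewrite !gt_eqF.
  by rewrite powRr1// ltW.
have -> : (c `^ ((1 - e) / e))%:E * \int[mu]_u (\int[mu]_v
      (\int[mu]_x f x (v - u * x)%R) `^ (i - e)^-1) `^ ((i - e) / e) =
   \int[mu]_u (\int[mu]_v
      (\int[mu]_x g x (v - u * x)%R) `^ (i - e)^-1) `^ ((i - e) / e).
  rewrite -intZl; [|nn|mf|nn]; apply: eq_integral => u _.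
  have -> : \int[mu]_v (\int[mu]_x g x (v - u * x)%R) `^ (i - e)^-1 =
      (b `^ (i - e)^-1)%:E * \int[mu]_v (\int[mu]_x f x (v - u * x)%R) `^ (i - e)^-1.
    rewrite -intZl; [|nn|mf|nn]; apply: eq_integral => v _.
    by rewrite /g intZl; [rewrite poweRM//; nn|nn|mf|nn].
  rewrite [RHS]poweRM; [|nn|nn]; rewrite poweR_EFin /b -!powRrM.
  congr (_ * _); congr EFin; congr powR; field; by rewrite !gt_eqF.
apply: mixed_norm_dual => //; [exact: ltW|nn|mf|].
move=> Q G Q0 mQ G0 mG iQ iG.
(* +oo to the power -1 is +oo by convention, so F is set to 0 where n x is infinite; since P is
   integrable, such x form a null set. *)
pose F x w := if n x < +oo then g x w `^ i^-1 * n x `^ (-1) else 0.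
have F0 : nneg2 F by move=> x w; rewrite /F; nn.
have mF : meas2 F by rewrite /F; mf.
have iF x : \int[mu]_w F x w <= 1.
  rewrite /F; have [nx|_] := boolP (n x < +oo); last by rewrite integral0.
  rewrite intZr; [|nn|mf|nn]; rewrite -/(n x).
  have /fineK <- : n x \is a fin_num by rewrite ge0_fin_numE.
  rewrite poweR_EFin -EFinM lee_fin.
  have [->|nn0] := eqVneq (fine (n x)) 0%R; first by rewrite mul0r.
  by rewrite powR_inv1 ?fine_ge0// divff.
apply: le_trans (hC P Q F G P0 Q0 F0 G0 mP mQ mF mG iP iF iQ iG).
pose h x u w := Q u `^ (1 - e) * G u (w + u * x)%R `^ (1 - (i - e)).
have h0 x u w : 0 <= h x u w by rewrite /h; nn.
have mh x u : measurable_fun setT (h x u) by rewrite /h; mf.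
have -> : \int[mu]_u \int[mu]_v ((\int[mu]_x g x (v - u * x)%R) *
      (Q u `^ (1 - e) * G u v `^ (1 - (i - e)))) =
    \int[mu]_x \int[mu]_u \int[mu]_w (g x w * h x u w).
  rewrite [RHS]tonelli; [|nn|rewrite /h; mf]; apply: eq_integral => u _.
  transitivity (\int[mu]_v \int[mu]_x (g x (v - u * x)%R *
      (Q u `^ (1 - e) * G u v `^ (1 - (i - e))))).
    by apply: eq_integral => v _; rewrite intZr; [|nn|mf|nn].
  rewrite tonelli; [|nn|mf]; apply: eq_integral => x _.
  rewrite -[LHS](@int_shift R (u * x)); [|nn|].
    by apply: eq_integral => w _; rewrite addrK.
  by mf.
apply: ae_ge0_le_integral => //; [by move=> x _; nn|by rewrite /h; mf|by move=> x _; nn|by mf|].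
have : mu.-integrable setT P.
  apply/integrableP; split => //; apply: le_lt_trans (ltry 1).
  by apply: le_trans iP; apply: le_int => x; [nn|rewrite gee0_abs].
move=> /(integrable_ae measurableT); apply: filterS => x /(_ Logic.I) Pfin _.
have nfin : n x < +oo.
  rewrite ltey; apply/eqP => nxy; move: Pfin; rewrite /P nxy poweRyr//.
  by rewrite gt_eqF// divr_gt0.
apply: le_int => u; first nn.
(* If n x = 0 then g x vanishes only almost everywhere, so the factorisation cannot be used at every
   w; Hölder shows that the integral is 0. *)
have [nx0|nx0] := eqVneq (n x) 0.
  apply: (@le_trans _ _ 0); last nn.
  have mhxu := mh x u.
  have := @hoelder_int _ _ R mu (fun w => g x w `^ i^-1)
    (fun w => h x u w `^ (1 - i)^-1) i i0.
  rewrite -/(n x) nx0 poweR0r ?gt_eqF// mul0e => H.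
  apply: le_trans (H _ _ _ _ _); [|lra|mf|mf|nn|nn].
  apply: le_int => w; first nn.
  rewrite !poweRVK//; first by apply: lt0r_neq0; lra.
  exact: lt0r_neq0.
apply: le_int => w; first nn.
apply: lee_wpmul2r; first exact: h0.
rewrite /P /F nfin.
have /fineK E : n x \is a fin_num by rewrite ge0_fin_numE.
have np : (0 < fine (n x))%R.
  by rewrite fine_gt0// nfin andbT lt_neqAle eq_sym nx0/=.
rewrite poweRM; [|nn|nn]; rewrite poweRVK//; last exact: lt0r_neq0.
rewrite -!poweRrM -E !poweR_EFin muleCA -EFinM -powRD_gt0//.
rewrite (_ : _ + _ = 0)%R ?powRr0 ?mule1//.
by field; apply: lt0r_neq0.
Qed.

End xray_mixed.

(** * Integrals over hyperplanes in the affine chart *)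

Section chart_radon.
Context (R : realType).
Local Notation RR := (measurableTypeR R).
Local Notation mu := (@lebesgue_measure R).
Local Notation L := (lebesgue_tuple R).

(** By induction on m. For a fixed tail x, the planar estimate in (s, w) lowers i by e; the
    induction hypothesis treats the tail at i - e. In between, L^(1/e) in t and L^(1/(1-e)) in x
    have to be exchanged, and Minkowski does so in the required direction because e < 1/2. *)
Lemma chart_radon (m : nat) (e i : R) : (0 < e)%R -> (3 * e < 1)%R ->
  (m.+1%:R * e <= i)%R -> (i <= 1 - e)%R ->
  exists2 C : R, (0 < C)%R & forall f : m.-tuple R -> RR -> \bar R,
  nneg2 f -> meas2 f ->
  \int[L m]_u (\int[mu]_v (\int[L m]_x f x (v - dotp u x)%R)
     `^ (i - m%:R * e)^-1) `^ ((i - m%:R * e) / e) <=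
  C%:E * (\int[L m]_x (\int[mu]_w f x w `^ i^-1) `^ (i / (1 - e))) `^ ((1 - e) / e).
Proof.
move=> e0 e3; have e10 : (0 < 1 - e)%R by lra.
elim: m i => [|m IH] i mi i1.
  exists 1%R => // f f0 mf_; rewrite mul1e mul0r subr0.
  have i0 : (0 < i)%R by rewrite mul1r in mi; lra.
  rewrite int_tuple0; last by mf.
  rewrite [X in _ <= X `^ _]int_tuple0; last by mf.
  rewrite le_eqVlt; apply/orP; left; apply/eqP; rewrite -poweRrM.
  rewrite (_ : i / (1 - e) * ((1 - e) / e) = i / e)%R; last first.
    by field; rewrite !gt_eqF.
  congr (_ `^ _); apply: eq_integral => v _; congr (_ `^ _).
  under eq_integral do rewrite /dotp big_ord0 subr0.
  by rewrite int_tuple0; last by mf.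
have mi' : (m.+1%:R * e <= i - e)%R.
  by move: mi; rewrite -[m.+2%:R]natr1 mulrDl mul1r; lra.
have me0 : (0 <= m%:R * e)%R by rewrite mulr_ge0// ltW.
have ei : (2 * e <= i)%R.
  by move: mi; rewrite -[m.+2%:R]natr1 -natr1 !mulrDl mul1r; lra.
have i1' : (i - e <= 1 - e)%R by lra.
have [C1 C10 hC1] := IH _ mi' i1'.
have [C2 C20 hC2] := xray_mixed e0 e3 ei i1.
exists (C1 * C2)%R => [|f f0 mf_]; first exact: mulr_gt0.
have iE : (i - e - m%:R * e = i - m.+1%:R * e)%R by rewrite -natr1 mulrDl; lra.
rewrite iE in hC1.
pose G (t : RR) (x : m.-tuple R) (w : RR) : \bar R :=
  \int[mu]_s f (cons_tuple s x) (w - t * s)%R.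
have G0 t x w : 0 <= G t x w by rewrite /G; nn.
have mG : measurable_fun [set: RR * m.-tuple R * RR] (fun z => G z.1.1 z.1.2 z.2).
  rewrite /G; mf.
have mGt t : meas2 (G t) by rewrite /G; mf.
pose P (t : RR) (x : m.-tuple R) := (\int[mu]_w G t x w `^ (i - e)^-1) `^ ((i - e) / (1 - e)).
have P0 : nneg2 P by move=> t x; rewrite /P; nn.
have mP : meas2 P by rewrite /P /G; mf.
rewrite int_tupleS; [|nn|mf].
rewrite tonelli; [|nn|mf].
apply: (@le_trans _ _ (\int[mu]_t (C1%:E * (\int[L m]_x P t x) `^ ((1 - e) / e)))).
  apply: le_int => t; first nn.
  apply: le_trans (hC1 (G t) (G0 t) (mGt t)).
  apply: le_int => u; first nn.
  rewrite le_eqVlt; apply/orP; left; apply/eqP.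
  congr (_ `^ _); apply: eq_integral => v _; congr (_ `^ _).
  rewrite int_tupleS; [|nn|mf]; apply: eq_integral => x _.
  rewrite /G; apply: eq_integral => s _.
  by rewrite dotp_cons opprD addrA addrAC.
rewrite intZl; [|nn|mf|nn].
rewrite EFinM -muleA; apply: lee_wpmul2l; first nn.
have E0 : (0 < e / (1 - e))%R by rewrite divr_gt0.
have E1 : (e / (1 - e) < 1)%R by rewrite ltr_pdivrMr// mul1r; lra.
have := @minkowski_int _ _ _ _ R mu (L m) (e / (1 - e)) P E0 E1 P0 mP.
have -> : (e / (1 - e))^-1%R = ((1 - e) / e)%R by rewrite invf_div.
move=> /le_trans; apply.
apply: (@le_trans _ _ ((\int[L m]_x ((C2 `^ (e / (1 - e)))%:E *
   \int[mu]_s (\int[mu]_w f (cons_tuple s x) w `^ i^-1) `^ (i / (1 - e)))) `^ ((1 - e) / e))).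
  apply: le_poweR; [by rewrite divr_ge0// ltW|nn|].
  apply: le_int => x; first nn.
  have := hC2 (fun s w => f (cons_tuple s x) w).
  have -> : \int[mu]_t P t x `^ ((1 - e) / e) =
    \int[mu]_t (\int[mu]_w G t x w `^ (i - e)^-1) `^ ((i - e) / e).
    apply: eq_integral => t _; rewrite /P -poweRrM; congr (_ `^ _).
    by field; rewrite !gt_eqF.
  move=> H; apply: le_trans.
    apply: le_poweR (H _ _); [exact: ltW|nn|nn|mf].
  rewrite poweRM; [|nn|nn]; rewrite -poweRrM.
  rewrite (_ : (1 - e) / e * (e / (1 - e)) = 1)%R; last by field; rewrite !gt_eqF.
  by rewrite poweRe1//; nn.
rewrite intZl; [|nn|mf|nn].
rewrite poweRM; [|nn|nn].
rewrite poweR_EFin -powRrM (_ : e / (1 - e) * ((1 - e) / e) = 1)%R; last first.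
  by field; rewrite !gt_eqF.
rewrite powRr1; last exact: ltW.
rewrite -(int_tupleS (F := fun x => (\int[mu]_w f x w `^ i^-1) `^ (i / (1 - e)))); [exact: lexx|nn|mf].
Qed.

End chart_radon.

(** * Fractional integration in the chart *)

Section chart_fractional.
Context (R : realType).
Local Notation RR := (measurableTypeR R).
Local Notation mu := (@lebesgue_measure R).
Local Notation L := (lebesgue_tuple R).

(** The direction (1, u) has first coordinate 1, so the kernel depends on (v - u.x) - y, with y the
    first coordinate and x the others. The fractional integration can thus be carried out in y
    first, from reciprocal exponent 1 - e to i = 1 - e - a, before [chart_radon] is applied. *)
Lemma chart_fractional (m : nat) (a e : R) : (0 < a)%R -> (a < 1)%R ->
  (0 < e)%R -> (3 * e < 1)%R -> (m.+2%:R * e <= 1 - a)%R ->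
  let j := (1 - a - m.+1%:R * e)%R in
  exists2 C : R, (0 < C)%R & forall f : m.+1.-tuple R -> \bar R,
  nneg1 f -> measurable_fun setT f ->
  \int[L m]_u (\int[mu]_v (\int[L m.+1]_x
    ((`|v - dotp x (cons_tuple 1%R u)| `^ (a - 1))%:E * f x)) `^ j^-1) `^ (j / e) <=
  C%:E * (\int[L m.+1]_x f x `^ (1 - e)^-1) `^ ((1 - e) / e).
Proof.
move=> a0 a1 e0 e3 ma j; have e10 : (0 < 1 - e)%R by lra.
pose i := (1 - e - a)%R.
have mi : (m.+1%:R * e <= i)%R.
  by move: ma; rewrite -[m.+2%:R]natr1 mulrDl mul1r /i; lra.
have i1 : (i <= 1 - e)%R by rewrite /i; lra.
have me0 : (0 <= m%:R * e)%R by rewrite mulr_ge0// ltW.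
have i0 : (0 < i)%R by move: mi; rewrite -natr1 mulrDl mul1r; lra.
have jE : (j = i - m%:R * e)%R by rewrite /j /i -natr1 mulrDl mul1r; ring.
have [C1 C10 hC1] := chart_radon e0 e3 mi i1.
have ia1 : (i + a < 1)%R by rewrite /i; lra.
have [C2 C20 hC2] := @fractional_integral_le R a i a0 a1 i0 ia1.
have iaE : (i + a = 1 - e)%R by rewrite /i; lra.
rewrite iaE in hC2.
exists (C1 * (C2 `^ (i / (1 - e))) `^ ((1 - e) / e))%R => [|f f0 mf_].
  by rewrite mulr_gt0// !powR_gt0.
pose g (x : m.-tuple R) (s : RR) := \int[mu]_y
  ((`|s - y| `^ (a - 1))%:E * f (cons_tuple y x)).
have g0 : nneg2 g by move=> x s; rewrite /g; nn.
have mg : meas2 g by rewrite /g; mf.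
have := hC1 g g0 mg; rewrite -jE => H.
have -> : \int[L m]_u (\int[mu]_v (\int[L m.+1]_x
    ((`|v - dotp x (cons_tuple 1%R u)| `^ (a - 1))%:E * f x)) `^ j^-1) `^ (j / e) =
  \int[L m]_u (\int[mu]_v (\int[L m]_x g x (v - dotp u x)%R) `^ j^-1) `^ (j / e).
  apply: eq_integral => u _; congr (_ `^ _); apply: eq_integral => v _.
  congr (_ `^ _); rewrite int_tupleS; [|nn|mf].
  apply: eq_integral => x _; rewrite /g; apply: eq_integral => y _.
  rewrite dotp_cons mulr1 opprD addrA addrAC /dotp.
  by under eq_bigr do rewrite mulrC.
apply: (le_trans H); rewrite EFinM -muleA; apply: lee_wpmul2l; first nn.
rewrite -poweR_EFin -poweRM; [|nn|nn].
apply: le_poweR; [by rewrite divr_ge0// ltW|nn|].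
rewrite int_tupleS; [|nn|mf].
rewrite -intZl; [|nn|mf|nn]; apply: le_int => x; first nn.
have h : \int[mu]_w g x w `^ i^-1 <=
    C2%:E * (\int[mu]_y f (cons_tuple y x) `^ (1 - e)^-1) `^ ((1 - e) / i).
  by apply: hC2; [nn|mf].
apply: le_trans.
  by apply: le_poweR h; [rewrite divr_ge0// ltW|nn].
rewrite poweRM; [|nn|nn]; rewrite -poweRrM poweR_EFin.
rewrite (_ : (1 - e) / i * (i / (1 - e)) = 1)%R; last by field; rewrite !gt_eqF.
by rewrite poweRe1//; nn.
Qed.

End chart_fractional.

(** * Dilations, and surface integrals as integrals over the ball *)

Section sphere.
Context (R : realType).
Local Notation RR := (measurableTypeR R).
Local Notation mu := (@lebesgue_measure R).
Local Notation L := (lebesgue_tuple R).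

Lemma scale_cons_tuple n (c t : R) (x : n.-tuple R) :
  scale_tuple c (cons_tuple t x) = cons_tuple (c * t)%R (scale_tuple c x).
Proof.
apply: eq_from_tnth => i; rewrite tnth_mktuple.
by case: (unliftP ord0 i) => [j ->|->]; rewrite ?tnthS ?tnth0 ?tnth_mktuple.
Qed.

Lemma dotp_scaler n (c : R) (x y : n.-tuple R) :
  dotp x (scale_tuple c y) = (c * dotp x y)%R.
Proof.
rewrite /dotp mulr_sumr; apply: eq_bigr => i _.
by rewrite tnth_mktuple mulrCA.
Qed.

Lemma dotpC n (x y : n.-tuple R) : dotp x y = dotp y x.
Proof. by rewrite /dotp; apply: eq_bigr => i _; rewrite mulrC. Qed.

Lemma dotp_ge0 n (x : n.-tuple R) : (0 <= dotp x x)%R.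
Proof. by apply: sumr_ge0 => i _; rewrite -expr2 sqr_ge0. Qed.

Lemma enorm_scale n (c : R) (x : n.-tuple R) :
  enorm (scale_tuple c x) = (`|c| * enorm x)%R.
Proof.
by rewrite /enorm dotp_scaler dotpC dotp_scaler mulrA -expr2 sqrtrM ?sqr_ge0// sqrtr_sqr.
Qed.

Lemma normalizeE n (x : n.-tuple R) : normalize x = scale_tuple (enorm x)^-1 x.
Proof.
by apply: eq_from_tnth => i; rewrite !tnth_mktuple mulrC.
Qed.

Lemma scale_tupleA n (b c : R) (x : n.-tuple R) :
  scale_tuple b (scale_tuple c x) = scale_tuple (b * c) x.
Proof. by apply: eq_from_tnth => i; rewrite !tnth_mktuple mulrA. Qed.

Lemma int_tuple_scale n (c : R) (f : n.-tuple R -> \bar R) : c != 0%R ->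
  nneg1 f -> measurable_fun setT f ->
  \int[L n]_x f (scale_tuple c x) = (`|c|^-1 ^+ n)%:E * \int[L n]_x f x.
Proof.
move=> c0; elim: n f => [|n IH] f f0 mf_.
  have mfs : measurable_fun setT (fun x : 0.-tuple R => f (scale_tuple c x)).
    apply: (measurableT_comp mf_); apply: measurable_scale_tuple.
      exact: measurable_cst.
    exact: measurable_id.
  rewrite !int_tuple0// expr0 mul1e; congr f; exact: tuple0.
have mfs : measurable_fun setT (fun x : n.+1.-tuple R => f (scale_tuple c x)).
  apply: (measurableT_comp mf_); apply: measurable_scale_tuple.
    exact: measurable_cst.
  exact: measurable_id.
rewrite int_tupleS//; rewrite [in RHS]int_tupleS//.
have -> : \int[L n]_x \int[mu]_t f (scale_tuple c (cons_tuple t x)) =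
   \int[L n]_x ((`|c|^-1)%:E * \int[mu]_t f (cons_tuple t (scale_tuple c x))).
  apply: eq_integral => x _.
  rewrite -(@int_affine R c 0%R (fun t => f (cons_tuple t (scale_tuple c x))))//;
    last by mf.
  by apply: eq_integral => t _; rewrite addr0 scale_cons_tuple.
rewrite (IH (fun x => (`|c|^-1)%:E * \int[mu]_t f (cons_tuple t x))); [|nn|mf].
by rewrite intZl; [rewrite muleA -EFinM -exprSr|nn|mf|nn].
Qed.

Lemma int_mrestr d (T : measurableType d) (m : {measure set T -> \bar R})
    (D : set T) (mD : measurable D) (f : T -> \bar R) :
  nneg1 f -> measurable_fun setT f ->
  \int[mrestr m mD]_x f x = \int[m]_(x in D) f x.
Proof.
move=> f0 mf_; rewrite [LHS](@ge0_negligible_integral _ _ _ _ _ (~` D))//.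
- rewrite setTD setCK; apply: eq_measure_integral => A mA AD.
  have E : mrestr m mD A = m A by rewrite /mrestr setIidl.
  by first [exact: E | exact: esym E].
- exact: measurableC.
- by transitivity (m (~` D `&` D)); rewrite // setICl measure0.
Qed.

Lemma int_surface n (f : n.-tuple R -> \bar R) : nneg1 f -> measurable_fun setT f ->
  \int[surface_measure R n]_x f x = n%:R%:E * \int[L n]_x
    (if (0 < enorm x)%R && (enorm x <= 1)%R then f (normalize x) else 0).
Proof.
move=> f0 mf_.
pose restr : {measure set (n.-tuple R) -> \bar R} :=
  mrestr (L n) (@measurable_punctured_ball R n).
pose cone : {measure set (n.-tuple R) -> \bar R} :=
  measure_function_pushforward__canonical__measure_function_Measure
    restr (@measurable_normalize R n).
transitivity (\int[mscale (n%:R%:nng)%R cone]_x f x).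
  by apply: eq_measure_integral.
rewrite ge0_integral_mscale//; congr (_ * _).
have E := ge0_integral_pushforward (@measurable_normalize R n) restr measurableT mf_
  (fun y _ => f0 y).
rewrite E preimage_setT int_mrestr; last first.
- exact: (measurableT_comp mf_ (@measurable_normalize R n)).
- by move=> x; exact: f0.
rewrite integral_mkcond; apply: eq_integral => x _.
rewrite patchE; case: ifPn => [|] h.
  by move: h => /set_mem; rewrite /punctured_ball/= => ->.
case: ifPn => // h'; move: h; rewrite notin_setE/=; by case.
Qed.

End sphere.

(** * Surface measure *)

Section sphere_chart.
Context (R : realType).
Local Notation RR := (measurableTypeR R).
Local Notation mu := (@lebesgue_measure R).
Local Notation L := (lebesgue_tuple R).

Definition kappa m (u : m.-tuple R) : R := enorm (cons_tuple 1%R u).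

Lemma kappa_gt0 m (u : m.-tuple R) : (0 < kappa u)%R.
Proof.
rewrite /kappa /enorm dotp_cons mulr1 sqrtr_gt0.
by rewrite ltr_pwDl// dotp_ge0.
Qed.

Lemma measurable_kappa m : measurable_fun setT (@kappa m).
Proof. by rewrite /kappa; mf. Qed.

Lemma measurable_cube m (r : R) : measurable [set x : m.-tuple R | forall i, (`|tnth x i| <= r)%R].
Proof.
rewrite (_ : [set x | _] = \bigcap_(i in [set: 'I_m]) ((fun x : m.-tuple R => tnth x i) @^-1` `[(- r)%R, r])).
  apply: fin_bigcap_measurable => // i _; rewrite -[X in measurable X]setTI.
  exact: (measurable_tnth i).
apply/seteqP; split => x /=.
  by move=> h i _ /=; rewrite in_itv/= -ler_norml.
by move=> h i; have := h i Logic.I; rewrite /= in_itv/= -ler_norml.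
Qed.

Lemma lebesgue_tuple_cons m (A : set (m.-tuple R)) (B : set RR) :
  measurable A -> measurable B ->
  L m.+1 [set x | exists z t, [/\ A z, B t & x = cons_tuple t z]] = L m A * mu B.
Proof.
move=> mA mB; rewrite -product_measure1E//; congr (product_measure1 _ _ _).
apply/seteqP; split => -[z t] /=.
  move=> [z' [t' [Az Bt /(congr1 val)/= [-> /val_inj zz]]]].
  by rewrite zz.
by move=> [Az Bt]; exists z, t.
Qed.

Lemma lebesgue_cube m (r : R) : (0 <= r)%R ->
  L m [set x | forall i, (`|tnth x i| <= r)%R] = ((2 * r) ^+ m)%:E.
Proof.
move=> r0; elim: m => [|m IH].
  rewrite expr0 /= diracE mem_set//= => -[].
  by [].
rewrite exprSr EFinM -IH -(_ : mu `[(- r)%R, r] = (2 * r)%:E); last first.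
  rewrite lebesgue_measure_itv/= lte_fin -EFinD opprK mulr_natl mulr2n.
  case: ifPn => //; rewrite -leNgt => h; have -> : r = 0%R by lra.
  by rewrite addr0.
rewrite -lebesgue_tuple_cons//; last exact: measurable_cube.
congr (L m.+1 _); apply/seteqP; split => x /=.
  move=> h; exists [tuple of behead x], (thead x); split.
  - by move=> i; have := h (lift ord0 i); rewrite [x in tnth x (lift _ _)]tuple_eta tnthS.
  - by rewrite /= in_itv/= -ler_norml; exact: h.
  - by rewrite [LHS]tuple_eta.
move=> [z [t [Az]]]; rewrite /= in_itv/= -ler_norml => tr -> i.
by case: (unliftP ord0 i) => [k ->|->]; rewrite ?tnthS ?tnth0.
Qed.

Lemma normr_tnth_le n (x : n.-tuple R) i : (`|tnth x i| <= enorm x)%R.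
Proof.
rewrite -sqrtr_sqr /enorm ler_wsqrtr// /dotp (bigD1 i)//= -expr2 lerDl.
by apply: sumr_ge0 => k _; rewrite -expr2 sqr_ge0.
Qed.

Lemma surface_measure_lty n : surface_measure R n setT < +oo.
Proof.
rewrite /surface_measure; apply: lte_mul_pinfty => //.
apply: (@le_lt_trans _ _ (L n [set x | forall i, (`|tnth x i| <= 1)%R])).
  apply: le_measure; rewrite ?inE.
  - by rewrite preimage_setT setTI; exact: measurable_punctured_ball.
  - exact: measurable_cube.
  - move=> x [_ /andP[_ x1]] i; exact: le_trans (normr_tnth_le x i) x1.
by rewrite lebesgue_cube ?ltry.
Qed.

(** Serves to raise an exponent on the sphere: for normalised data the additive 1 costs no more than
    the total area. *)
Lemma le1D_poweR (x : \bar R) (r : R) : (1 <= r)%R -> 0 <= x -> x <= 1 + x `^ r.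
Proof.
move=> r1 x0; have [x1|x1] := leP x 1.
  by rewrite (le_trans x1)// leeDl// poweR_ge0.
apply: (@le_trans _ _ (x `^ r)); last by rewrite leeDr.
case: x x0 x1 => [x| |//] x0 x1; last by rewrite poweRyr// gt_eqF// (lt_le_trans ltr01).
rewrite poweR_EFin lee_fin le1r_powR//.
by move: x1; rewrite lte_fin => /ltW.
Qed.

Lemma int_interval (c b : R) : (0 < b)%R ->
  \int[mu]_z (if (`|z| * b <= 1)%R then c%:E else 0) = (c * (2 / b))%:E.
Proof.
move=> b0; rewrite (_ : \int[mu]_z _ = \int[mu]_(z in `[(- b^-1)%R, (b^-1)%R]) cst c%:E z).
  rewrite integral_cst//= lebesgue_measure_itv/= lte_fin.
  have b10 : (0 < b^-1)%R by rewrite invr_gt0.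
  case: ifPn => [_|]; last by rewrite -leNgt => h; exfalso; lra.
  by rewrite -EFinD -EFinM opprK; congr EFin; congr GRing.mul; lra.
rewrite [RHS]integral_mkcond; apply: eq_integral => z _.
by rewrite patchE mem_setE in_itv/= -ler_norml -ler_pdivlMr// mul1r.
Qed.

Lemma enorm_scale_chart m (z : R) (u : m.-tuple R) :
  enorm (cons_tuple z (scale_tuple z u)) = (`|z| * kappa u)%R.
Proof.
have -> : cons_tuple z (scale_tuple z u) = scale_tuple z (cons_tuple 1%R u).
  by rewrite scale_cons_tuple mulr1.
exact: enorm_scale.
Qed.

(* The chart u |-> (1, u)/|(1, u)|, whose Jacobian is kappa u ^- n. *)
Lemma sphere_chart m (f : m.+1.-tuple R -> \bar R) (g : m.-tuple R -> \bar R) :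
  nneg1 f -> nneg1 g -> measurable_fun setT f -> measurable_fun setT g ->
  (forall z u, z != 0%R -> f (normalize (cons_tuple z (scale_tuple z u))) <=
    (kappa u ^+ m.+1)%:E * g u) ->
  \int[surface_measure R m.+1]_x f x <= (m.+1%:R * 2)%:E * \int[L m]_u g u.
Proof.
move=> f0 g0 mf_ mg fg; rewrite int_surface//.
rewrite EFinM -muleA; apply: lee_wpmul2l; first by rewrite lee_fin.
pose h (x : m.+1.-tuple R) := if ((0 < enorm x) && (enorm x <= 1))%R then f (normalize x) else 0.
have h0 : nneg1 h by move=> x; rewrite /h; nn.
have mh : measurable_fun setT h by rewrite /h; mf.
rewrite int_tupleS//; rewrite tonelli; [|nn|mf].
have mk := @measurable_kappa m.
pose k (z : RR) (u : m.-tuple R) : \bar R :=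
  if (`|z| * kappa u <= 1)%R then (kappa u)%:E * g u else 0.
have k0 : nneg2 k.
  by move=> z u; rewrite /k; case: ifP => // _; rewrite mule_ge0// lee_fin ltW// kappa_gt0.
have mk_ : meas2 k by rewrite /k; mf.
apply: (@le_trans _ _ (\int[mu]_z \int[L m]_u k z u)).
  apply: (@le_int_neq _ 0%R); [nn|nn|mf|mf|].
  move=> z z0; have zp : (0 < `|z|)%R by rewrite normr_gt0.
  (* For fixed z the remaining coordinates are written as z u, at the cost of |z|^m. *)
  have -> : \int[L m]_x h (cons_tuple z x) =
     (`|z| ^+ m)%:E * \int[L m]_u h (cons_tuple z (scale_tuple z u)).
    rewrite (@int_tuple_scale R m z (fun x => h (cons_tuple z x)) z0); [|nn|mf].
    by rewrite muleA -EFinM -exprMn divff ?expr1n ?mul1e// gt_eqF.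
  rewrite -intZl; [|nn|mf|by rewrite lee_fin exprn_ge0].
  apply: le_int => u.
    by rewrite mule_ge0// lee_fin exprn_ge0.
  have kp := kappa_gt0 u.
  rewrite /h /k enorm_scale_chart mulr_gt0//=; case: ifPn => [zk|_]; last by rewrite mule0.
  apply: (@le_trans _ _ ((`|z| ^+ m)%:E * ((kappa u ^+ m.+1)%:E * g u))).
    by apply: lee_wpmul2l; [rewrite lee_fin exprn_ge0|exact: fg].
  rewrite muleA -EFinM; apply: lee_wpmul2r => //; rewrite lee_fin.
  (* In the unit ball |z| kappa <= 1, so |z|^m kappa^(m+1) <= kappa; the interval of admissible z
     has length 2 / kappa, which removes the last power. *)
  rewrite exprSr mulrA -exprMn -[leRHS]mul1r; apply: ler_wpM2r; first exact: ltW.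
  by rewrite exprn_ile1// mulr_ge0// ltW.
rewrite tonelli; [|nn|mf].
rewrite -intZl; [|nn|mf|by rewrite lee_fin].
apply: le_int => u; first nn.
have kp := kappa_gt0 u.
have -> : \int[mu]_z k z u = g u * \int[mu]_z (if (`|z| * kappa u <= 1)%R then (kappa u)%:E else 0).
  rewrite -intZl; [|by move=> z; case: ifP => // _; rewrite lee_fin ltW|mf|nn].
  apply: eq_integral => z _; rewrite /k; case: ifP => _; by rewrite ?mule0// muleC.
by rewrite int_interval// mulrCA divff ?gt_eqF// mulr1 muleC.
Qed.

End sphere_chart.

(** * Strong and weak bounds for the absolute kernel *)

Lemma surface_measure_sigma_finite (R : realType) n :
  sigma_finite setT (surface_measure R n).
Proof.
exists (fun=> setT); first by rewrite bigcup_const.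
by move=> _; split => //; exact: surface_measure_lty.
Qed.

HB.instance Definition _ (R : realType) n := Measure_isSigmaFinite.Build _ _ _
  (surface_measure R n) (@surface_measure_sigma_finite R n).

Opaque scale_tuple.

Section radon.
Context (R : realType).
Local Notation RR := (measurableTypeR R).
Local Notation mu := (@lebesgue_measure R).
Local Notation L := (lebesgue_tuple R).
Local Notation S := (surface_measure R).

(** Defined for every y in R^n and not only for unit vectors, so that dilations can carry the chart
    points (1, u) to the sphere. *)
Definition abs_radon n (a : R) (f : n.-tuple R -> \bar R) (y : n.-tuple R) (t : RR) :=
  \int[L n]_x ((`|t - dotp x y| `^ (a - 1))%:E * f x).

Lemma abs_radon_ge0 n a (f : n.-tuple R -> \bar R) : nneg1 f -> nneg2 (abs_radon a f).
Proof. by move=> f0 y t; rewrite /abs_radon; nn. Qed.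

Lemma measurable_abs_radon n a (f : n.-tuple R -> \bar R) : nneg1 f ->
  measurable_fun setT f -> meas2 (abs_radon a f).
Proof. by move=> f0 mf_; rewrite /abs_radon; mf. Qed.

Lemma abs_radonZl n a b (f : n.-tuple R -> \bar R) y t : (0 <= b)%R -> nneg1 f ->
  measurable_fun setT f ->
  abs_radon a (fun x => b%:E * f x) y t = b%:E * abs_radon a f y t.
Proof.
move=> b0 f0 mf_; rewrite /abs_radon -intZl; [|nn|mf|nn].
by apply: eq_integral => x _; rewrite muleCA.
Qed.

Lemma abs_radon_scale n a (c : R) (f : n.-tuple R -> \bar R) y t : c != 0%R ->
  nneg1 f -> measurable_fun setT f ->
  abs_radon a f (scale_tuple c y) t =
  (`|c| `^ (a - 1))%:E * abs_radon a f y (c^-1 * t + 0)%R.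
Proof.
move=> c0 f0 mf_; rewrite /abs_radon -intZl; [|nn|mf|nn].
apply: eq_integral => x _; rewrite muleA -EFinM -powRM// -normrM dotp_scaler.
by congr ((`|_| `^ _)%R%:E * _); field.
Qed.

Opaque abs_radon.

Lemma int_poweR_scale (A A' : RR -> \bar R) (k c r : R) : c != 0%R -> (0 <= k)%R ->
  nneg1 A -> measurable_fun setT A ->
  (forall t, A' t = k%:E * A (c^-1 * t + 0)%R) ->
  \int[mu]_t A' t `^ r = (k `^ r * `|c|)%:E * \int[mu]_t A t `^ r.
Proof.
move=> c0 k0 A0 mA AE.
transitivity (\int[mu]_t (k%:E `^ r * A (c^-1 * t + 0)%R `^ r)).
  by apply: eq_integral => t _; rewrite AE poweRM.
rewrite intZl; [|nn|mf|nn].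
rewrite (@int_affine R c^-1 0%R (fun t => A t `^ r)); last 3 first.
- by rewrite invr_eq0.
- nn.
- mf.
by rewrite muleA poweR_EFin -EFinM normfV invrK.
Qed.

(** The kernel contributes (a - 1) r to the exponent, the dilation of t contributes 1. *)
Lemma int_abs_radon_scale n a (r c : R) (f : n.-tuple R -> \bar R) y : c != 0%R ->
  nneg1 f -> measurable_fun setT f ->
  \int[mu]_t abs_radon a f (scale_tuple c y) t `^ r =
  (`|c| `^ ((a - 1) * r + 1))%:E * \int[mu]_t abs_radon a f y t `^ r.
Proof.
move=> c0 f0 mf_; have cp : (0 < `|c|)%R by rewrite normr_gt0.
have mA := measurable_fun_pair2 y (measurable_abs_radon a f0 mf_).
have A0 := abs_radon_ge0 a f0 y.
have E t := abs_radon_scale a y t c0 f0 mf_.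
apply: (eq_trans (int_poweR_scale r c0 (powR_ge0 _ _) A0 mA E)).
by congr (_ * _); congr EFin; rewrite [RHS]powRD_gt0// powRrM powRr1// ltW.
Qed.

Lemma abs_radon_strong (m : nat) (a e : R) : (0 < a)%R -> (a < 1)%R ->
  (0 < e)%R -> (3 * e < 1)%R -> (m.+2%:R * e <= 1 - a)%R ->
  let j := (1 - a - m.+1%:R * e)%R in
  exists2 C : R, (0 < C)%R & forall f : m.+1.-tuple R -> \bar R,
  nneg1 f -> measurable_fun setT f ->
  \int[S m.+1]_y \int[mu]_t abs_radon a f y t `^ j^-1 <=
  C%:E * (\int[L m.+1]_x f x `^ (1 - e)^-1) `^ ((1 - e) / j).
Proof.
move=> a0 a1 e0 e3 ma j; have e10 : (0 < 1 - e)%R by lra.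
have je : (e <= j)%R.
  by move: ma; rewrite -[m.+2%:R]natr1 mulrDl mul1r /j; lra.
have j0 : (0 < j)%R by lra.
have [C C0 hC] := chart_fractional a0 a1 e0 e3 ma.
rewrite -/j in hC.
have [s s0 sE] : exists2 s : R, (0 <= s)%R & S m.+1 setT = s%:E.
  exists (fine (S m.+1 setT)); first by rewrite fine_ge0.
  by rewrite fineK// ge0_fin_numE// surface_measure_lty.
exists (s + m.+1%:R * 2 * C)%R => [|f f0 mf_].
  by rewrite ltr_wpDl// !mulr_gt0// ltr0n.
have nn1 : (0 <= m.+1%:R * 2 :> R)%R by rewrite mulr_ge0.
apply: homogeneous_le.
- by rewrite divr_gt0.
- by rewrite ltr_wpDl// !mulr_gt0// ltr0n.
- by apply: int_ge0 => y; nn.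
- nn.
move=> c c0 hc; pose b := (c `^ (1 - e))%R.
have b0 : (0 < b)%R by rewrite powR_gt0.
pose g x := b%:E * f x.
have g0 : nneg1 g by move=> x; rewrite /g; nn.
have mg : measurable_fun setT g by rewrite /g; mf.
have ig : \int[L m.+1]_x g x `^ (1 - e)^-1 <= 1.
  apply: le_trans hc; rewrite -intZl; [|nn|mf|nn].
  apply: le_int => x; first nn.
  rewrite /g poweRM; [|nn|nn]; rewrite poweR_EFin /b -powRrM mulfV ?gt_eqF//.
  by rewrite powRr1// ltW.
have mA := measurable_abs_radon a f0 mf_.
have A0 := abs_radon_ge0 a f0.
have mB := measurable_abs_radon a g0 mg.
have B0 := abs_radon_ge0 a g0.
have BA y t := abs_radonZl a y t (ltW b0) f0 mf_.
have Bscale c' y c0' := @int_abs_radon_scale m.+1 a j^-1 c' g y c0' g0 mg.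
have BC : \int[L m]_u (\int[mu]_v abs_radon a g (cons_tuple 1%R u) v `^ j^-1) `^ (j / e)
    <= C%:E * (\int[L m.+1]_x g x `^ (1 - e)^-1) `^ ((1 - e) / e) := hC g g0 mg.
rewrite -/g in BA.
move: (abs_radon a f) (abs_radon a g) mA A0 mB B0 BA Bscale BC => A B mA A0 mB B0 BA Bscale BC.
have -> : (c `^ ((1 - e) / j))%:E * \int[S m.+1]_y \int[mu]_t A y t `^ j^-1 =
    \int[S m.+1]_y \int[mu]_t B y t `^ j^-1.
  rewrite -intZl; [|nn|mf|nn]; apply: eq_integral => y _.
  rewrite -intZl; [|nn|mf|nn]; apply: eq_integral => t _.
  rewrite BA poweRM//; last by rewrite lee_fin ltW.
  by rewrite poweR_EFin /b -powRrM.
(* As j >= e, the power j / e reaches the outer exponent of the chart estimate; the summand 1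
   integrates to the area s. *)
apply: (@le_trans _ _ (\int[S m.+1]_y (1 + (\int[mu]_t B y t `^ j^-1) `^ (j / e)))).
  apply: le_int => y; first nn.
  by apply: le1D_poweR; [rewrite ler_pdivlMr// mul1r|nn].
rewrite intD; [|by []|exact: measurable_cst|nn|mf].
rewrite EFinD; apply: leeD.
  by rewrite integral_cst// mul1e -sE; exact: lexx.
pose Phi (u : m.-tuple R) :=
  (\int[mu]_v B (cons_tuple 1%R u) v `^ j^-1) `^ (j / e).
have Phi0 : nneg1 Phi by move=> u; rewrite /Phi; nn.
have mPhi : measurable_fun setT Phi by rewrite /Phi; mf.
apply: (@le_trans _ _ ((m.+1%:R * 2)%:E * \int[L m]_u Phi u)).
  apply: sphere_chart; [nn|nn|mf|mf|].
  move=> z u z0; have kp := kappa_gt0 u.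
  have zk : (0 < `|z| * kappa u)%R by rewrite mulr_gt0// normr_gt0.
  rewrite normalizeE enorm_scale_chart.
  have -> : cons_tuple z (scale_tuple z u) = scale_tuple z (cons_tuple 1%R u).
    by rewrite scale_cons_tuple mulr1.
  rewrite scale_tupleA Bscale; last first.
    by rewrite mulf_neq0// invr_eq0 gt_eqF.
  rewrite poweRM; [|nn|nn]; rewrite -/(Phi u).
  apply: lee_wpmul2r => //; rewrite poweR_EFin lee_fin.
  rewrite normrM normfV (gtr0_norm zk) invfM mulrAC mulVf ?mul1r; last by rewrite normr_eq0.
  rewrite powRV ?(ltW kp)// -powRN -powRrM -powR_mulrn ?(ltW kp)//.
  rewrite (_ : - ((a - 1) * j^-1 + 1) * (j / e) = m.+1%:R)%R//.
  have -> : (a = 1 - j - m.+1%:R * e)%R by rewrite /j; ring.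
  by field; rewrite !gt_eqF.
rewrite [X in _ <= X%:E]mulrC [leRHS]EFinM muleC; apply: lee_wpmul2r => //.
apply: (le_trans BC).
rewrite -[leRHS]mule1; apply: lee_wpmul2l; first nn.
rewrite -[leRHS](poweR1r ((1 - e) / e)); apply: le_poweR => //; last nn.
by rewrite divr_ge0// ltW.
Qed.

End radon.

Lemma int_cst d (T : measurableType d) (R : realType) (m : {measure set T -> \bar R}) (c : \bar R) :
  \int[m]_x c = c * m setT.
Proof. by rewrite (@integral_cst _ T R m setT). Qed.

(** * The weak type bound *)

Section weak.
Context (R : realType).
Local Notation RR := (measurableTypeR R).
Local Notation mu := (@lebesgue_measure R).
Local Notation L := (lebesgue_tuple R).
Local Notation S := (surface_measure R).
Local Notation Z := (Zn_measure R).

Lemma int_Zn n (F : n.-tuple R -> RR -> \bar R) : nneg2 F -> meas2 F ->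
  \int[Z n]_z F z.1 z.2 = \int[S n]_y \int[mu]_t F y t.
Proof. by move=> F0 mF; exact: (fubini_tonelli1 (fun z => F z.1 z.2)). Qed.

(** By Tonelli it suffices to integrate the kernel over E, uniformly in x. Within distance m it is
    integrated in t and then over the whole sphere; beyond that it is at most m^(a-1) on a set of
    measure m. Both parts are of order m^a. *)
Lemma abs_radon_set_le n (a : R) : (0 < a)%R -> (a < 1)%R ->
  exists2 K : R, (0 < K)%R & forall (E : set (n.-tuple R * RR)) (m : R)
    (f : n.-tuple R -> \bar R), measurable E -> (0 < m)%R -> Z n E = m%:E ->
    nneg1 f -> measurable_fun setT f ->
    \int[Z n]_z ((\1_E z)%:E * abs_radon a f z.1 z.2) <=
    (K * m `^ a)%:E * \int[L n]_x f x.
Proof.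
move=> a0 a1; have l0 : (0 < 1 - a)%R by lra.
have l1 : (1 - a < 1)%R by lra.
have [K K0 hK] := near_kernel l0 l1.
have [s s0 sE] : exists2 s : R, (0 <= s)%R & S n setT = s%:E.
  exists (fine (S n setT)); first by rewrite fine_ge0.
  by rewrite fineK// ge0_fin_numE// surface_measure_lty.
exists (K * s + 1)%R => [|E m f mE m0 Em f0 mf_].
  by rewrite ltr_wpDl// mulr_ge0// ltW.
pose Zs := sigma_finite_prod (S n) mu.
pose k (x : n.-tuple R) (z : n.-tuple R * RR) : R := (`|z.2 - dotp x z.1| `^ (a - 1))%R.
pose i1 (z : n.-tuple R * RR) : R := \1_E z.
have i10 z : (0 <= i1 z)%R by rewrite /i1.
have mi1 : measurable_fun setT i1 by exact: measurable_indic.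
have kE x : \int[Zs]_z (i1 z * k x z)%:E <= ((K * s + 1) * m `^ a)%:E.
  pose h (y : n.-tuple R) (t : RR) : \bar R :=
    if (m^-1 * `|dotp x y - t| < 1)%R then (`|dotp x y - t| `^ (- (1 - a)))%:E else 0.
  have h0 : nneg2 h by move=> y t; rewrite /h; nn.
  have mh : meas2 h by rewrite /h; mf.
  apply: (@le_trans _ _ (\int[Zs]_z (h z.1 z.2 + (m `^ (a - 1))%:E * (i1 z)%:E))).
    apply: le_int => z; first by rewrite lee_fin mulr_ge0// powR_ge0.
    rewrite /h /k -normrN opprB; case: ifPn => [_|].
      rewrite opprB -(@EFinM _ (m `^ (a - 1))%R) -EFinD lee_fin.
      apply: (@le_trans _ _ (`|dotp x z.1 - z.2| `^ (a - 1))%R).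
        rewrite /i1 indicE; case: (_ \in _); rewrite ?mul1r// mul0r powR_ge0//.
      by rewrite lerDl mulr_ge0// powR_ge0.
    rewrite -leNgt add0e -EFinM lee_fin => h1; rewrite mulrC.
    apply: ler_wpM2r => //.
    have -> : (a - 1 = - (1 - a))%R by rewrite opprB.
    apply: powRN_anti => //; first exact: ltW.
    by move: h1; rewrite mulrC ler_pdivlMr// mul1r.
  rewrite intD; [|nn|mf|nn|mf].
  rewrite mulrDl mul1r EFinD; apply: leeD.
    rewrite (int_Zn h0 mh).
    apply: (@le_trans _ _ (\int[S n]_y (K * m `^ a)%:E)).
      apply: le_int => y; first nn.
      have m10 : (0 < m^-1)%R by rewrite invr_gt0.
      apply: le_trans (hK (m^-1)%R (dotp x y) m10) _.
      rewrite powRV ?(ltW m0)// -powRN lee_fin.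
      by rewrite (_ : - (1 - a - 1) = a)%R//; lra.
    have -> : \int[S n]_y (K * m `^ a)%:E = (K * m `^ a)%:E * s%:E.
      by rewrite int_cst; congr (_ * _); exact: sE.
    by rewrite -EFinM lee_fin mulrAC.
  rewrite intZl; [|nn|mf|nn].
  rewrite (_ : \int[Zs]_x0 (i1 x0)%:E = m%:E); last first.
    by rewrite /i1 integral_indic// setIT -Em.
  by rewrite -EFinM lee_fin -[X in (_ * X <= _)%R]powRr1 ?(ltW m0)// -powRD_gt0// subrK.
have -> : \int[Z n]_z ((\1_E z)%:E * abs_radon a f z.1 z.2) =
    \int[L n]_x (f x * \int[Zs]_z (i1 z * k x z)%:E).
  transitivity (\int[Zs]_z \int[L n]_x (f x * (i1 z * k x z)%:E)).
    apply: eq_integral => z _; rewrite /abs_radon -intZl; [|nn|mf|by rewrite lee_fin].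
    by apply: eq_integral => x _; rewrite muleA -EFinM muleC.
  rewrite tonelli; last 2 first.
  - move=> z x; apply: mule_ge0 => //; by rewrite lee_fin mulr_ge0// powR_ge0.
  - by rewrite /k; mf.
  apply: eq_integral => x _; rewrite intZl//.
  - by move=> z; rewrite lee_fin mulr_ge0// powR_ge0.
  - by rewrite /k; mf.
rewrite -intZl; [|nn|mf|]; last first.
  by rewrite lee_fin mulr_ge0// ?powR_ge0// addr_ge0// mulr_ge0// ltW.
apply: le_int => x.
  apply: mule_ge0 => //; apply: int_ge0 => z.
  by rewrite lee_fin mulr_ge0// powR_ge0.
by rewrite muleC; apply: lee_wpmul2r.
Qed.

Lemma abs_radon_weak n (a : R) : (0 < a)%R -> (a < 1)%R ->
  exists2 C : R, (0 < C)%R & forall (f : n.-tuple R -> \bar R) (l : R), (0 < l)%R ->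
    nneg1 f -> measurable_fun setT f ->
    Z n [set z | l%:E < abs_radon a f z.1 z.2] <=
    C%:E * (\int[L n]_x f x * (l^-1)%:E) `^ (1 - a)^-1.
Proof.
move=> a0 a1; have l0 : (0 < 1 - a)%R by lra.
have [K K0 hK] := abs_radon_set_le n a0 a1.
exists (K `^ (1 - a)^-1)%R => [|f l lp f0 mf_]; first by rewrite powR_gt0.
have N0 : 0 <= \int[L n]_x f x by nn.
case EN : (\int[L n]_x f x) N0 => [N| |//] N0; last first.
  rewrite gt0_mulye ?lte_fin ?invr_gt0// poweRyr ?invr_neq0 ?gt_eqF//.
  by rewrite gt0_muley ?leey// lte_fin powR_gt0.
have mA := measurable_abs_radon a f0 mf_.
have A0 := abs_radon_ge0 a f0.
(* The cut |t| <= k makes the measure m of the level set finite, so that m^a can be divided out of l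
   m <= K m^a N; the union over k is taken afterwards. *)
pose E k := [set z : n.-tuple R * RR | (`|z.2| <= k%:R)%R && (l%:E < abs_radon a f z.1 z.2)].
have mE k : measurable (E k).
  have : measurable_fun setT (fun z : n.-tuple R * RR =>
      (`|z.2| <= k%:R)%R && (l%:E < abs_radon a f z.1 z.2)) by mf.
  by move=> /(_ measurableT [set true] I); rewrite setTI.
have ndE : nondecreasing_seq E.
  move=> i k ik; apply/subsetPset => z; rewrite /E/= => /andP[zi ->]; rewrite andbT.
  by rewrite (le_trans zi)// ler_nat.
have UE : \bigcup_k E k = [set z | l%:E < abs_radon a f z.1 z.2].
  apply/seteqP; split => z; first by move=> [k _ /andP[]].
  move=> /= h; exists (Num.bound `|z.2|) => //=; rewrite /E/= h andbT ltW//.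
  exact: archi_boundP.
have Efin k : Z n (E k) < +oo.
  apply: (@le_lt_trans _ _ (Z n (setT `*` `[(- k%:R)%R, k%:R]))).
    apply: le_measure; rewrite ?inE//; first exact: measurableX.
    by move=> z /andP[zk _]; split => //=; rewrite in_itv/= -ler_norml.
  rewrite [ltLHS]product_measure1E//.
  have ifin : mu `[(- k%:R)%R, k%:R] < +oo.
    by rewrite lebesgue_measure_itv/=; case: ifPn => // _; rewrite -EFinD ltry.
  apply: lte_mul_pinfty => //.
  by rewrite ge0_fin_numE// surface_measure_lty.
have cv := nondecreasing_cvg_mu mE (bigcup_measurable (fun k _ => mE k)) ndE (mu := Z n).
rewrite UE in cv; rewrite -(cvg_lim _ cv)//.
apply: lime_le; first by apply/cvg_ex; eexists; exact: cv.
apply: nearW => k; rewrite -[leLHS]/(Z n (E k)).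
have [m Em] : exists m, Z n (E k) = m%:E.
  by exists (fine (Z n (E k))); rewrite fineK// ge0_fin_numE// Efin.
have m0 : (0 <= m)%R by rewrite -lee_fin -Em; exact: (measure_ge0 (Z n) (E k)).
rewrite Em.
move: m0; rewrite le_eqVlt => /predU1P[<-|m0].
  by rewrite mule_ge0// ?poweR_ge0// lee_fin powR_ge0.
have h : (l * m)%:E <= (K * m `^ a)%:E * N%:E.
  rewrite -EN; apply: le_trans (hK (E k) m f (mE k) m0 Em f0 mf_).
  have iE : \int[Z n]_z (\1_(E k) z)%:E = m%:E.
    by rewrite integral_indic// setIT.
  rewrite EFinM -iE -intZl; last 3 first.
  - by move=> z; rewrite lee_fin.
  - by apply/measurable_EFinP; exact: measurable_indic.
  - by rewrite lee_fin ltW.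
  apply: le_int => z; first by rewrite -EFinM lee_fin mulr_ge0// ltW.
  rewrite indicE; case: (boolP (z \in E k)) => [/set_mem/andP[_ hz]|_].
    by rewrite mule1 mul1e ltW.
  by rewrite mule0 mul0e.
rewrite -EFinM lee_fin in h.
rewrite -(EFinM N) poweR_EFin -EFinM lee_fin.
have ma : (0 < m `^ a)%R by rewrite powR_gt0.
have h2 : (m `^ (1 - a) <= K * (N / l))%R.
  rewrite mulrA ler_pdivlMr// mulrC.
  rewrite -(ler_pM2r ma) -mulrA -powRD_gt0// subrK powRr1 ?(ltW m0)//.
  by rewrite mulrAC.
rewrite -powRM ?(ltW K0)//; last by rewrite divr_ge0// ltW.
have -> : m = ((m `^ (1 - a)) `^ (1 - a)^-1)%R.
  by rewrite -powRrM divff ?lt0r_neq0// powRr1// ltW.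
apply: ge0_ler_powR => //; first by rewrite invr_ge0 ltW.
- by rewrite nnegrE powR_ge0.
- by rewrite nnegrE mulr_ge0// ?divr_ge0// ltW.
Qed.

End weak.

(** * Complex-valued functions *)

Section complex_modulus.
Context (R : realType).
Implicit Types (x y : R) (z : R[i]).

Lemma normcE2 z : normc z = Num.sqrt (complex.Re z ^+ 2 + complex.Im z ^+ 2)%R.
Proof. by case: z. Qed.

Lemma normc_ge0 z : (0 <= normc z)%R.
Proof. by rewrite normcE2 sqrtr_ge0. Qed.

Lemma Re_le_normc z : (`|complex.Re z| <= normc z)%R.
Proof.
rewrite normcE2 -sqrtr_sqr ler_wsqrtr// lerDl; exact: sqr_ge0.
Qed.

Lemma Im_le_normc z : (`|complex.Im z| <= normc z)%R.
Proof.
rewrite normcE2 -sqrtr_sqr ler_wsqrtr// lerDr; exact: sqr_ge0.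
Qed.

Lemma normc_le_ReIm z : (normc z <= `|complex.Re z| + `|complex.Im z|)%R.
Proof.
rewrite normcE2 -(ger0_norm (addr_ge0 (normr_ge0 (complex.Re z)) (normr_ge0 (complex.Im z)))).
rewrite -sqrtr_sqr ler_wsqrtr// sqrrD !real_normK ?num_real//.
by rewrite lerD2r lerDl mulrn_wge0// mulr_ge0.
Qed.

Lemma normc_real x : normc (x%:C)%C = `|x|%R.
Proof. by rewrite normcE2/= expr0n/= addr0 sqrtr_sqr. Qed.

End complex_modulus.

Section signed_integrals.
Context d (T : measurableType d) (R : realType).

Lemma measurable_normc (f : T -> R[i]) : cmeasurable f ->
  measurable_fun setT (fun x => normc (f x)).
Proof.
move=> [mr mi]; rewrite (_ : (fun _ => _) = Num.sqrt \o
    (fun x => complex.Re (f x) ^+ 2 + complex.Im (f x) ^+ 2)%R); last first.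
  by apply/funext => x /=; rewrite normcE2.
apply: measurableT_comp; first exact: continuous_measurable_fun (@sqrt_continuous R).
by apply: measurable_funD; exact: measurable_funX.
Qed.

(** [fine] sends an infinite integral to 0, so the bound survives divergence. *)
Lemma abs_Rintegral_le (m : {measure set T -> \bar R}) (g : T -> R) :
  measurable_fun setT g ->
  (`|(\int[m]_x g x)%R|)%:E <= \int[m]_x (`|g x|)%:E.
Proof.
move=> mg; rewrite /Rintegral.
have h := le_abse_integral m measurableT (measurable_EFinT mg).
case E : (\int[m]_x (g x)%:E) h => [r| |] h //=.
all: by rewrite normr0; apply: integral_ge0 => x _; rewrite lee_fin.
Qed.

Lemma measurable_Rintegral d2 (T2 : measurableType d2)
    (m : {sigma_finite_measure set T2 -> \bar R}) (g : T -> T2 -> R) :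
  meas2 g -> measurable_fun setT (fun x => (\int[m]_y g x y)%R).
Proof.
move=> mg; rewrite /Rintegral.
apply: (measurableT_comp (f := @fine R)) => //.
under eq_fun => x do rewrite integralE.
apply: emeasurable_funB.
  apply: measurable_int => [x y|]; first exact: funepos_ge0.
  by have := measurable_funepos (measurable_EFinT mg); rewrite !unlock.
apply: measurable_int => [x y|]; first exact: funeneg_ge0.
by have := measurable_funeneg (measurable_EFinT mg); rewrite !unlock.
Qed.

End signed_integrals.

(** * Domination of R_+^a f by the absolute kernel *)

Section Rplus_bounds.
Context (R : realType).
Local Notation RR := (measurableTypeR R).
Local Notation mu := (@lebesgue_measure R).
Local Notation L := (lebesgue_tuple R).
Local Notation Z := (Zn_measure R).
Variables (n : nat) (a : R) (f : n.-tuple R -> R[i]).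
Hypothesis mf_ : cmeasurable f.
Let F x := (normc (f x))%:E.

Lemma plus_power_ge0 (X l : R) : (0 <= plus_power X l)%R.
Proof. by rewrite /plus_power; case: ifP => // _; rewrite powR_ge0. Qed.

Lemma plus_power_le (X l : R) : (plus_power X l <= `|X| `^ l)%R.
Proof. by rewrite /plus_power; case: ifP => // _; rewrite powR_ge0. Qed.

Lemma measurable_kernel :
  meas2 (fun (z : n.-tuple R * RR) (x : n.-tuple R) =>
    plus_power (z.2 - dotp x z.1) (a - 1)).
Proof. by rewrite /plus_power; mf. Qed.

Lemma Re_Rplus_integrand z x : complex.Re (Rplus_integrand a f z x) =
  (plus_power (z.2 - dotp x z.1) (a - 1) * complex.Re (f x))%R.
Proof. by rewrite /Rplus_integrand; case: (f x) => u v /=; rewrite mul0r subr0. Qed.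

Lemma Im_Rplus_integrand z x : complex.Im (Rplus_integrand a f z x) =
  (plus_power (z.2 - dotp x z.1) (a - 1) * complex.Im (f x))%R.
Proof. by rewrite /Rplus_integrand; case: (f x) => u v /=; rewrite mul0r addr0. Qed.

Lemma measurable_Re_integrand :
  meas2 (fun (z : n.-tuple R * RR) x => complex.Re (Rplus_integrand a f z x)).
Proof.
under eq_fun => w do rewrite Re_Rplus_integrand.
apply: measurable_funM; first exact: measurable_kernel.
exact: (measurableT_comp mf_.1 measurable_snd).
Qed.

Lemma measurable_Im_integrand :
  meas2 (fun (z : n.-tuple R * RR) x => complex.Im (Rplus_integrand a f z x)).
Proof.
under eq_fun => w do rewrite Im_Rplus_integrand.
apply: measurable_funM; first exact: measurable_kernel.
exact: (measurableT_comp mf_.2 measurable_snd).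
Qed.

Lemma int_Re_integrand_le z :
  \int[L n]_x (`|complex.Re (Rplus_integrand a f z x)|)%:E <= abs_radon a F z.1 z.2.
Proof.
apply: le_int => x; first by rewrite lee_fin.
rewrite Re_Rplus_integrand normrM (ger0_norm (plus_power_ge0 _ _)) -EFinM lee_fin.
by apply: ler_pM => //; [exact: plus_power_ge0|exact: plus_power_le|exact: Re_le_normc].
Qed.

Lemma int_Im_integrand_le z :
  \int[L n]_x (`|complex.Im (Rplus_integrand a f z x)|)%:E <= abs_radon a F z.1 z.2.
Proof.
apply: le_int => x; first by rewrite lee_fin.
rewrite Im_Rplus_integrand normrM (ger0_norm (plus_power_ge0 _ _)) -EFinM lee_fin.
by apply: ler_pM => //; [exact: plus_power_ge0|exact: plus_power_le|exact: Im_le_normc].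
Qed.

Lemma cintegrable_integrand z : abs_radon a F z.1 z.2 < +oo ->
  cintegrable (L n) (Rplus_integrand a f z).
Proof.
move=> Afin; split; apply/integrableP; split.
- apply: measurable_EFinT.
  exact: (measurable_fun_pair2 (z : n.-tuple R * RR) measurable_Re_integrand).
- exact: le_lt_trans (int_Re_integrand_le z) Afin.
- apply: measurable_EFinT.
  exact: (measurable_fun_pair2 (z : n.-tuple R * RR) measurable_Im_integrand).
- exact: le_lt_trans (int_Im_integrand_le z) Afin.
Qed.

(** Valid at every z, also where the defining integral diverges and the value is a default. The
    factor 2 comes from bounding the modulus by |Re| + |Im|. *)
Lemma normc_Rplus_le (z : n.-tuple R * RR) :
  (normc (Rplus a f z))%:E <= (2 * `|(Gamma a)^-1|)%:E * abs_radon a F z.1 z.2.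
Proof.
rewrite /Rplus ComplexField.Normc.normcM normc_real mulrC.
rewrite (mulrC 2%R) (EFinM `|_|%R) -muleA muleC (EFinM _ `|_|%R) lee_wpmul2r ?lee_fin//.
apply: (@le_trans _ _ (abs_radon a F z.1 z.2 + abs_radon a F z.1 z.2)).
  set c := cintegral _ _.
  apply: (@le_trans _ _ (`|complex.Re c| + `|complex.Im c|)%:E).
    by rewrite lee_fin; exact: normc_le_ReIm.
  rewrite EFinD; apply: leeD.
    apply: le_trans (int_Re_integrand_le z); apply: abs_Rintegral_le.
    exact: (measurable_fun_pair2 z measurable_Re_integrand).
  apply: le_trans (int_Im_integrand_le z); apply: abs_Rintegral_le.
  exact: (measurable_fun_pair2 z measurable_Im_integrand).
by rewrite -mule2n mule_natl.
Qed.

Lemma cmeasurable_Rplus : cmeasurable (fun z : n.-tuple R * RR => Rplus a f z).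
Proof.
have ReE z : complex.Re (Rplus a f z) =
    ((Gamma a)^-1 * \int[L n]_x complex.Re (Rplus_integrand a f z x))%R.
  by rewrite /Rplus /= mul0r subr0.
have ImE z : complex.Im (Rplus a f z) =
    ((Gamma a)^-1 * \int[L n]_x complex.Im (Rplus_integrand a f z x))%R.
  by rewrite /Rplus /= mul0r addr0.
split.
  under eq_fun => z do rewrite ReE; apply: measurable_funM => //.
  exact: measurable_Rintegral measurable_Re_integrand.
under eq_fun => z do rewrite ImE; apply: measurable_funM => //.
exact: measurable_Rintegral measurable_Im_integrand.
Qed.

End Rplus_bounds.

(** * Weak and strong type for complex-valued functions *)

Section upper_bounds.
Context (R : realType).
Local Notation RR := (measurableTypeR R).
Local Notation mu := (@lebesgue_measure R).
Local Notation L := (lebesgue_tuple R).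
Local Notation S := (surface_measure R).
Local Notation Z := (Zn_measure R).

Lemma Rplus_exists_ae n a (f : n.-tuple R -> R[i]) : cmeasurable f ->
  Z n [set z | abs_radon a (fun x => (normc (f x))%:E) z.1 z.2 = +oo] = 0 ->
  Rplus_exists a f.
Proof.
move=> mf_ Z0.
have F0 x : 0 <= (normc (f x))%:E by rewrite lee_fin normc_ge0.
have mF := measurable_EFinT (measurable_normc mf_).
have mA := measurable_abs_radon a F0 mF.
exists [set z | abs_radon a (fun x => (normc (f x))%:E) z.1 z.2 = +oo]; split => //.
  rewrite -[X in measurable X]setTI.
  exact: (mA measurableT [set +oo] (emeasurable_set1 _)).
move=> z /= hz; apply: contrapT => /eqP; rewrite -ltey => Az.
by apply: hz; exact: cintegrable_integrand.
Qed.

Lemma cLnorm_fin d (T : measurableType d) (m : {measure set T -> \bar R})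
    (r : R) (f : T -> R[i]) :
  cLnorm m r%:E f = (\int[m]_x (normc (f x))%:E `^ r) `^ r^-1.
Proof.
rewrite /cLnorm unlock; congr (_ `^ _); apply: eq_integral => x _.
by rewrite gee0_abs// lee_fin normc_ge0.
Qed.

Lemma Rplus_weak_type n (a : R) : (0 < a)%R -> (a < 1)%R ->
  exists c : R, forall f : n.-tuple R -> R[i], cLp (L n) 1%E f ->
     Rplus_exists a f /\
     forall l : R, (0 < l)%R ->
       Z n (Zn R n `&` [set z | (l < normc (Rplus a f z))%R]) <=
        c%:E * (cLnorm (L n) 1 f / l%:E) `^ (1 - a)^-1%R.
Proof.
move=> a0 a1; have [C C0 hC] := abs_radon_weak n a0 a1.
have i0 : (0 < (1 - a)^-1)%R by rewrite invr_gt0; lra.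
(* The summand 1 makes c0 positive, so that l / c0 is a level for the majorant. *)
pose c0 : R := (2 * `|(Gamma a)^-1| + 1)%R.
have c00 : (0 < c0)%R by rewrite ltr_wpDl// mulr_ge0.
exists (C * c0 `^ (1 - a)^-1)%R => f [mf_ fL].
pose F x := (normc (f x))%:E.
have F0 x : 0 <= F x by rewrite lee_fin normc_ge0.
have mF : measurable_fun setT F := measurable_EFinT (measurable_normc mf_).
have mA := measurable_abs_radon a F0 mF.
have A0 := abs_radon_ge0 a F0.
have NE : cLnorm (L n) 1 f = \int[L n]_x F x.
  by rewrite /cLnorm Lnorm1; apply: eq_integral => x _; rewrite gee0_abs//; exact: F0.
rewrite NE; rewrite NE in fL.
have N0 : 0 <= \int[L n]_x F x by nn.
have [N N_ NF] : exists2 N : R, (0 <= N)%R & \int[L n]_x F x = N%:E.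
  exists (fine (\int[L n]_x F x)); first by rewrite fine_ge0.
  by rewrite fineK// ge0_fin_numE.
rewrite NF; split.
  apply: (Rplus_exists_ae mf_); apply/eqP; rewrite eq_le measure_ge0 andbT.
  apply/lee_addgt0Pr => e e0; rewrite add0e.
  (* Here e is an arbitrary positive bound for the measure of the set where the majorant is
     infinite. At this level l the weak bound is at most e, and N + 1 keeps l positive when N =
     0. *)
  pose l := ((N + 1) / (e / C) `^ (1 - a))%R.
  have ec : (0 < e / C)%R by rewrite divr_gt0.
  have l0 : (0 < l)%R by rewrite divr_gt0 ?powR_gt0//; lra.
  apply: (@le_trans _ _ (Z n [set z | l%:E < abs_radon a F z.1 z.2])).
    apply: le_measure; rewrite ?inE.
    - rewrite -[X in measurable X]setTI.
      exact: (mA measurableT [set +oo] (emeasurable_set1 _)).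
    - have : measurable_fun setT (fun z : n.-tuple R * RR =>
        l%:E < abs_radon a F z.1 z.2) by mf.
      by move=> /(_ measurableT [set true] I); rewrite setTI.
    - by move=> z /= ->; rewrite ltry.
  apply: le_trans (hC F l l0 F0 mF) _.
  rewrite NF -(EFinM N) poweR_EFin -EFinM lee_fin.
  rewrite mulrC -ler_pdivlMr//.
  have -> : (e / C = ((e / C) `^ (1 - a)) `^ (1 - a)^-1)%R.
    by rewrite -powRrM divff ?powRr1 ?(ltW ec)// gt_eqF//; lra.
  apply: ge0_ler_powR; rewrite ?nnegrE ?(ltW i0) ?powR_ge0//.
    by rewrite divr_ge0// ltW.
  rewrite /l invf_div mulrA ler_pdivrMr; last lra.
  rewrite [leRHS]mulrC ler_wpM2r ?powR_ge0//; lra.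
move=> l l0.
have lc : (0 < l / c0)%R by rewrite divr_gt0.
apply: (@le_trans _ _ (Z n [set z | (l / c0)%:E < abs_radon a F z.1 z.2])).
  have mN : measurable_fun setT (fun z : n.-tuple R * RR => normc (Rplus a f z)).
    exact: measurable_normc (cmeasurable_Rplus a mf_).
  apply: le_measure; rewrite ?inE.
  - apply: measurableI.
      apply: measurableX => //.
      rewrite -[X in measurable X]setTI.
      exact: (measurable_enorm measurableT (measurable_set1 1%R)).
    have : measurable_fun setT (fun z : n.-tuple R * RR =>
        (l < normc (Rplus a f z))%R) by mf.
    by move=> /(_ measurableT [set true] I); rewrite setTI.
  - have : measurable_fun setT (fun z : n.-tuple R * RR =>
      (l / c0)%:E < abs_radon a F z.1 z.2) by mf.
    by move=> /(_ measurableT [set true] I); rewrite setTI.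
  - move=> z [_] /= hz; have := normc_Rplus_le a mf_ z.
    move: (A0 z.1 z.2); rewrite -/F; case: (abs_radon a F z.1 z.2) => [A| |//].
      rewrite -EFinM !lee_fin lte_fin => A_ h.
      rewrite ltr_pdivrMr// mulrC; apply: lt_le_trans hz (le_trans h _).
      by rewrite ler_wpM2r// /c0 lerDl.
    by move=> _ _; rewrite ltry.
apply: le_trans (hC F _ lc F0 mF) _.
rewrite NF inver gt_eqF// -!(EFinM N) !poweR_EFin -!EFinM lee_fin.
rewrite invf_div -mulrA ler_wpM2l ?(ltW C0)// mulrCA.
by rewrite powRM ?mulr_ge0 ?invr_ge0 ?(ltW c00) ?(ltW l0).
Qed.


Lemma Rplus_strong_type m (a r j : R) : (0 < m)%N -> (0 < a)%R -> (a < 1)%R ->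
  (1 < r)%R -> (r <= (m.+1%:R + 1) / (m.+1%:R + a))%R ->
  j = (1 - a - m.+1%:R * (1 - r^-1))%R ->
  exists c : R, forall f : m.+1.-tuple R -> R[i], cLp (L m.+1) r%:E f ->
    Rplus_exists a f /\
    cLnorm (Z m.+1) (j^-1)%:E (Rplus a f) <= c%:E * cLnorm (L m.+1) r%:E f.
Proof.
move=> m0 a0 a1 r1 rle jE; pose e := (1 - r^-1)%R.
have r0 : (0 < r)%R by lra.
have r1e : (1 - e = r^-1)%R by rewrite /e; lra.
have e0 : (0 < e)%R by rewrite /e subr_gt0 invf_lt1.
have m1 : (1 <= m%:R :> R)%R by rewrite ler1n.
have me : (m.+2%:R * e <= 1 - a)%R.
  move: rle; rewrite -!natr1 ler_pdivlMr; last lra.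
  rewrite -(ler_pM2l (_ : 0 < r^-1)%R) ?invr_gt0// mulrA mulVf ?gt_eqF// mul1r -r1e.
  by move: (m%:R)%R m1 => k k1; lra.
(* Here n >= 2 enters: 3 <= n + 1, so 3e <= (n + 1) e <= 1 - a < 1. *)
have e3 : (3 * e < 1)%R.
  have : (3 * e <= m.+2%:R * e)%R by rewrite ler_wpM2r ?(ltW e0)// ler_nat.
  by move: me; move: (m.+2%:R * e)%R => k; lra.
have j0 : (0 < j)%R.
  by rewrite jE -/e; move: me; rewrite -[m.+2%:R]natr1 mulrDl mul1r; move: (m.+1%:R * e)%R => k; lra.
have [C C0 hC] := abs_radon_strong a0 a1 e0 e3 me.
rewrite -/e in jE; rewrite -jE in hC.
pose c0 : R := (2 * `|(Gamma a)^-1|)%R.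
have c00 : (0 <= c0)%R by rewrite mulr_ge0.
exists (c0 * C `^ j)%R => f [mf_ fL].
pose F x := (normc (f x))%:E.
have F0 x : 0 <= F x by rewrite lee_fin normc_ge0.
have mF : measurable_fun setT F := measurable_EFinT (measurable_normc mf_).
have mA := measurable_abs_radon a F0 mF.
have A0 := abs_radon_ge0 a F0.
have hF := hC F F0 mF; rewrite r1e invrK in hF.
have N0 : 0 <= \int[L m.+1]_x F x `^ r by nn.
rewrite cLnorm_fin in fL *.
have Nfin : \int[L m.+1]_x F x `^ r < +oo.
  by apply: (lty_poweRy _ fL); rewrite invr_neq0// gt_eqF.
have AE : \int[Z m.+1]_z abs_radon a F z.1 z.2 `^ j^-1 =
    \int[S m.+1]_y \int[mu]_t abs_radon a F y t `^ j^-1.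
  apply: (@int_Zn R m.+1 (fun y t => abs_radon a F y t `^ j^-1)).
    by move=> y t; exact: poweR_ge0.
  exact: (measurable_poweRT (f := fun z => abs_radon a F z.1 z.2) _ mA).
have AI0 : 0 <= \int[Z m.+1]_z abs_radon a F z.1 z.2 `^ j^-1.
  by apply: int_ge0 => z; exact: poweR_ge0.
rewrite -AE in hF; split.
  apply: (Rplus_exists_ae mf_).
  (* The finite L^q norm of the majorant makes it finite a.e., and there the integral of R_+^a f
     converges absolutely. *)
  have : (Z m.+1).-integrable setT (fun z => abs_radon a F z.1 z.2 `^ j^-1).
    apply/integrableP; split.
      exact: (measurable_poweRT (f := fun z => abs_radon a F z.1 z.2) _ mA).
    under eq_integral => z _ do rewrite gee0_abs ?poweR_ge0//.
    apply: le_lt_trans hF _; apply: lte_mul_pinfty => //; first by rewrite lee_fin ltW.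
    exact: poweR_lty.
  move=> /(integrable_ae measurableT)[N [mN N00 hN]].
  apply/eqP; rewrite eq_le measure_ge0 andbT -N00.
  apply: le_measure; rewrite ?inE//.
    rewrite -[X in measurable X]setTI.
    exact: (mA measurableT [set +oo] (emeasurable_set1 _)).
  move=> z /= zE; apply: hN => /=.
  by rewrite -/F zE poweRyr ?invr_neq0 ?gt_eqF// => /(_ I).
rewrite cLnorm_fin invrK.
apply: (@le_trans _ _ (((c0 `^ j^-1)%:E * \int[Z m.+1]_z abs_radon a F z.1 z.2 `^ j^-1) `^ j)).
  apply: le_poweR; first exact: ltW.
    by apply: int_ge0 => z; exact: poweR_ge0.
  rewrite -intZl; last 3 first.
  - by move=> z; exact: poweR_ge0.
  - exact: (measurable_poweRT (f := fun z => abs_radon a F z.1 z.2) _ mA).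
  - by rewrite lee_fin powR_ge0.
  apply: le_int => z; first exact: poweR_ge0.
  rewrite -poweR_EFin -poweRM ?lee_fin//.
  apply: le_poweR; first by rewrite invr_ge0 ltW.
    by rewrite lee_fin normc_ge0.
  exact: normc_Rplus_le.
rewrite poweRM ?lee_fin ?powR_ge0// -poweR_EFin poweRVK ?gt_eqF ?lee_fin//.
rewrite (EFinM c0) -muleA. apply: lee_wpmul2l; rewrite ?lee_fin//.
apply: le_trans (le_poweR (ltW j0) AI0 hF) _.
rewrite poweRM ?lee_fin ?(ltW C0) ?poweR_ge0// poweR_EFin -poweRrM.
by rewrite mulfVK ?gt_eqF.
Qed.

End upper_bounds.

(** * Necessity *)

Section one_dimensional.
Context (R : realType).
Local Notation RR := (measurableTypeR R).
Local Notation mu := (@lebesgue_measure R).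

(** Follows from exp x >= 1 + x^2 / 2, and gives enough decay to compare with [far_unit_lty] at
    exponent 2. *)
Lemma expRN_le (x : R) : (0 < x)%R -> (expR (- x) <= 2 * x `^ (- 2))%R.
Proof.
move=> x0; have h := expR_ge1Dxn 1 (ltW x0).
have x2 : (0 < x ^+ 2)%R by rewrite exprn_gt0.
rewrite expRN powRN powR_mulrn ?(ltW x0)// -ler_pdivrMl// mulrC -invfM.
rewrite lef_pV2 ?posrE ?expR_gt0 ?mulr_gt0 ?invr_gt0 ?exprn_gt0//.
by move: h; rewrite -[2`!%N]/2%N; move: (x ^+ 2)%R (expR x) => u v; lra.
exact: expR_gt0.
Qed.

(** [Gamma] is the [fine] of an integral and would be 0 if that integral diverged, so convergence
    has to be shown as well as positivity. *)
Lemma Gamma_neq0 (a : R) : (0 < a)%R -> (a < 1)%R -> Gamma a != 0%R.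
Proof.
move=> a0 a1; pose g (x : R) := (x `^ (a - 1) * expR (- x))%:E.
have l0 : (0 < 1 - a)%R by lra.
have l1 : (1 - a < 1)%R by lra.
have g0 x : 0 <= g x by rewrite lee_fin mulr_ge0// ?powR_ge0// expR_ge0.
rewrite /Gamma /Rintegral integral_mkcond; set I := integral _ _ _.
suff [Ipos Ifin] : 0 < I /\ I < +oo.
  rewrite gt_eqF//; apply: fine_gt0; apply/andP; split => //.
have rE (D : set R) x : ((fun x0 => g x0) \_ D) x = if x \in D then g x else 0.
  by rewrite /patch.
split.
  (* Both factors of the integrand decrease, so its value at 2 is a lower bound on [1, 2]. *)
  pose c : R := (2 `^ (a - 1) * expR (- 2))%R.
  have c0 : (0 < c)%R by rewrite mulr_gt0// ?powR_gt0// expR_gt0.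
  apply: (@lt_le_trans _ _ (\int[mu]_(x in `[1%R, 2%R]) (cst c%:E) x)).
    rewrite integral_cst//= lebesgue_measure_itv/= lte_fin.
    by rewrite ifT ?ltr1n// -EFinB -EFinM lte_fin mulr_gt0// subr_gt0 ltr1n.
  rewrite integral_mkcond; apply: le_int => x; rewrite /patch.
    by case: ifP => // _; rewrite lee_fin ltW.
  case: ifPn => [|_].
    rewrite inE/= in_itv/= => /andP[x1 x2].
    have x0 : (0 < x)%R by lra.
    rewrite ifT; last by rewrite inE/= in_itv/= x0.
    rewrite lee_fin; apply: ler_pM; rewrite ?powR_ge0 ?expR_ge0//.
      have -> : (a - 1 = - (1 - a))%R by rewrite opprB.
      by apply: powRN_anti => //; exact: ltW.
    by rewrite ler_expR lerN2.
  by case: ifP => // _; exact: g0.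
pose h1 (y : RR) : \bar R := if (`|y| < 1)%R then (`|y| `^ (- (1 - a)))%:E else 0.
pose h2 (y : RR) : \bar R := if (1 <= `|y|)%R then (`|y| `^ (- 2))%:E else 0.
have h10 : nneg1 h1 by move=> y; rewrite /h1; nn.
have h20 : nneg1 h2 by move=> y; rewrite /h2; nn.
have mh1 : measurable_fun setT h1 by rewrite /h1; mf.
have mh2 : measurable_fun setT h2 by rewrite /h2; mf.
have f1 : \int[mu]_x h1 x < +oo by exact: near_unit_lty.
have f2 : \int[mu]_x h2 x < +oo by apply: far_unit_lty; rewrite ltr1n.
apply: (@le_lt_trans _ _ (\int[mu]_x (h1 x + 2%:E * h2 x))).
  apply: le_int => x; rewrite /patch; first by case: ifP => // _; exact: g0.
  case: ifPn => [|_]; last by rewrite adde_ge0// mule_ge0.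
  rewrite inE/= in_itv/= andbT => x0; rewrite /h1 /h2 gtr0_norm//.
  have [x1|x1] := ltP x 1%R.
    rewrite mule0 adde0 lee_fin -opprB -[leRHS]mulr1 ler_wpM2l ?powR_ge0//.
    by rewrite -expR0 ler_expR lerNl oppr0 ltW.
  rewrite add0e -EFinM lee_fin; apply: le_trans (expRN_le x0).
  rewrite -[leRHS]mul1r ler_wpM2r ?expR_ge0//.
  have -> : (a - 1 = - (1 - a))%R by rewrite opprB.
  rewrite [leRHS](_ : _ = 1 `^ (- (1 - a)))%R; last by rewrite powR1.
  by apply: powRN_anti => //; exact: ltW.
rewrite intD; [|nn|mf|nn|mf]; rewrite intZl; [|nn|mf|nn].
apply: lte_add_pinfty => //; exact: lte_mul_pinfty.
Qed.

(* Dilation by 2 turns J = \int_T^oo dt / t into J + \int_(T/2)^T dt / t. *)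
Lemma int_inv_infty (T : R) : (0 < T)%R ->
  \int[mu]_t (if (T <= t)%R then (t^-1)%:E else 0) = +oo.
Proof.
move=> T0; pose h (t : RR) : \bar R := if (T <= t)%R then (t `^ (-1))%:E else 0.
have hE (t : R) : (if (T <= t)%R then (t^-1)%:E else 0) = h t.
  by rewrite /h; case: ifPn => // Tt; rewrite powR_inv1//; lra.
under eq_integral => t _ do rewrite hE.
have h0 : nneg1 h by move=> t; rewrite /h; nn.
have mh : measurable_fun setT h.
  rewrite /h; apply: measurable_fun_ifT; [|mf|mf].
  by apply: (measurable_fun_ler (f := fun=> T)); [exact: measurable_cst|mid].
pose D : set R := `[(T / 2)%R, T[%classic.
have ED : mu D = (T / 2)%:E.
  rewrite lebesgue_measure_itv/= lte_fin ifT; last lra.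
  by rewrite -EFinB; congr EFin; lra.
pose k (t : RR) : \bar R := (T^-1 * \1_D t)%:E.
have k0 : nneg1 k by move=> t; rewrite lee_fin mulr_ge0// invr_ge0 ltW.
have mk : measurable_fun setT k.
  by apply/measurable_EFinP; apply: measurable_funM => //; apply: measurable_indic; exact: measurable_itv.
have kE : \int[mu]_t k t = (2^-1)%:E.
  rewrite /k; under eq_integral => t _ do rewrite EFinM.
  rewrite intZl.
  - rewrite integral_indic//; last exact: measurable_itv.
    by rewrite setIT [X in _ * X]ED -EFinM mulrA mulVf ?gt_eqF// mul1r.
  - by [].
  - by apply/measurable_EFinP; apply: measurable_indic; exact: measurable_itv.
  - by rewrite lee_fin invr_ge0 ltW.
have hk : \int[mu]_t (h t + k t) <= \int[mu]_t (2%:E * h (2 * t + 0)%R).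
  apply: le_int => t; first by rewrite adde_ge0.
  move: (t : R) => {}t; rewrite /h /k addr0 indicE.
  have [Tt|tT] := leP T t.
    rewrite ifT; last lra.
    rewrite (_ : t \in D = false); last first.
      by apply/negbTE/negP => /set_mem; rewrite /D/= in_itv/= => /andP[_]; lra.
    rewrite mulr0 adde0 -EFinM lee_fin !powR_inv1; [|lra|lra].
    by rewrite invfM mulrA divff// mul1r.
  rewrite add0e; case: (boolP (t \in D)) => [/set_mem|_]; last first.
    by rewrite mulr0; case: ifP => // _; rewrite mule_ge0// lee_fin powR_ge0.
  rewrite /D/= in_itv/= => /andP[Tt _]; rewrite ifT; last lra.
  rewrite mulr1 -EFinM lee_fin powR_inv1; last lra.
  rewrite invfM mulrA divff// mul1r lef_pV2 ?posrE//; lra.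
move: hk; rewrite intD// kE intZl; last 3 first.
- by move=> t.
- by apply: (measurableT_comp mh); mf.
- by [].
rewrite int_affine// normr_nat muleA -EFinM divff// mul1e.
have := int_ge0 mu h0; case: (\int[mu]_t h t) => [J| |]// _.
by rewrite -EFinD lee_fin => ?; exfalso; lra.
Qed.

End one_dimensional.

(** * Norms of indicators, and lower bounds for norms *)

Section norms_and_indicators.
Context d (T : measurableType d) (R : realType) (m : {measure set T -> \bar R}).

(** Stated with the reciprocal exponent, which is 0 for q = +oo, so that one formula covers all
    q. *)
Lemma cLnorm_ge (q : \bar R) (f : T -> R[i]) (B : set T) (A w : R) :
  1 <= q -> measurable B -> (0 <= A)%R -> (0 < w)%R -> w%:E <= m B ->
  (forall z, B z -> (A <= normc (f z))%R) ->
  (A * w `^ fine q^-1)%:E <= cLnorm m q f.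
Proof.
move=> q1 mB A0 w0 wB hA; case: q q1 => [q| |//].
  rewrite lee_fin => q1; have q0 : (0 < q)%R by lra.
  rewrite inver gt_eqF// cLnorm_fin EFinM.
  have -> : (A%:E : \bar R) = ((A `^ q)%:E) `^ q^-1.
    by rewrite poweR_EFin -powRrM divff ?gt_eqF// powRr1.
  rewrite -[(w `^ _)%:E]poweR_EFin -poweRM ?lee_fin ?powR_ge0 ?(ltW w0)//.
  apply: le_poweR; first by rewrite invr_ge0 ltW.
    by rewrite mule_ge0// lee_fin ?powR_ge0 ?ltW.
  apply: (@le_trans _ _ ((A `^ q)%:E * m B)).
    by rewrite lee_wpmul2l// lee_fin powR_ge0.
  rewrite -(setIT B) -integral_indic// -intZl; last 3 first.
  - by move=> x; rewrite lee_fin.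
  - by apply/measurable_EFinP; exact: measurable_indic.
  - by rewrite lee_fin powR_ge0.
  apply: le_int => x; first by rewrite mule_ge0// lee_fin powR_ge0.
  rewrite indicE; case: (boolP (x \in B)) => [/set_mem Bx|_]; last by rewrite mule0 poweR_ge0.
  rewrite mule1 -poweR_EFin; apply: le_poweR; rewrite ?lee_fin ?(ltW q0)//.
  exact: hA.
move=> _; rewrite invey/= powRr0 mulr1 /cLnorm unlock.
have mB0 : 0 < m B by apply: lt_le_trans wB; rewrite lte_fin.
rewrite ifT; last first.
  by apply: lt_le_trans mB0 _; apply: le_measure; rewrite ?inE.
rewrite leNgt; apply/negP => hlt.
have [N [mN N0 hN]] := ess_sup_inf.ess_sup_ge m (abse \o (fun x => (normc (f x))%:E)).
suff : m B <= 0 by rewrite leNgt mB0.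
rewrite -N0; apply: le_measure; rewrite ?inE// => x Bx; apply: hN => /= h.
have := le_lt_trans h hlt; rewrite lte_fin ltNge => /negP; apply.
by rewrite ger0_norm ?normc_ge0//; exact: hA.
Qed.

Definition cindic (E : set T) (x : T) : R[i] := (\1_E x)%:C%C.

Lemma cmeasurable_cindic (E : set T) : measurable E -> cmeasurable (cindic E).
Proof.
move=> mE; split; first exact: measurable_indic.
exact: measurable_cst.
Qed.

Lemma normc_cindic (E : set T) x : normc (cindic E x) = \1_E x.
Proof. by rewrite /cindic normc_real ger0_norm. Qed.

Lemma cLnorm_cindic_le (p : \bar R) (E : set T) (v : R) : 1 <= p ->
  measurable E -> m E = v%:E -> cLnorm m p (cindic E) <= (v `^ fine p^-1)%:E.
Proof.
move=> p1 mE Ev; case: p p1 => [p| |//].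
  rewrite lee_fin => p1; have p0 : (0 < p)%R by lra.
  have EI : \int[m]_x (\1_E x)%:E = v%:E by rewrite integral_indic// setIT.
  rewrite inver gt_eqF// cLnorm_fin -poweR_EFin -EI.
  rewrite le_eqVlt; apply/orP; left; apply/eqP; congr (_ `^ _).
  apply: eq_integral => x _; rewrite normc_cindic indicE poweR_EFin.
  by case: (x \in E); rewrite /= ?mulr1n ?mulr0n ?powR1// powR0// gt_eqF.
move=> _; rewrite invey/= powRr0 /cLnorm unlock.
case: ifP => // _; apply/ess_sup_inf.ess_supP; apply: nearW => x.
rewrite -[(_ \o _) x]/(`|(normc (cindic E x))%:E|) normc_cindic gee0_abs ?lee_fin//.
Qed.

End norms_and_indicators.
Arguments cindic {d T R}.

(** * Boxes in space and caps on the sphere *)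

Section boxes.
Context (R : realType).
Local Notation RR := (measurableTypeR R).
Local Notation mu := (@lebesgue_measure R).
Local Notation L := (lebesgue_tuple R).
Local Notation S := (surface_measure R).
Local Notation Z := (Zn_measure R).

(** Used both for the test boxes, with I = [-l d, l d] and r = l, and for the directions near the
    first axis, with I = [-1, 1] and r = d. *)
Definition slab m (I : set R) (r : R) : set (m.+1.-tuple R) :=
  [set x | I (tnth x ord0) /\ forall i, (`|tnth x (lift ord0 i)| <= r)%R].

Lemma measurable_slab m (I : set R) (r : R) :
  measurable I -> measurable (@slab m I r).
Proof.
move=> mI; have -> : @slab m I r = (fun x => tnth x ord0) @^-1` I `&`
    (fun x => [tuple tnth x (lift ord0 i) | i < m]) @^-1`
      [set x | forall i, (`|tnth x i| <= r)%R].
  apply/seteqP; split => x [/= x0 xr]; split => //= i.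
    by rewrite tnth_mktuple.
  by have := xr i; rewrite tnth_mktuple.
apply: measurableI; rewrite -[X in measurable X]setTI.
  exact: (measurable_tnth ord0).
have mt : measurable_fun setT
    (fun x : m.+1.-tuple R => [tuple tnth x (lift ord0 i) | i < m]).
  apply/measurable_fun_tnthP => i.
  rewrite (_ : _ \o _ = fun x => tnth x (lift ord0 i)); first exact: measurable_tnth.
  by apply/funext => x /=; rewrite tnth_mktuple.
exact: (mt measurableT _ (measurable_cube r)).
Qed.

Lemma lebesgue_slab m (I : set R) (r : R) : measurable I -> (0 <= r)%R ->
  L m.+1 (slab I r) = ((2 * r) ^+ m)%:E * mu I.
Proof.
move=> mI r0; rewrite -lebesgue_cube// -lebesgue_tuple_cons//; last exact: measurable_cube.
congr (L m.+1 _); apply/seteqP; split => x.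
  case/tupleP: x => t z [xI xr]; exists z, t; split => //= i.
  by have := xr i; rewrite tnthS.
move=> [z [t [zr It ->]]]; split; first by rewrite tnth0.
by move=> i; rewrite tnthS.
Qed.

Lemma mu_itv_cc (b c : R) : (b < c)%R -> mu `[b, c] = (c - b)%:E.
Proof. by move=> bc; rewrite lebesgue_measure_itv/= lte_fin bc -EFinB. Qed.

Lemma dotp_le n (x y : n.-tuple R) (A : R) :
  (forall i, `|tnth x i * tnth y i| <= A)%R -> (`|dotp x y| <= n%:R * A)%R.
Proof.
move=> h; apply: (le_trans (ler_norm_sum _ _ _)).
apply: (le_trans (ler_sum _ (fun i _ => h i))).
by rewrite sumr_const card_ord mulr_natl.
Qed.

(* The points with first coordinate in [1/4, 1/2] and the others of size
   d / (4n) lie in the cone over the cap. *)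
Lemma surface_slab_ge m (d : R) : (0 < d)%R -> (d <= 1)%R ->
  ((m.+1%:R * ((2 * m.+1%:R)^-1 ^+ m * 4^-1)) * d ^+ m)%:E <=
  S m.+1 (slab `[(-1)%R, 1%R] d).
Proof.
move=> d0 d1; have n0 : (0 < m.+1%:R :> R)%R by [].
have n1 : (1 <= m.+1%:R :> R)%R by rewrite ler1n.
pose r : R := (d / (4 * m.+1%:R))%R.
have r0 : (0 < r)%R by rewrite divr_gt0// mulr_gt0.
have rE : (m.+1%:R * r = d / 4)%R.
  by rewrite /r; field; rewrite gt_eqF.
have rle : (r <= d / 4)%R by rewrite -rE ler_peMl// ltW.
have -> : (m.+1%:R * ((2 * m.+1%:R)^-1 ^+ m * 4^-1) * d ^+ m =
    m.+1%:R * ((2 * r) ^+ m * (2^-1 - 4^-1)))%R.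
  have -> : (2 * r = (2 * m.+1%:R)^-1 * d)%R.
    by rewrite /r; field; rewrite gt_eqF.
  by rewrite exprMn; field.
have mI : measurable (`[(4^-1)%R, (2^-1)%R]%classic : set R) by exact: measurable_itv.
rewrite EFinM EFinM -(@mu_itv_cc (4^-1)%R (2^-1)%R); last lra.
rewrite -lebesgue_slab ?(ltW r0)// /surface_measure lee_wpmul2l//.
apply: le_measure; rewrite ?inE.
- exact: measurable_slab.
- apply: measurableI; last exact: measurable_punctured_ball.
  rewrite -[X in measurable X]setTI.
  apply: measurable_normalize => //; apply: measurable_slab; exact: measurable_itv.
move=> x [/=]; rewrite in_itv/= => /andP[x4 x2] xr.
have x0 : (4^-1 <= enorm x)%R.
  by apply: le_trans (normr_tnth_le x ord0); apply: le_trans x4 (ler_norm _).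
have e0 : (0 < enorm x)%R by lra.
split.
  split=> [|i]; rewrite tnth_mktuple.
    rewrite /= in_itv/= -ler_norml normrM normfV (gtr0_norm e0) ler_pdivrMr// mul1r.
    exact: normr_tnth_le.
  rewrite normrM normfV (gtr0_norm e0) ler_pdivrMr//; apply: le_trans (xr i) _.
  apply: le_trans rle _; rewrite ler_wpM2l// ltW//.
rewrite /punctured_ball/= e0/= /enorm -sqrtr1 ler_wsqrtr//.
rewrite /dotp big_ord_recl -!expr2.
have h1 : (tnth x ord0 ^+ 2 <= 4^-1)%R by nra.
have h2 : (\sum_(i < m) tnth x (lift ord0 i) * tnth x (lift ord0 i) <= m%:R * r)%R.
  apply: (@le_trans _ _ (\sum_(i < m) r)%R); last by rewrite sumr_const card_ord mulr_natl.
  apply: ler_sum => i _; rewrite -expr2 -real_normK ?num_real// expr2.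
  have := xr i; have := normr_ge0 (tnth x (lift ord0 i)); have : (r <= 1)%R by lra.
  by move: `|_|%R => u; nra.
have h3 : (m%:R * r <= 4^-1)%R.
  apply: (@le_trans _ _ (m.+1%:R * r)%R); first by rewrite ler_wpM2r ?(ltW r0)// ler_nat.
  by rewrite rE; lra.
have h4 := lerD h1 (le_trans h2 h3).
by apply: le_trans h4 _; lra.
Qed.

End boxes.

(** * Testing the strong bound on boxes *)

Section necessity.
Context (R : realType).
Local Notation RR := (measurableTypeR R).
Local Notation mu := (@lebesgue_measure R).
Local Notation L := (lebesgue_tuple R).
Local Notation S := (surface_measure R).
Local Notation Z := (Zn_measure R).

(** For t >= 2 rho all of E lies in the half-space x.y < t, and t - x.y is between rho and 2 t; as a
    < 1, the kernel is at least (2 t)^(a-1) on E. *)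
Lemma Rplus_cindic_ge n (a v rho t : R) (E : set (n.-tuple R)) (y : n.-tuple R) :
  (a < 1)%R -> measurable E -> L n E = v%:E -> (0 < rho)%R ->
  (forall x, E x -> (`|dotp x y| <= rho)%R) -> (2 * rho <= t)%R ->
  (`|(Gamma a)^-1| * ((2 * t) `^ (a - 1) * v) <= normc (Rplus a (cindic E) (y, t)))%R.
Proof.
move=> a1 mE Ev rho0 hE rt.
rewrite /Rplus ComplexField.Normc.normcM normc_real ler_wpM2l//.
apply: le_trans (Re_le_normc _); apply: le_trans (ler_norm _).
pose J := \int[L n]_x (complex.Re (Rplus_integrand a (cindic E) (y, t) x))%:E.
rewrite -[leRHS]/(fine J).
have EI (c : R) : (0 <= c)%R -> \int[L n]_x (c * \1_E x)%:E = (c * v)%:E.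
  move=> c0; under eq_integral => x _ do rewrite EFinM.
  rewrite intZl; last 3 first.
  - by move=> x; rewrite lee_fin.
  - by apply/measurable_EFinP; exact: measurable_indic.
  - by rewrite lee_fin.
  by rewrite integral_indic// setIT EFinM; congr (_ * _); exact: Ev.
have kE x : complex.Re (Rplus_integrand a (cindic E) (y, t) x) =
    (plus_power (t - dotp x y) (a - 1) * \1_E x)%R.
  by rewrite Re_Rplus_integrand.
have hk x : E x -> [/\ 0 < t - dotp x y, rho <= t - dotp x y & t - dotp x y <= 2 * t]%R.
  move=> Ex; have := hE x Ex; rewrite ler_norml => /andP[h1 h2].
  by split; lra.
have opp : (a - 1 = - (1 - a))%R by rewrite opprB.
have a10 : (0 <= 1 - a)%R by lra.
have lo : ((2 * t) `^ (a - 1) * v)%:E <= J.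
  rewrite -EI ?powR_ge0//; apply: le_int => x.
    by rewrite lee_fin mulr_ge0// powR_ge0.
  rewrite kE lee_fin indicE; case: (boolP (x \in E)) => [/set_mem Ex|_]; last by rewrite !mulr0.
  have [h1 h2 h3] := hk x Ex.
  by rewrite !mulr1 /plus_power h1 gtr0_norm// opp powRN_anti.
(* An infinite J would have [fine] equal to 0, so the lower bound is of use only together with
   finiteness. *)
have up : J <= (rho `^ (a - 1) * v)%:E.
  rewrite -EI ?powR_ge0//; apply: le_int => x.
    by rewrite kE lee_fin mulr_ge0// plus_power_ge0.
  rewrite kE lee_fin indicE; case: (boolP (x \in E)) => [/set_mem Ex|_]; last by rewrite !mulr0.
  have [h1 h2 h3] := hk x Ex.
  by rewrite !mulr1 /plus_power h1 gtr0_norm// opp powRN_anti.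
by rewrite -lee_fin fineK// fin_real// (lt_le_trans _ lo) ?ltNyr//= (le_lt_trans up) ?ltry.
Qed.

(** Tested on t in [2 rho, 3 rho], an interval of length rho on which 2 t <= 6 rho. *)
Lemma Rplus_cindic_cLnorm_ge n (a v rho s : R) (q : \bar R) (E D : set (n.-tuple R)) :
  (a < 1)%R -> measurable E -> L n E = v%:E -> (0 <= v)%R -> (0 < rho)%R -> 1 <= q ->
  measurable D -> (0 < s)%R -> s%:E <= S n D ->
  (forall x y, E x -> D y -> (`|dotp x y| <= rho)%R) ->
  (`|(Gamma a)^-1| * ((6 * rho) `^ (a - 1) * v) * (s * rho) `^ fine q^-1)%:E <=
  cLnorm (Z n) q (Rplus a (cindic E)).
Proof.
move=> a1 mE Ev v0 rho0 q1 mD s0 sD hED.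
have opp : (a - 1 = - (1 - a))%R by rewrite opprB.
have mI : measurable (`[(2 * rho)%R, (3 * rho)%R]%classic : set RR) by exact: measurable_itv.
apply: (@cLnorm_ge _ _ _ (Z n) q _ (D `*` `[(2 * rho)%R, (3 * rho)%R]%classic)) => //.
- exact: measurableX.
- by rewrite !mulr_ge0// powR_ge0.
- by rewrite mulr_gt0.
- have -> : Z n (D `*` `[(2 * rho)%R, (3 * rho)%R]%classic) = S n D * rho%:E.
    apply: (eq_trans (product_measure1E _ _ mD mI)); congr (_ * _).
    have r23 : (2 * rho < 3 * rho)%R by lra.
    by apply: (eq_trans (mu_itv_cc r23)); congr EFin; lra.
  by rewrite EFinM lee_wpmul2r// lee_fin ltW.
move=> [y t] [/= Dy]; rewrite in_itv/= => /andP[t2 t3].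
apply: le_trans (@Rplus_cindic_ge n a v rho t E y a1 mE Ev rho0 _ t2).
  rewrite ler_wpM2l// ler_wpM2r// opp powRN_anti//; lra.
by move=> x Ex; exact: hED.
Qed.

(** Logarithms turn the test inequality into an affine one in ln l and ln d. *)
Lemma ln_monomial_le (g x y z c b i j : R) :
  (0 < g)%R -> (0 < x)%R -> (0 < y)%R -> (0 < z)%R -> (0 <= c)%R ->
  (g * (x `^ b * y) * z `^ i <= c * y `^ j)%R ->
  (ln g + (b * ln x + ln y) + i * ln z <= ln c + j * ln y)%R.
Proof.
move=> g0 x0 y0 z0 c0 h.
have xb := powR_gt0 b x0; have zi := powR_gt0 i z0; have yj := powR_gt0 j y0.
have xy := mulr_gt0 xb y0; have gxy := mulr_gt0 g0 xy.
have cgt0 : (0 < c)%R.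
  by rewrite lt_neqAle eq_sym c0 andbT; apply/eqP => cE; move: (lt_le_trans (mulr_gt0 gxy zi) h);
    rewrite cE mul0r ltxx.
move: h; rewrite -ler_ln ?posrE ?mulr_gt0//.
by rewrite (lnM gxy zi) (lnM g0 xy) (lnM xb y0) (lnM cgt0 yj) !ln_powR.
Qed.

Section bounded.
Variables (m : nat) (a c : R) (p q : \bar R).
Hypotheses (a0 : (0 < a)%R) (a1 : (a < 1)%R) (p1 : 1 <= p) (q1 : 1 <= q).
Hypothesis bounded : forall f : m.+1.-tuple R -> R[i], cLp (L m.+1) p f ->
  cLnorm (Z m.+1) q (Rplus a f) <= c%:E * cLnorm (L m.+1) p f.
Let N : R := m.+1%:R.

(** The box is thinner by the factor d along the first axis, and the directions deviate from this
    axis by at most d, so each of the N products in x.y is at most l d; this gives rho. The measure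
    of the cap, of order d^m, is bounded below by s. *)
Lemma box_inequality (l d : R) : (0 < l)%R -> (0 < d)%R -> (d <= 1)%R ->
  let v := ((2 * l) ^+ m * (2 * (l * d)))%R in
  let rho := (N * (l * d))%R in
  let s := (N * ((2 * N)^-1 ^+ m * 4^-1) * d ^+ m)%R in
  (`|(Gamma a)^-1| * ((6 * rho) `^ (a - 1) * v) * (s * rho) `^ fine q^-1 <=
    `|c| * v `^ fine p^-1)%R : Prop.
Proof.
move=> l0 d0 d1 v rho s.
have N0 : (0 < N)%R by [].
have ld0 : (0 < l * d)%R by rewrite mulr_gt0.
have v0 : (0 < v)%R by rewrite mulr_gt0 ?exprn_gt0// mulr_gt0.
pose I : set R := `[(- (l * d))%R, (l * d)%R]%classic.
have mI : measurable I by exact: measurable_itv.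
have mE : measurable (@slab R m I l) by exact: measurable_slab.
have Ev : L m.+1 (slab I l) = v%:E.
  rewrite lebesgue_slab ?(ltW l0)// mu_itv_cc; last by lra.
  by rewrite -EFinM; congr EFin; rewrite /v; congr (_ * _)%R; lra.
have nE := cLnorm_cindic_le p1 mE Ev.
have fE : cLp (L m.+1) p (cindic (slab I l)).
  by split; [exact: cmeasurable_cindic|exact: le_lt_trans nE (ltry _)].
rewrite -lee_fin; apply: (@le_trans _ _ (cLnorm (Z m.+1) q (Rplus a (cindic (slab I l))))).
  apply: (@Rplus_cindic_cLnorm_ge _ _ _ _ _ _ _ (slab `[(-1)%R, 1%R]%classic d)) => //.
  - exact: ltW.
  - by rewrite mulr_gt0.
  - by apply: measurable_slab; exact: measurable_itv.
  - by rewrite !mulr_gt0 ?exprn_gt0 ?invr_gt0 ?mulr_gt0.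
  - exact: surface_slab_ge.
  move=> x y [xI xl] [yI yd]; apply: dotp_le => i.
  case: (unliftP ord0 i) => [j ->|->]; rewrite normrM.
    by apply: ler_pM.
  move: xI yI; rewrite /I/= !in_itv/= -!ler_norml => x1 y1.
  by rewrite -[leRHS]mulr1; apply: ler_pM.
apply: le_trans (bounded fE) _.
apply: (@le_trans _ _ (`|c|%:E * cLnorm (L m.+1) p (cindic (slab I l)))).
  apply: lee_wpmul2r; first by rewrite Lnorm_ge0.
  by rewrite lee_fin ler_norm.
by rewrite EFinM lee_wpmul2l// lee_fin.
Qed.

(** With l = exp u and d = exp w, an affine function of (u, w) is at most 0 for all u and all w <=
    0. Its coefficient in u therefore vanishes, and its coefficient in w is nonnegative. *)
Lemma bounded_exponents : (0 < m)%N ->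
  (fine q^-1 = 1 - a - N * (1 - fine p^-1))%R /\
  ((N + 1) * (1 - fine p^-1) <= 1 - a)%R.
Proof.
move=> m0; pose ip := fine p^-1; pose iq := fine q^-1; rewrite -/ip -/iq.
have N0 : (0 < N)%R by [].
have N2 : (2 <= N)%R by rewrite /N ler_nat.
have g0 : (0 < `|(Gamma a)^-1|)%R by rewrite normr_gt0 invr_neq0// Gamma_neq0.
pose k : R := (2 ^+ m * 2)%R.
have k0 : (0 < k)%R by rewrite mulr_gt0 ?exprn_gt0.
pose s0 : R := (N * ((2 * N)^-1 ^+ m * 4^-1) * N)%R.
have s00 : (0 < s0)%R by rewrite !mulr_gt0 ?exprn_gt0 ?invr_gt0 ?mulr_gt0.
pose B := (ln `|(Gamma a)^-1| + (a - 1) * ln (6 * N) + ln k + iq * ln s0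
  - ln `|c| - ip * ln k)%R.
have key u w : (w <= 0 -> B + (a - 1 + N + iq - N * ip) * u +
    (a + N * iq - ip) * w <= 0)%R.
  move=> w0; have ed : (expR w <= 1)%R by rewrite -expR0 ler_expR.
  have := box_inequality (expR_gt0 u) (expR_gt0 w) ed; rewrite /= -/ip -/iq.
  rewrite -expRD.
  have -> : ((2 * expR u) ^+ m * (2 * expR (u + w)) = k * expR (N * u + w))%R.
    rewrite exprMn -expRM_natl /k mulrACA -expRD; congr (_ * expR _)%R.
    by rewrite /N -natr1; lra.
  have -> : (N * ((2 * N)^-1 ^+ m / 4) * expR w ^+ m * (N * expR (u + w)) =
      s0 * expR (u + N * w))%R.
    rewrite -expRM_natl /s0 mulrACA -expRD; congr (_ * expR _)%R.
    by rewrite /N -natr1; lra.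
  have P0 : (0 < 6 * (N * expR (u + w)))%R by rewrite mulr_gt0// mulr_gt0// expR_gt0.
  have P2 : (0 < k * expR (N * u + w))%R by rewrite mulr_gt0// expR_gt0.
  have P3 : (0 < s0 * expR (u + N * w))%R by rewrite mulr_gt0// expR_gt0.
  move=> /(ln_monomial_le g0 P0 P2 P3 (normr_ge0 c)).
  have -> : ln (6 * (N * expR (u + w)))%R = (ln (6 * N) + (u + w))%R.
    by rewrite mulrA lnM ?expRK// posrE ?expR_gt0// mulr_gt0.
  rewrite [ln (k * _)]lnM ?posrE ?expR_gt0// [ln (s0 * _)]lnM ?posrE ?expR_gt0//.
  have arrange (A M i j x y l1 l2 l3 l4 l5 : R) :
      (l1 + (A * (l2 + (x + y)) + (l3 + (M * x + y))) + i * (l4 + (x + M * y)) <=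
        l5 + j * (l3 + (M * x + y)) ->
      l1 + A * l2 + l3 + i * l4 - l5 - j * l3 + (A + M + i - M * j) * x +
        (A + 1 + M * i - j) * y <= 0)%R by lra.
  rewrite !expRK => /arrange; rewrite subrK; exact.
have X0 : (a - 1 + N + iq - N * ip = 0)%R.
  apply/eqP; apply/negP => /negP X0.
  (* This u gives the affine function the value 1. *)
  have := key ((1 - B) / (a - 1 + N + iq - N * ip))%R 0%R (lexx _).
  by rewrite mulrC divfK// mulr0; lra.
have Y0 : (0 <= a + N * iq - ip)%R.
  rewrite leNgt; apply/negP => Y0.
  (* This w is negative and gives the affine function the value B + 1 + |B| >= 1. *)
  have := key 0%R ((1 + `|B|) / (a + N * iq - ip))%R.
  rewrite mulr0 addr0 [((_ - _) * (_ / _))%R]mulrC divfK ?lt_eqF// => h.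
  have B1 : (0 <= B + `|B|)%R by have := ler_norm (- B)%R; rewrite normrN; lra.
  have : ((1 + `|B|) / (a + N * iq - ip) <= 0)%R.
    by rewrite pmulr_rle0 ?invr_le0 ?(ltW Y0)// ltr_pwDl.
  by move=> /h; lra.
have iqE : (iq = 1 - a - N * (1 - ip))%R by lra.
split => //; move: Y0; rewrite iqE; move: N2.
(* Once iq is eliminated, the coefficient of w has the factor N - 1, which is positive because n >=
   2. *)
have factor (A M j : R) : (2 <= M -> 0 <= A + M * (1 - A - M * (1 - j)) - j ->
    (M + 1) * (1 - j) <= 1 - A)%R.
  move=> M2; have -> : (A + M * (1 - A - M * (1 - j)) - j =
      (M - 1) * (1 - A - (M + 1) * (1 - j)))%R by ring.
  by rewrite pmulr_rge0 ?subr_ge0//; lra.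
exact: factor.
Qed.

End bounded.
End necessity.

(** * Failure of the strong bound at p = 1 *)

Section endpoint.
Context (R : realType).
Local Notation RR := (measurableTypeR R).
Local Notation mu := (@lebesgue_measure R).
Local Notation L := (lebesgue_tuple R).
Local Notation S := (surface_measure R).
Local Notation Z := (Zn_measure R).

(** The cube E = [-1, 1]^n is both the support of f and the set of directions, where it contains the
    whole sphere. *)
Lemma unbounded_endpoint m (a c : R) : (0 < a)%R -> (a < 1)%R ->
  ~ (forall f : m.+1.-tuple R -> R[i], cLp (L m.+1) 1 f ->
    cLnorm (Z m.+1) ((1 - a)^-1)%:E (Rplus a f) <= c%:E * cLnorm (L m.+1) 1 f).
Proof.
move=> a0 a1 bounded; pose Q : R := ((1 - a)^-1)%R.
have l0 : (0 < 1 - a)%R by lra.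
have Q0 : (0 < Q)%R by rewrite invr_gt0.
pose I : set R := `[(-1)%R, 1%R]%classic.
have mI : measurable I by exact: measurable_itv.
pose E := @slab R m I 1%R.
have mE : measurable E by exact: measurable_slab.
pose v : R := (2 ^+ m * 2)%R.
have v0 : (0 < v)%R by rewrite mulr_gt0 ?exprn_gt0.
have Ev : L m.+1 E = v%:E.
  rewrite lebesgue_slab// mu_itv_cc; last by lra.
  by rewrite -EFinM mulr1; congr EFin; rewrite /v; congr (_ * _)%R; lra.
have nE := cLnorm_cindic_le (lexx 1) mE Ev.
have fE : cLp (L m.+1) 1 (cindic E).
  by split; [exact: cmeasurable_cindic|exact: le_lt_trans nE (ltry _)].
pose g : R := `|(Gamma a)^-1|%R.
have g0 : (0 < g)%R by rewrite normr_gt0 invr_neq0// Gamma_neq0.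
pose N : R := m.+1%:R.
have N0 : (0 < N)%R by [].
have N20 : (0 < 2 * N)%R by rewrite mulr_gt0.
have lower (y : m.+1.-tuple R) (t : R) : E y -> (2 * N <= t)%R ->
    (g * ((2 * t) `^ (a - 1) * v) <= normc (Rplus a (cindic E) (y, t)))%R.
  move=> Ey Nt; apply: (@Rplus_cindic_ge _ _ _ _ N) => //.
  move=> x Ex; rewrite -[N]mulr1; apply: dotp_le => i.
  have le1 z : E z -> (`|tnth z i| <= 1)%R.
    move=> [z0 z1]; case: (unliftP ord0 i) => [j ->|->]; first exact: z1.
    by move: z0; rewrite /I/= in_itv/= -ler_norml.
  by rewrite normrM -[leRHS]mulr1; apply: ler_pM; rewrite ?le1.
pose K : R := ((g * v) `^ Q * 2^-1)%R.
have K0 : (0 < K)%R by rewrite mulr_gt0 ?powR_gt0 ?mulr_gt0// invr_gt0.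
pose h (t : RR) : \bar R := if (2 * N <= t)%R then (t^-1)%:E else 0.
have h0 : nneg1 h.
  by move=> t; rewrite /h; case: ifPn => // Nt; rewrite lee_fin invr_ge0 (le_trans (ltW N20)).
have mh : measurable_fun setT h.
  rewrite (_ : h = fun t : RR => if (2 * N <= t)%R then (t `^ (-1))%:E else 0); last first.
    apply/funext => t; rewrite /h; case: ifPn => // Nt.
    by rewrite powR_inv1// (le_trans (ltW N20)).
  apply: measurable_fun_ifT; [|mf|mf].
  by apply: (measurable_fun_ler (f := fun=> (2 * N)%R)); [exact: measurable_cst|mid].
pose k (y : m.+1.-tuple R) : \bar R := (K * \1_E y)%:E.
have k0 : nneg1 k by move=> y; rewrite lee_fin mulr_ge0// ltW.
have mk : measurable_fun setT k.
  by apply/measurable_EFinP; apply: measurable_funM => //; exact: measurable_indic.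
have infinite : \int[Z m.+1]_z (k z.1 * h z.2) = +oo.
  rewrite (@int_Zn R m.+1 (fun y t => k y * h t)); [|nn|mf].
  under eq_integral => y _ do rewrite intZl// (int_inv_infty N20).
  rewrite intZr// gt0_muley// /k.
  under eq_integral => y _ do rewrite EFinM.
  rewrite intZl.
  - rewrite integral_indic// setIT mule_gt0 ?lte_fin//.
    apply: lt_le_trans (surface_slab_ge m ltr01 (lexx 1%R)).
    by rewrite lte_fin !mulr_gt0 ?exprn_gt0 ?invr_gt0 ?mulr_gt0.
  - by [].
  - by apply/measurable_EFinP; exact: measurable_indic.
  - by rewrite lee_fin ltW.
have finite : \int[Z m.+1]_z (normc (Rplus a (cindic E) z))%:E `^ Q < +oo.
  apply: (lty_poweRy (lt0r_neq0 l0)); rewrite -[(1 - a)%R]invrK -cLnorm_fin.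
  apply: (le_lt_trans (bounded _ fE)).
  apply: (@le_lt_trans _ _ (`|c|%:E * cLnorm (L m.+1) 1 (cindic E))).
    by apply: lee_wpmul2r; rewrite ?Lnorm_ge0// lee_fin ler_norm.
  by apply: lte_mul_pinfty => //; exact: fE.2.
move: finite; rewrite ltNge => /negP; apply; rewrite -infinite.
apply: le_int => -[y t]; first by rewrite mule_ge0.
rewrite -[leLHS]/(k y * h t) /k /h indicE; case: (boolP (y \in E)) => [/set_mem Ey|_]; last first.
  by rewrite mulr0 mul0e poweR_ge0.
case: ifPn => [Nt|_]; last by rewrite mule0 poweR_ge0.
have t0 : (0 < t)%R := lt_le_trans N20 Nt.
have t20 : (0 < 2 * t)%R by rewrite mulr_gt0.
rewrite mulr1 -EFinM poweR_EFin lee_fin.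
have -> : (K * t^-1 = (g * ((2 * t) `^ (a - 1) * v)) `^ Q)%R.
  have -> (X : R) : (g * (X * v) = (g * v) * X)%R by rewrite mulrCA mulrC.
  rewrite powRM ?powR_ge0//; last by rewrite mulr_ge0// ltW.
  rewrite -powRrM (_ : (a - 1) * Q = -1)%R; last first.
    by rewrite /Q -opprB mulNr divff// gt_eqF.
  by rewrite powR_inv1 ?(ltW t20)// invfM mulrA.
apply: ge0_ler_powR; rewrite ?nnegrE ?(ltW Q0) ?normc_ge0//; last exact: lower.
by rewrite !mulr_ge0 ?powR_ge0 ?(ltW g0) ?(ltW v0).
Qed.

End endpoint.

(** * The equivalence for the strong type *)

Lemma inve_fine (R : realType) (p : \bar R) : 1 <= p -> p^-1 = (fine p^-1)%:E.
Proof.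
case: p => [p| |//]; last by rewrite invey.
by rewrite lee_fin inver => p1; case: eqP => // p0; exfalso; lra.
Qed.

Lemma Rplus_strong_type_iff (R : realType) (n : nat) (a : R) :
  (2 <= n)%N -> (0 < a)%R -> (a < 1)%R ->
  forall p p' q : \bar R, 1 <= p -> 1 <= q -> 1 <= p' -> p^-1 + p'^-1 = 1 ->
  (exists c : R, forall f : n.-tuple R -> R[i],
     cLp (lebesgue_tuple R n) p f ->
     Rplus_exists a f /\
     cLnorm (Zn_measure R n) q (Rplus a f) <= c%:E * cLnorm (lebesgue_tuple R n) p f)
  <->
  1 < p <= ((n%:R + 1) / (n%:R + a))%:E /\ q^-1 = (1 - a)%:E - n%:R%:E / p'.
Proof.
case: n => [//|m]; rewrite ltnS => m0 ha0 ha1 p p' q p1 q1 p'1; rewrite (inve_fine p1) (inve_fine q1) (inve_fine p'1).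
rewrite -EFinD -EFinM -EFinB => -[pp'].
have -> : fine p'^-1 = (1 - fine p^-1)%R by rewrite -pp'; lra.
have N2 : (2 <= m.+1%:R :> R)%R by rewrite ler_nat.
set N : R := m.+1%:R in N2 *; split.
  move=> [c hc].
  have bounded f (fp : cLp (lebesgue_tuple R m.+1) p f) := (hc f fp).2.
  have [iqE] := bounded_exponents ha0 ha1 p1 q1 bounded m0.
  rewrite -/N => ipE; split; last by rewrite iqE.
  (* For p = +oo the condition would read n + 1 <= 1 - a. *)
  case: p p1 ipE iqE bounded {hc pp'} => [r| |//]; last first.
    by move=> _; rewrite invey/= => ipE; exfalso; lra.
  rewrite lee_fin => r1; have r0 : (0 < r)%R by lra.
  rewrite inver gt_eqF//= => ipE iqE bounded.
  apply/andP; split.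
    (* p = 1 satisfies both conditions obtained from boxes, so it has to be excluded by the separate
       counterexample. *)
    rewrite lte_fin lt_neqAle r1 andbT; apply/eqP => rE; subst r.
    have qE : q = ((1 - a)^-1)%:E.
      rewrite -[q]inveK (inve_fine q1) iqE invr1 subrr mulr0 subr0 inver gt_eqF//; lra.
    by rewrite qE in bounded; exact: (unbounded_endpoint ha0 ha1 bounded).
  rewrite lee_fin ler_pdivlMr; last lra.
  have rV : (r * r^-1 = 1)%R by rewrite divff// gt_eqF.
  have := ler_wpM2l (ltW r0) ipE.
  rewrite (_ : r * ((N + 1) * (1 - r^-1)) = (N + 1) * (r - r * r^-1))%R; last by ring.
  by rewrite rV; lra.
move=> [/andP[]]; case: p p1 pp' => [r| |//]; last by [].
rewrite lte_fin !lee_fin => _ _ r1 rle [].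
have r0 : (0 < r)%R by lra.
rewrite inver gt_eqF//= => iqE.
have qE : q = ((fine q^-1)^-1)%:E.
  (* The range of p gives 1/q >= 1/p' > 0, so q is finite. *)
  rewrite -[LHS]inveK (inve_fine q1) inver; case: eqP => // j0; exfalso.
  move: rle; rewrite ler_pdivlMr; last lra.
  have r10 : (0 < r^-1)%R by rewrite invr_gt0.
  move=> /(ler_wpM2l (ltW r10)); rewrite mulrA mulVf ?gt_eqF// mul1r.
  have : (r^-1 < 1)%R by rewrite invf_lt1.
  by move: iqE; rewrite j0; move: (r^-1)%R => i; nra.
by rewrite qE; apply: Rplus_strong_type.
Qed.

Local Close Scope ereal_scope.
Unset Implicit Arguments.

Theorem theorem6p3 (R : realType) (n : nat) (a : R)
    (hn : (2 <= n)%N) (ha0 : 0 < a) (ha1 : a < 1) :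
  (exists c : R, forall f : n.-tuple R -> R[i],
     cLp (lebesgue_tuple R n) 1%E f ->
     Rplus_exists a f /\
     forall l : R, 0 < l ->
       (Zn_measure R n
          (Zn R n `&` [set z | (l < ComplexField.Normc.normc (Rplus a f z))%R]) <=
        c%:E * (cLnorm (lebesgue_tuple R n) 1 f / l%:E) `^ (1 - a)^-1%R)%E)
  /\
  (forall p p' q : \bar R,
     (1 <= p)%E -> (1 <= q)%E -> (1 <= p')%E -> (p^-1 + p'^-1 = 1)%E ->
     (exists c : R, forall f : n.-tuple R -> R[i],
        cLp (lebesgue_tuple R n) p f ->
        Rplus_exists a f /\
        (cLnorm (Zn_measure R n) q (Rplus a f) <=
         c%:E * cLnorm (lebesgue_tuple R n) p f)%E)
     <->
     (1 < p <= ((n%:R + 1) / (n%:R + a))%:E)%E /\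
     (q^-1 = (1 - a)%:E - n%:R%:E / p')%E).
Proof.
split; first exact: Rplus_weak_type.
exact: Rplus_strong_type_iff.
Qed.
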